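(* There exist positive absolute constants $c, C, C_1, C_2$ such that for every complex-valued $q\in L^2(\mathbb{R})$, with $R=\|q\|_{L^2(\mathbb{R})}$, $$c\,e^{-C_1R}\,\|q\|_{H^{-1}(\mathbb{R})}^2\le \widetilde{\mathcal{K}}_Q\le C\,e^{C_2R}\,\|q\|_{H^{-1}(\mathbb{R})}^2 ,$$ where $Q=\begin{pmatrix}-\operatorname{Im}q&-\operatorname{Re}q\\-\operatorname{Re}q&\operatorname{Im}q\end{pmatrix}$, $N_Q$ is the solution on $\mathbb{R}$ of $JN_Q'+QN_Q=0$, $N_Q(0)=I$, and $$\widetilde{\mathcal{K}}_Q=\sum_{k\in\mathbb{Z}}\left(\det\int_k^{k+2}N_Q^*(\xi)N_Q(\xi)\,d\xi-4\right).$$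
   Context: $I$ is the $2\times2$ identity matrix and $J=\begin{pmatrix}0&-1\\1&0\end{pmatrix}$. $N_Q$ is a $2\times 2$ matrix-valued, locally absolutely continuous function. $\|f\|_{H^{-1}(\mathbb{R})}^2=\int_{\mathbb{R}}\frac{|(\mathcal{F}f)(\eta)|^2}{1+\eta^2}\,d\eta$ with $(\mathcal{F}f)(\eta)=\frac{1}{\sqrt{2\pi}}\int_{\mathbb{R}}f(x)e^{-i\eta x}\,dx$. *)

(* Defs.v *)
From HB Require Import structures.
From mathcomp Require Import all_boot all_order all_algebra.
From mathcomp Require Import all_classical all_reals all_analysis.
From mathcomp Require Import complex.

Set Implicit Arguments.
Unset Strict Implicit.
Unset Printing Implicit Defensive.

Import Order.TTheory GRing.Theory Num.Theory.
Import numFieldNormedType.Exports.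

Local Open Scope classical_set_scope.
Local Open Scope ring_scope.
Local Open Scope complex_scope.

(* Not the R[i]-valued 'Re and 'Im of numClosedFieldType. *)
Local Notation Re := complex.Re.
Local Notation Im := complex.Im.
Local Notation normc := ComplexField.Normc.normc.

Section complex_valued_functions.
Variable R : realType.
Local Notation mu := (@lebesgue_measure R).
Implicit Types (q f : R -> R[i]) (A : set R).

Definition cmeasurable f : Prop :=
  measurable_fun [set: R] (fun x => Re (f x)) /\
  measurable_fun [set: R] (fun x => Im (f x)).

Definition L2norm f : \bar R := Lnorm mu 2%:E (fun x => (normc (f x))%:E).

Definition is_L2 f : Prop := cmeasurable f /\ (L2norm f < +oo)%E.

Definition cintegral A f : R[i] :=
  (\int[mu]_(x in A) Re (f x)) +i* (\int[mu]_(x in A) Im (f x)).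

Definition cis (t : R) : R[i] := cos t +i* sin t.

Definition fourier_integral A f (eta : R) : R[i] :=
  (Num.sqrt (2 * pi))^-1%:C *
  cintegral A (fun x => f x * cis (- (eta * x))).

(* For f in L^2 the Fourier integral over R need not converge absolutely: the
   transform is the L^2-limit of the integrals over [-n, n], an element of L^2
   determined up to a null set. *)
Definition is_fourier f fhat : Prop :=
  is_L2 fhat /\
  L2norm (fun eta => fourier_integral `[- n%:R, n%:R] f eta - fhat eta)
    @[n --> \oo] --> 0%E.

(* A representative of the Fourier transform of f in L^2. *)
Definition fourier f : R -> R[i] := xget (cst 0) [set fhat | is_fourier f fhat].

Definition Hm1norm_sqr f : \bar R :=
  (\int[mu]_eta ((normc (fourier f eta)) ^+ 2 / (1 + eta ^+ 2))%:E)%E.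

End complex_valued_functions.

Section fundamental_matrix.
Variable R : realType.
Local Notation mu := (@lebesgue_measure R).

Definition abs_continuous_on (a b : R) (f : R -> R) : Prop :=
  forall e : R, 0 < e -> exists2 d : R, 0 < d &
    forall (n : nat) (x y : 'I_n -> R),
      (forall i, [/\ a <= x i, x i <= y i & y i <= b]) ->
      trivIset [set: 'I_n] (fun i => `]x i, y i[%classic) ->
      \sum_(i < n) (y i - x i) < d ->
      \sum_(i < n) `|f (y i) - f (x i)| < e.

Definition loc_abs_continuous (f : R -> R) : Prop :=
  forall a b : R, abs_continuous_on a b f.

Definition mx22 (a b c d : R) : 'M[R]_2 :=
  \matrix_(i, j) nth 0 (nth [::] [:: [:: a; b]; [:: c; d]] i) j.

Definition Jmx : 'M[R]_2 := mx22 0 (-1) 1 0.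

Definition Qmx (q : R -> R[i]) (x : R) : 'M[R]_2 :=
  mx22 (- Im (q x)) (- Re (q x))
       (- Re (q x)) (Im (q x)).

(* As Q is merely locally integrable, J N' + Q N = 0 holds almost everywhere,
   for N locally absolutely continuous. As J, Q and N(0) are real, so is N. *)
Definition is_fundamental_solution (Q N : R -> 'M[R]_2) : Prop :=
  [/\ forall i j, loc_abs_continuous (fun x => N x i j),
      {ae mu, forall x, exists2 D : 'M[R]_2,
        forall i j, is_derive x (1 : R) (fun t => N t i j) (D i j) &
        Jmx *m D + Q x *m N x = 0} &
      N 0 = 1%:M].

Definition mxintegral (A : set R) (M : R -> 'M[R]_2) : 'M[R]_2 :=
  \matrix_(i, j) \int[mu]_(x in A) M x i j.

(* N being real, N^* is N^T. The esum is the sum of the series over the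
   integers because its terms are nonnegative for the N of interest:
   tr (J Q) = 0 gives \det N = 1, and Minkowski's determinant inequality
   bounds \det (\int N^* N) below by 2 ^ 2. *)
Definition Ktilde (N : R -> 'M[R]_2) : \bar R :=
  \esum_(k in [set: int])
    (\det (mxintegral `[k%:~R, (k + 2)%:~R] (fun x => (N x)^T *m N x)) - 4)%:E.

End fundamental_matrix.

(* Main.v *)
Require Import Defs.
From HB Require Import structures.
From mathcomp Require Import all_boot all_order all_algebra.
From mathcomp Require Import all_classical all_reals all_analysis.
From mathcomp Require Import measurable_realfun complex zify ring lra.
Set Implicit Arguments.
Unset Strict Implicit.
Unset Printing Implicit Defensive.
Import Order.TTheory GRing.Theory Num.Theory.
Import numFieldNormedType.Exports.
Local Open Scope classical_set_scope.
Local Open Scope ring_scope.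
Section Basics.
Variable R : realType.
Notation mu := (@lebesgue_measure R).
Notation itg D f := (mu.-integrable D (EFin \o (f : R -> R))).
Implicit Types (D A : set R) (f g h : R -> R).

Lemma itgD D f g : measurable D -> itg D f -> itg D g -> itg D (fun x => f x + g x).
Proof. by move=> mD fi gi; exact: integrableD fi gi. Qed.

Lemma itgN D f : measurable D -> itg D f -> itg D (fun x => - f x).
Proof. by move=> mD fi; exact: integrableN fi. Qed.

Lemma itgB D f g : measurable D -> itg D f -> itg D g -> itg D (fun x => f x - g x).
Proof. by move=> mD fi gi; apply: itgD => //; exact: itgN. Qed.

Lemma itgZ D f r : measurable D -> itg D f -> itg D (fun x => r * f x).
Proof. by move=> mD fi; exact: integrableZl fi. Qed.

Lemma itg_meas D f : itg D f -> measurable_fun D f.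
Proof. by move=> /measurable_int /measurable_EFinP. Qed.

Lemma itg_abs D f : measurable D -> itg D f -> itg D (fun x => `|f x|).
Proof. by move=> mD /integrable_norm. Qed.

Lemma itg_le D f g : measurable D -> measurable_fun D f ->
  (forall x, D x -> `|f x| <= g x) -> itg D g -> itg D f.
Proof.
move=> mD mf fg; apply: le_integrable => //; first exact/measurable_EFinP.
by move=> x Dx /=; rewrite lee_fin (le_trans (fg _ Dx))// ler_norm.
Qed.

Lemma itgMb D f g M : measurable D -> itg D f -> measurable_fun D g ->
  (forall x, D x -> `|g x| <= M) -> itg D (fun x => f x * g x).
Proof.
move=> mD fi mg gM; apply: (@itg_le _ _ (fun x => M * `|f x|)) => //.
- exact: measurable_funM (itg_meas fi) mg.
- by move=> x Dx; rewrite normrM mulrC ler_wpM2r// gM.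
- exact/itgZ/itg_abs.
Qed.

Lemma itg_mono A D f : measurable A -> measurable D -> A `<=` D -> itg D f -> itg A f.
Proof. by move=> mA mD AD; exact: integrableS. Qed.

Lemma itg_cont a b f : {within `[a, b], continuous f} -> itg `[a, b] f.
Proof. by move=> cf; apply: continuous_compact_integrable => //; exact: segment_compact. Qed.

Lemma itg_bnd D f M : measurable D -> (mu D < +oo)%E -> measurable_fun D f ->
  (forall x, D x -> `|f x| <= M) -> itg D f.
Proof.
move=> mD Doo mf fM; apply: (@itg_le _ _ (fun=> M)) => //.
apply: measurable_bounded_integrable => //.
by exists M; split; [exact: num_real|move=> N MN x Dx; rewrite ltW// (le_lt_trans _ MN)// ger0_norm// (le_trans (normr_ge0 _) (fM _ Dx))].
Qed.

Lemma mu_itvcc (a b : R) : a <= b -> mu `[a, b] = (b - a)%:E.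
Proof. by move=> ab; rewrite lebesgue_measure_itv/= lte_fin; case: ltgtP ab => // ->; rewrite subrr. Qed.

Lemma mu_itv_lty (a b : R) : (mu `[a, b] < +oo)%E.
Proof. by rewrite lebesgue_measure_itv/=; case: ifP => _; rewrite ltry. Qed.

Lemma itg_cst a b r : itg `[a, b] (fun=> r).
Proof. by apply: (@itg_bnd _ _ `|r|) => //; exact: mu_itv_lty. Qed.

Lemma itg_of_sq D f g : measurable D -> measurable_fun D f -> measurable_fun D g ->
  itg D (fun x => f x ^+ 2) -> itg D (fun x => g x ^+ 2) -> itg D (fun x => f x * g x).
Proof.
move=> mD mf mg f2 g2; apply: (@itg_le _ _ (fun x => f x ^+ 2 + g x ^+ 2)) => //.
- exact: measurable_funM.
- move=> x _; rewrite normrM -(real_normK (num_real (f x))) -(real_normK (num_real (g x))).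
  move: `|f x| `|g x| => u v.
  by have := sqr_ge0 (u - v); have := sqr_ge0 (u + v); rewrite !expr2; nra.
- exact: itgD.
Qed.

Lemma le_Rint_sub A D f : measurable A -> measurable D -> A `<=` D -> itg D f ->
  (forall x, D x -> 0 <= f x) -> \int[mu]_(x in A) f x <= \int[mu]_(x in D) f x.
Proof.
move=> mA mD AD fi f0; rewrite /Rintegral fine_le//.
- exact/(integrable_fin_num _ (itg_mono mA mD AD fi)).
- exact: integrable_fin_num fi.
- apply: ge0_subset_integral => //; first exact: measurable_int fi.
Qed.

Lemma Rint_itv (a b : R) r : a <= b -> \int[mu]_(x in `[a, b]) r = r * (b - a).
Proof. by move=> ab; rewrite Rintegral_cst//; congr (_ * _); rewrite -[RHS]/(fine (b - a)%:E) -mu_itvcc. Qed.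

Lemma cauchy_schwarz D f g : measurable D -> measurable_fun D f -> measurable_fun D g ->
  itg D (fun x => f x ^+ 2) -> itg D (fun x => g x ^+ 2) ->
  (\int[mu]_(x in D) (f x * g x)) ^+ 2 <=
  (\int[mu]_(x in D) f x ^+ 2) * (\int[mu]_(x in D) g x ^+ 2).
Proof.
move=> mD mf mg f2 g2; have fg := itg_of_sq mD mf mg f2 g2.
set F := \int[mu]_(x in D) f x ^+ 2; set G := \int[mu]_(x in D) g x ^+ 2.
set H := \int[mu]_(x in D) _.
have key t : 0 <= t ^+ 2 * F + 2 * t * H + G.
  rewrite -!RintegralZl// -RintegralD//; [|exact: itgZ|exact: itgZ].
  rewrite -RintegralD//; [|by apply: itgD => //; exact: itgZ].
  apply: Rintegral_ge0 => x _.
  by rewrite (_ : _ + _ = (t * f x + g x) ^+ 2) ?sqr_ge0//; ring.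
have F0 : 0 <= F by apply: Rintegral_ge0 => x _; exact: sqr_ge0.
have G0 : 0 <= G by apply: Rintegral_ge0 => x _; exact: sqr_ge0.
have [F_eq0|Fn0] := eqVneq F 0.
  have := key (- (G + 1) / (2 * H)); rewrite F_eq0 mulr0 mul0r add0r.
  have [->|Hn0] := eqVneq H 0; first by rewrite expr0n.
  rewrite (_ : _ * H = - (G + 1)); last by field.
  by lra.
have := key (- H / F).
rewrite (_ : _ + G = G - H ^+ 2 / F); last by field.
have Fp : 0 < F by rewrite lt_def Fn0.
by rewrite subr_ge0 ler_pdivrMr// mulrC.
Qed.

End Basics.

Section AbsoluteContinuity.
Variable R : realType.
Notation mu := (@lebesgue_measure R).
Notation itg D f := (mu.-integrable D (EFin \o (f : R -> R))).
Implicit Types (f g h : R -> R) (l : seq (R * R)) (U : set R).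

Let later (p q : R * R) : bool := q.2 <= p.1.

Lemma ac_seq s e f eps : abs_continuous_on s e f -> 0 < eps ->
  exists2 d, 0 < d & forall l, all (fun p => [&& s <= p.1, p.1 <= p.2 & p.2 <= e]) l ->
    pairwise later l -> \sum_(p <- l) (p.2 - p.1) < d ->
    \sum_(p <- l) `|f p.2 - f p.1| < eps.
Proof.
move=> fac eps0; have [d d0 H] := fac _ eps0; exists d => // l /allP lse lpw.
rewrite !(big_nth (0, 0)) !big_mkord => ld.
pose x (i : 'I_(size l)) := (nth (0, 0) l i).1.
pose y (i : 'I_(size l)) := (nth (0, 0) l i).2.
apply: (H _ x y) => //.
  by move=> i; have /and3P[] := lse _ (mem_nth (0, 0) (ltn_ord i)).
have lt_disj (i j : 'I_(size l)) (z : R) : (i < j)%N ->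
    z \in `]x i, y i[ -> z \in `]x j, y j[ -> False.
  move=> ij; rewrite !in_itv/= => /andP[xi _] /andP[_ yj].
  have /(pairwiseP (0, 0)) := lpw.
  move=> /(_ i j (ltn_ord i) (ltn_ord j) ij); rewrite /later leNgt.
  by rewrite (lt_trans xi yj).
apply/trivIsetP => i j _ _ ij; apply/disj_set2P; rewrite disj_set2E; apply/eqP.
rewrite -subset0 => z /= [zi zj]; have := ij; rewrite -(inj_eq val_inj) neq_ltn.
by move=> /orP[|] /lt_disj; [move/(_ z zi zj) | move/(_ z zj zi)].
Qed.

Lemma sum_length_le l U : measurable U -> pairwise later l ->
  (forall p, p \in l -> p.1 <= p.2 /\ `]p.1, p.2[ `<=` U) ->
  ((\sum_(p <- l) (p.2 - p.1))%:E <= mu U)%E.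
Proof.
elim: l U => [|[u v] l IH] U mU; first by rewrite big_nil measure_ge0.
move=> /= /andP[/allP ul lpw] H; rewrite big_cons/=.
have [/= uv uvU] := H (u, v) (mem_head _ _).
have mU1 : measurable (U `&` `]-oo, u]) by exact: measurableI.
have -> : (v - u + \sum_(p <- l) (p.2 - p.1))%:E =
    (mu `]u, v[ + (\sum_(p <- l) (p.2 - p.1))%:E)%E.
  rewrite EFinD lebesgue_measure_itv/= lte_fin; case: ltgtP uv => // -> _.
  by rewrite subrr.
apply: (@le_trans _ _ (mu `]u, v[ + mu (U `&` `]-oo, u]))%E).
  rewrite leeD2l// IH// => p pl; have [p12 pU] := H p (mem_behead (s := _ :: _) pl).
  split => // z zp; split; first exact: pU.
  move: zp; rewrite /= !in_itv/= => /andP[_ zp2]; apply: ltW; apply: (lt_le_trans zp2).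
  exact: ul.
rewrite -measureU//; last first.
  rewrite -subset0 => z /= [+ [_]]; rewrite !in_itv/= => /andP[uz _].
  by rewrite leNgt uz.
apply: le_measure; rewrite ?inE//; first exact: measurableU.
by move=> z [/uvU//|[]].
Qed.

Lemma le_muU (A B : set R) : measurable A -> measurable B ->
  (mu (A `|` B) <= mu A + mu B)%E.
Proof. exact: (@measureU2 _ _ _ mu). Qed.

Lemma mu0U (A B : set R) : measurable A -> measurable B -> mu A = 0%E -> mu B = 0%E ->
  mu (A `|` B) = 0%E.
Proof.
move=> mA mB A0 B0; apply/eqP; rewrite eq_le measure_ge0 andbT.
by rewrite (le_trans (le_muU mA mB))// A0 B0 adde0.
Qed.

(** A tagged-partition (Cousin) argument run as a supremum *)
Lemma ac_ae_deriv0_cst s e f : s <= e -> abs_continuous_on s e f ->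
  {ae mu, forall x, s < x < e -> is_derive x (1 : R) f 0} -> f e = f s.
Proof.
move=> se fac fd; apply/eqP; rewrite -subr_eq0 -normr_le0; apply/ler_addgt0Pl => eps0 eps00.
rewrite addr0.
pose eps := eps0 / (e - s + 1).
have es1 : 0 < e - s + 1 by rewrite ltr_pwDr// subr_ge0.
have eps_gt0 : 0 < eps by rewrite divr_gt0.
have [d d0 Hd] := ac_seq fac eps_gt0.
have [Z [mZ Z0 Zsub]] := fd.
pose Z' := Z `|` [set s] `|` [set e].
have mZ' : measurable Z' by do 2 apply: measurableU => //.
have Z'0 : mu Z' = 0%E.
  apply: mu0U; rewrite ?lebesgue_measure_set1//; first exact: measurableU.
  by apply: mu0U; rewrite ?lebesgue_measure_set1.
have [U [oU Z'U muU]] := lebesgue_regularity_outer mZ' (eq_ind_r (fun z => (z < +oo)%E) (ltry _) Z'0) d0.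
have mU : measurable U by exact: open_measurable.
have muU' : (mu U < d%:E)%E.
  rewrite (_ : U = Z' `|` (U `\` Z')); last by rewrite setDUK.
  apply: (le_lt_trans (le_muU _ _)) => //; first exact: measurableD.
  by rewrite Z'0 add0e.
pose good x l := [/\ all (fun p => [&& s <= p.1, p.1 <= p.2 & p.2 <= x]) l,
  pairwise later l, (forall p, p \in l -> `]p.1, p.2[ `<=` U) &
  `|f x - f s| <= eps * (x - s) + \sum_(p <- l) `|f p.2 - f p.1| ].
pose S := [set x | s <= x <= e /\ exists l, good x l].
have good_widen x y l : x <= y -> all (fun p => [&& s <= p.1, p.1 <= p.2 & p.2 <= x]) l ->
    all (fun p => [&& s <= p.1, p.1 <= p.2 & p.2 <= y]) l.
  move=> xy /allP H; apply/allP => p /H /and3P[-> ->/= px]; exact: le_trans px xy.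
have local m : s <= m <= e -> exists2 r, 0 < r & forall x y, S x -> m - r < x ->
    x <= m -> m <= y -> y < m + r -> y <= e -> S y.
  move=> /andP[sm me]; have [mUin|mUout] := pselect (U m).
    have /nbhs_ballP[r /= r0 rU] := open_nbhs_nbhs (conj oU mUin).
    exists r => // x y [/andP[sx xe] [l [l1 l2 l3 l4]]] xr xm my yr ye.
    have xy := le_trans xm my.
    split; first by rewrite ye (le_trans sx).
    exists ((x, y) :: l); split.
    - by rewrite /= sx xy lexx/=; exact: good_widen l1.
    - rewrite /= l2 andbT; apply/allP => p pl.
      by move/allP : l1 => /(_ _ pl) /and3P[].
    - move=> p; rewrite inE => /orP[/eqP -> /= z|/l3//].
      rewrite /= in_itv/= => /andP[xz zy]; apply: rU.
      by rewrite -ball_normE/= ltr_distlC; apply/andP; split; [exact: lt_trans xr xz|exact: lt_trans zy yr].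
    - rewrite big_cons/=; have -> : f y - f s = (f y - f x) + (f x - f s) by ring.
      apply: (le_trans (ler_normD _ _)); rewrite addrCA lerD2l (le_trans l4)// lerD2r.
      by rewrite ler_pM2l// lerB.
  have smn : s < m by rewrite lt_neqAle sm andbT; apply/eqP => sm'; apply: mUout; apply: Z'U; left; right.
  have men : m < e by rewrite lt_neqAle me andbT; apply/eqP => sm'; apply: mUout; apply: Z'U; right.
  have dm : is_derive m (1 : R) f 0.
    have [//|nd] := pselect (s < m < e -> is_derive m (1 : R) f 0).
      by apply; rewrite smn men.
    exfalso; apply: mUout; apply: Z'U; left; left; exact: Zsub.
  have dcvg : h^-1 *: (f (h *: 1 + m) - f m) @[h --> 0^'] --> (0 : R).
    by have [d1 d2] := dm; rewrite -[X in _ --> X]d2; exact: d1.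
  have /cvgrPdist_lt /(_ _ eps_gt0) := dcvg.
  move=> /nbhs_ballP[r /= r0 rH].
  have lin z : `|z - m| < r -> `|f z - f m| <= eps * `|z - m|.
    move=> zr; have [->|zm] := eqVneq z m; first by rewrite !subrr normr0 mulr0.
    have zm0 : z - m != 0 by rewrite subr_eq0.
    have := rH (z - m); rewrite -ball_normE/= sub0r normrN => /(_ zr zm0).
    rewrite sub0r normrN [X in f X](_ : _ = z); last by rewrite /= /GRing.scale/= mulr1 subrK.
    rewrite normrZ normfV mulrC ltr_pdivrMr ?normr_gt0// => /ltW.
    exact.
  exists r => // x y [/andP[sx xe] [l [l1 l2 l3 l4]]] xr xm my yr ye.
  have xy := le_trans xm my.
  split; first by rewrite ye (le_trans sx).
  exists l; split => //; first exact: good_widen l1.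
  have -> : f y - f s = (f y - f m) - (f x - f m) + (f x - f s) by ring.
  apply: (le_trans (ler_normD _ _)); apply: (le_trans (lerD (ler_normB _ _) l4)).
  have /lin yl : `|y - m| < r by rewrite ger0_norm ?subr_ge0// ltrBlDl.
  have /lin xl : `|x - m| < r by rewrite ler0_norm ?subr_le0// opprB ltrBlDl -ltrBlDr.
  rewrite [in leRHS]ger0_norm ?subr_ge0// in yl.
  rewrite [in leRHS]ler0_norm ?subr_le0// in xl.
  have -> : eps * (y - s) + \sum_(p <- l) `|f p.2 - f p.1| = eps * (y - m) + eps * - (x - m) +
    (eps * (x - s) + \sum_(p <- l) `|f p.2 - f p.1|) by ring.
  by rewrite lerD2r lerD.
have Ss : S s.
  split; first by rewrite lexx se.
  by exists [::]; split => //; rewrite !subrr normr0 mulr0 big_nil addr0.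
have supS : has_sup S.
  by split; [exists s|exists e => x [/andP[]]].
pose m := sup S.
have sm : s <= m by apply: ub_le_sup => //; exact: supS.2.
have me : m <= e by apply: ge_sup; [exists s|move=> x [/andP[]]].
have [r r0 Hr] := local m (introT andP (conj sm me)).
have [x Sx xm] := sup_adherent r0 supS.
have xm' : x <= m by apply: ub_le_sup => //; exact: supS.2.
have Sy : S (Num.min e (m + r / 2)).
  apply: (Hr _ _ Sx xm xm').
  - by rewrite le_min me/= lerDl divr_ge0// ltW.
  - by rewrite gt_min; apply/orP; right; rewrite ltrD2l ltr_pdivrMr// mulr_natr mulr2n ltrDl.
  - by rewrite ge_min lexx.
have ym : Num.min e (m + r / 2) <= m by apply: ub_le_sup => //; exact: supS.2.
have em : e <= m.
  move: ym; rewrite ge_min => /orP[//|]; rewrite gerDl leNgt divr_gt0//.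
move: Sy; rewrite (_ : Num.min _ _ = e); last first.
  by apply/min_idPl; rewrite (le_trans em)// lerDl divr_ge0// ltW.
move=> [_ [l [l1 l2 l3 l4]]].
have suml : \sum_(p <- l) `|f p.2 - f p.1| < eps.
  apply: Hd => //; rewrite -lte_fin; apply: le_lt_trans muU'.
  apply: sum_length_le => // p pl; split; last exact: l3.
  by move/allP : l1 => /(_ _ pl) /and3P[].
apply: (le_trans l4); apply: (le_trans (lerD (lexx _) (ltW suml))).
by rewrite -{2}(mulr1 eps) -mulrDr /eps divfK// gt_eqF.
Qed.

End AbsoluteContinuity.

Section Primitives.
Variable R : realType.
Notation mu := (@lebesgue_measure R).
Notation itg D f := (mu.-integrable D (EFin \o (f : R -> R))).
Implicit Types (f g h : R -> R).

Definition primitive g (x : R) : R := \int[mu]_(t in `]-oo, x]) g t.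

Lemma primitiveB g x y : itg setT g -> x <= y ->
  primitive g y - primitive g x = \int[mu]_(t in `[x, y]) g t.
Proof.
move=> gi xy; have gS (i : interval R) : itg [set` i] g by exact: itg_mono gi.
by rewrite /primitive Rintegral_itvB// Rintegral_itv_obnd_cbnd.
Qed.

Lemma Rint_efin D f : measurable D -> itg D f ->
  (\int[mu]_(x in D) f x)%:E = (\int[mu]_(x in D) (f x)%:E)%E.
Proof. by move=> mD fi; rewrite fineK//; exact: integrable_fin_num fi. Qed.

Lemma itg_mkcond D f : measurable D -> itg D f <-> itg setT (f \_ D).
Proof. by move=> mD; rewrite integrable_mkcond// restrict_EFin. Qed.

Lemma sum_disjoint_Rint n (A : 'I_n -> set R) h : (forall i, measurable (A i)) ->
  trivIset setT A -> itg setT h -> (forall x, 0 <= h x) ->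
  \sum_(i < n) \int[mu]_(x in A i) h x <= \int[mu]_x h x.
Proof.
move=> mA tA hi h0; rewrite -lee_fin -sumEFin Rint_efin//.
rewrite (eq_bigr (fun i => \int[mu]_(x in A i) (h x)%:E)%E); last first.
  by move=> i _; rewrite Rint_efin//; [exact: mA|apply: itg_mono hi => //; exact: mA].
have mh : measurable_fun setT (EFin \o h) := measurable_int _ hi.
rewrite -ge0_integral_bigsetU//; first last.
- by move=> x _; rewrite lee_fin.
- exact: measurable_funS mh.
- by apply: sub_trivIset tA.
- exact: index_enum_uniq.
- apply: ge0_subset_integral => //; first by apply: bigsetU_measurable => i _; exact: mA.
  by move=> x _; rewrite lee_fin.
Qed.

(** The AM-GM inequality trades the integral of |g| over a set of small measure for a small multiple of the integral of g^2 *)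
Lemma primitive_ac s e g : measurable_fun setT g -> itg setT g ->
  itg setT (fun x => g x ^+ 2) -> abs_continuous_on s e (primitive g).
Proof.
move=> mg gi g2 eps eps0; set G := \int[mu]_x g x ^+ 2.
have G0 : 0 <= G by apply: Rintegral_ge0 => x _; exact: sqr_ge0.
pose lam := 2 * (G + 1) / eps.
have lam0 : 0 < lam by rewrite divr_gt0// mulr_gt0// ltr_wpDl.
have lamE : lam * (eps / 2) = G + 1 by rewrite /lam; field; rewrite gt_eqF.
clearbody lam.
exists (eps / (2 * lam)); first by rewrite divr_gt0// mulr_gt0.
move=> n x y xy tA sumd.
have gS (i : interval R) : itg [set` i] g by exact: itg_mono gi.
have g2S (i : interval R) : itg [set` i] (fun x => g x ^+ 2) by exact: itg_mono g2.
have term (i : 'I_n) : `|primitive g (y i) - primitive g (x i)| <=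
    lam * (y i - x i) + lam^-1 * \int[mu]_(t in `]x i, y i[) g t ^+ 2.
  have [_ xyi _] := xy i; rewrite primitiveB//.
  have ci := itg_cst (x i) (y i) lam.
  have gi2 := itgZ lam^-1 (measurable_itv _) (g2S (`[x i, y i])).
  apply: (le_trans (le_normr_Rintegral _ _)) => //.
  apply: (@le_trans _ _ (\int[mu]_(t in `[x i, y i]) (lam + lam^-1 * g t ^+ 2))).
    apply: le_Rintegral => //; [exact: itg_abs|exact: itgD|].
    move=> t _; rewrite -(real_normK (num_real (g t))).
    rewrite -(ler_pM2l lam0); move: `|g t| => u.
    rewrite (_ : lam * (lam + _) = lam ^+ 2 + u ^+ 2); last by field; rewrite gt_eqF.
    have := sqr_ge0 (lam - u); rewrite !expr2; nra.
  rewrite RintegralD// Rint_itv// RintegralZl//.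
  rewrite (_ : \int[mu]_(t in `[x i, y i]) g t ^+ 2 = \int[mu]_(t in `]x i, y i[) g t ^+ 2)//.
  rewrite -Rintegral_itv_obnd_cbnd// Rintegral_itv_bndo_bndc//.
apply: (le_lt_trans (ler_sum _ (fun i _ => term i))).
rewrite big_split/= -!mulr_sumr.
have H1 : \sum_(i < n) \int[mu]_(t in `]x i, y i[) g t ^+ 2 <= G.
  by apply: sum_disjoint_Rint => // z; exact: sqr_ge0.
have H2 : lam^-1 * (\sum_(i < n) \int[mu]_(t in `]x i, y i[) g t ^+ 2) <= eps / 2.
  apply: (@le_trans _ _ (lam^-1 * G)); first by rewrite ler_wpM2l// invr_ge0 ltW.
  by rewrite ler_pdivrMl// lamE lerDl.
have H3 : lam * (\sum_(i < n) (y i - x i)) < eps / 2.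
  move: sumd; rewrite ltr_pdivlMr ?mulr_gt0// => H; rewrite ltr_pdivlMr//; nra.
by rewrite (le_lt_trans (lerD (lexx _) H2))// [ltRHS](splitr eps) ltrD2r.
Qed.

Lemma acB s e f g : abs_continuous_on s e f -> abs_continuous_on s e g ->
  abs_continuous_on s e (fun x => f x - g x).
Proof.
move=> fac gac eps eps0; have e2 : 0 < eps / 2 by rewrite divr_gt0.
have [d1 d10 H1] := fac _ e2; have [d2 d20 H2] := gac _ e2.
exists (Num.min d1 d2); first by rewrite lt_min d10.
move=> n x y xy tA; rewrite lt_min => /andP[s1 s2].
rewrite [ltRHS](splitr eps); apply: le_lt_trans (ltrD (H1 _ _ _ xy tA s1) (H2 _ _ _ xy tA s2)).
rewrite -big_split/=; apply: ler_sum => i _.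
by rewrite (_ : _ - _ = (f (y i) - f (x i)) - (g (y i) - g (x i))) ?ler_normB//; ring.
Qed.

Lemma acM s e f g M : (forall x, s <= x <= e -> `|f x| <= M) ->
  (forall x, s <= x <= e -> `|g x| <= M) ->
  abs_continuous_on s e f -> abs_continuous_on s e g ->
  abs_continuous_on s e (fun x => f x * g x).
Proof.
move=> fM gM fac gac eps eps0; pose N := `|M| + 1.
have N0 : 0 < N by rewrite ltr_wpDl.
have e2 : 0 < eps / (2 * N) by rewrite divr_gt0// mulr_gt0.
have [d1 d10 H1] := fac _ e2; have [d2 d20 H2] := gac _ e2.
exists (Num.min d1 d2); first by rewrite lt_min d10.
move=> n x y xy tA; rewrite lt_min => /andP[s1 s2].
have K1 := H1 _ _ _ xy tA s1; have K2 := H2 _ _ _ xy tA s2.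
have -> : eps = N * (eps / (2 * N)) + N * (eps / (2 * N)).
  by field; rewrite gt_eqF.
rewrite -(ltr_pM2l N0) in K1; rewrite -(ltr_pM2l N0) in K2.
apply: le_lt_trans (ltrD K1 K2).
rewrite !mulr_sumr -big_split/=; apply: ler_sum => i _.
have [sx xyi ye] := xy i.
have -> : f (y i) * g (y i) - f (x i) * g (x i) =
  (f (y i) - f (x i)) * g (y i) + f (x i) * (g (y i) - g (x i)) by ring.
have MN : M <= N by rewrite (le_trans (ler_norm _))// lerDl.
apply: (le_trans (ler_normD _ _)); rewrite !normrM; apply: lerD.
- rewrite mulrC ler_wpM2r// (le_trans _ MN)// gM// ye andbT (le_trans sx xyi)//.
- by rewrite ler_wpM2r// (le_trans _ MN)// fM// sx (le_trans xyi ye).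
Qed.

Lemma acS s e s' e' f : s <= s' -> e' <= e -> abs_continuous_on s e f ->
  abs_continuous_on s' e' f.
Proof.
move=> ss ee fac eps eps0; have [d d0 H] := fac _ eps0; exists d => // n x y xy.
apply: H => i; have [h1 h2 h3] := xy i.
by split; [exact: le_trans h1|by []|exact: le_trans h3 ee].
Qed.

Lemma loc_ac_continuous f : loc_abs_continuous f -> continuous f.
Proof.
move=> fac x; apply/cvgrPdist_lt => eps eps0.
have [d d0 H] := fac (x - 1) (x + 1) _ eps0.
have dist u v : x - 1 <= u -> u <= v -> v <= x + 1 -> v - u < d -> `|f v - f u| < eps.
  move=> xu uv vx uvd; have := H 1%N (fun=> u) (fun=> v) => /(_ (fun=> And3 xu uv vx)).
  rewrite !big_ord1; apply => //.
  by apply/trivIsetP => i j _ _; rewrite (ord1 i) (ord1 j) eqxx.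
apply/nbhs_ballP; exists (Num.min d 1) => [|y]; first by rewrite /= lt_min d0/=.
rewrite /ball/= lt_min => /andP[]; have [xy|xy] := leP x y.
  rewrite ler0_norm ?subr_le0// opprB => h1 h2; rewrite distrC; apply: dist => //; lra.
rewrite gtr0_norm ?subr_gt0// => h1 h2; apply: dist => //; lra.
Qed.

Lemma ac_FTC s e f g : s <= e -> abs_continuous_on s e f ->
  measurable_fun `[s, e] g -> itg `[s, e] (fun x => g x ^+ 2) ->
  {ae mu, forall x, s < x < e -> is_derive x (1 : R) f (g x)} ->
  f e - f s = \int[mu]_(t in `[s, e]) g t.
Proof.
move=> se fac mg g2 fd.
have gi : itg `[s, e] g.
  apply: (@itg_le _ _ _ (fun x => 1 + g x ^+ 2)) => //.
    by move=> x _; rewrite -(real_normK (num_real (g x))); move: `|g x| => u; have := sqr_ge0 (u - 1); rewrite !expr2; nra.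
  by apply: itgD => //; exact: itg_cst.
pose h := g \_ `[s, e].
have hi : itg setT h by apply/(itg_mkcond _ _).1.
have mh : measurable_fun setT h by exact: itg_meas hi.
have h2 : itg setT (fun x => h x ^+ 2).
  rewrite (_ : (fun x => h x ^+ 2) = (fun x => g x ^+ 2) \_ `[s, e]); first by apply/(itg_mkcond _ _).1.
  by apply/funext => x; rewrite /h !patchE; case: ifP => // _; rewrite expr0n.
have -> : \int[mu]_(t in `[s, e]) g t = primitive h e - primitive h s.
  rewrite primitiveB//; apply: eq_Rintegral => x xse; by rewrite /h patchE xse.
have Pae : {ae mu, forall x, derivable (primitive h) x 1 /\ (primitive h)^`()%classic x = h x}.
  apply: FTC1Ny; first by move=> y; exact: itg_mono hi.
  apply: integrable_locally => //; exact: gi.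
suff : f e - primitive h e = f s - primitive h s by move=> H; lra.
apply: (@ac_ae_deriv0_cst _ s e (fun x => f x - primitive h x)) => //.
  by apply: acB => //; exact: primitive_ac.
apply: filterS2 fd Pae; first exact: (ae_filter_ringOfSetsType mu).
move=> x fx [dx Px] /[dup] sxe /fx {}fx.
have -> : (0 : R) = g x - g x by rewrite subrr.
apply: is_deriveB; apply: DeriveDef => //.
rewrite -derive1E Px /h patchE; case: ifPn => //; rewrite notin_setE/= in_itv/=.
by case/andP: sxe => /ltW -> /ltW ->.
Qed.

End Primitives.

Section Gronwall.
Variable R : realType.
Notation mu := (@lebesgue_measure R).
Notation itg D f := (mu.-integrable D (EFin \o (f : R -> R))).
Implicit Types (f g h : R -> R).

Lemma itg_sub s e x y f : s <= x -> y <= e -> itg `[s, e] f -> itg `[x, y] f.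
Proof.
move=> sx ye; apply: itg_mono => // z; rewrite /= !in_itv/= => /andP[xz zy].
by rewrite (le_trans sx xz) (le_trans zy ye).
Qed.

Lemma Rint_split s x e f : s <= x -> x <= e -> itg `[s, e] f ->
  \int[mu]_(t in `[s, e]) f t = \int[mu]_(t in `[s, x]) f t + \int[mu]_(t in `[x, e]) f t.
Proof.
move=> sx xe fi.
rewrite [X in _ + X](_ : _ = \int[mu]_(t in `]x, e]) f t); last first.
  by rewrite Rintegral_itv_obnd_cbnd//; apply: itg_mono fi => // z; rewrite /= !in_itv/= => /andP[/ltW xz ->]; rewrite (le_trans sx xz).
by rewrite -(Rintegral_itvB fi)// addrC subrK.
Qed.

(** [gronwall_step] absorbs the right-hand side on a piece where the weight has integral at most 1/2 *)
Lemma gronwall_step s e w h S : s <= e ->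
  itg `[s, e] w -> itg `[s, e] (fun x => w x * h x) ->
  itg `[s, e] (fun x => w x * S x) ->
  (forall x, s <= x <= e -> 0 <= w x) -> (forall x, s <= x <= e -> 0 <= S x) ->
  (forall x, s <= x <= e -> S x <= h x + \int[mu]_(t in `[s, x]) (w t * S t)) ->
  forall x y, s <= x -> x <= y -> y <= e -> \int[mu]_(t in `[x, y]) w t <= 2^-1 ->
  \int[mu]_(t in `[s, y]) (w t * S t) <=
  2 * (\int[mu]_(t in `[s, x]) (w t * S t) + \int[mu]_(t in `[x, y]) (w t * h t)).
Proof.
move=> se wi whi wSi w0 S0 HS x y sx xy ye wxy.
set Z := \int[mu]_(t in `[s, y]) (w t * S t).
have wS0 z : s <= z <= e -> 0 <= w z * S z by move=> ?; rewrite mulr_ge0 ?w0 ?S0.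
have Z0 : 0 <= Z.
  apply: Rintegral_ge0 => z; rewrite /= in_itv/= => /andP[sz zy]; apply: wS0.
  by rewrite sz (le_trans zy ye).
have sub f : itg `[s, e] f -> itg `[x, y] f by exact: itg_sub.
have := Rint_split sx xy (itg_sub (lexx s) ye wSi); rewrite -/Z => Zsplit.
have : \int[mu]_(t in `[x, y]) (w t * S t) <=
    \int[mu]_(t in `[x, y]) (w t * h t + Z * w t).
  apply: le_Rintegral => //; [exact: sub|by apply: itgD => //; [exact: sub|apply: itgZ => //; exact: sub]|].
  move=> t; rewrite /= in_itv/= => /andP[xt ty].
  have tse : s <= t <= e by rewrite (le_trans sx xt) (le_trans ty ye).
  have /andP[st te] := tse.
  have := Rint_split st ty (itg_sub (lexx s) ye wSi); rewrite -/Z => Zt.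
  have rest : 0 <= \int[mu]_(z in `[t, y]) (w z * S z).
    apply: Rintegral_ge0 => z; rewrite /= in_itv/= => /andP[tz zy]; apply: wS0.
    by rewrite (le_trans st tz) (le_trans zy ye).
  have St : S t <= h t + Z by apply: (le_trans (HS _ tse)); rewrite lerD2l Zt lerDl.
  by have := ler_wpM2l (w0 _ tse) St; rewrite mulrDr (mulrC Z).
rewrite RintegralD//; [|exact: sub|by apply: itgZ => //; exact: sub].
rewrite RintegralZl//; last exact: sub.
have : Z * \int[mu]_(t in `[x, y]) w t <= Z * 2^-1 by exact: ler_wpM2l.
move: Zsplit.
set I1 := \int[mu]_(t in `[s, x]) _; set I2 := \int[mu]_(t in `[x, y]) _.
set I3 := \int[mu]_(t in `[x, y]) (w t * h t); set I4 := _ * \int[mu]_(_ in _) _.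
lra.
Qed.

(** Cutting the interval into pieces of weight 1/2 costs a factor 2 per piece. *)
Lemma gronwall_pieces s e w h S : s <= e ->
  itg `[s, e] w -> itg `[s, e] (fun x => w x * h x) ->
  itg `[s, e] (fun x => w x * S x) ->
  (forall x, s <= x <= e -> 0 <= w x) -> (forall x, s <= x <= e -> 0 <= S x) ->
  (forall x, s <= x <= e -> 0 <= h x) ->
  (forall x, s <= x <= e -> S x <= h x + \int[mu]_(t in `[s, x]) (w t * S t)) ->
  forall m x, s <= x -> x <= e -> \int[mu]_(t in `[s, x]) w t <= m.+1%:R / 2 ->
  \int[mu]_(t in `[s, x]) (w t * S t) <= 2 ^+ m.+1 * \int[mu]_(t in `[s, x]) (w t * h t).
Proof.
move=> se wi whi wSi w0 S0 h0 HS; elim=> [|m IH] x sx xe Wx.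
  have := gronwall_step se wi whi wSi w0 S0 HS (lexx s) sx xe.
  by rewrite set_itv1 Rintegral_set1 add0r expr1; apply; rewrite -[leRHS]mul1r.
have [Wsmall|Wbig] := leP (\int[mu]_(t in `[s, x]) w t) (m.+1%:R / 2).
  apply: (le_trans (IH x sx xe Wsmall)); apply: ler_wpM2r.
    apply: Rintegral_ge0 => z; rewrite /= in_itv/= => /andP[sz zx].
    by rewrite mulr_ge0 ?w0 ?h0// sz (le_trans zx xe).
  by rewrite [leRHS]exprS ler_peMl// ?exprn_ge0// ler1n.
have [|//|t] := @IVT R (fun x => \int[mu]_(t in `[s, x]) w t) s x (m.+1%:R / 2) sx.
- by have := parameterized_integral_continuous sx (itg_sub (lexx s) xe wi).
- rewrite set_itv1 Rintegral_set1 min_l ?max_r ?divr_ge0//; first by rewrite ltW.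
  + by apply: le_trans (ltW Wbig); rewrite divr_ge0.
  + by apply: le_trans (ltW Wbig); rewrite divr_ge0.
rewrite in_itv/= => /andP[st tx] Wt.
have te := le_trans tx xe.
have := Rint_split st tx (itg_sub (lexx s) xe wi); rewrite Wt => Wsplit.
have Wtx : \int[mu]_(t in `[t, x]) w t <= 2^-1.
  by move: Wx; rewrite Wsplit -[m.+2%:R]natr1 mulrDl mul1r lerD2l.
have := gronwall_step se wi whi wSi w0 S0 HS st tx xe Wtx.
have IHt := IH t st te; rewrite Wt lexx in IHt.
rewrite (Rint_split st tx (itg_sub (lexx s) xe whi)).
have := IHt isT.
have V0 : 0 <= \int[mu]_(z in `[t, x]) (w z * h z).
  apply: Rintegral_ge0 => z; rewrite /= in_itv/= => /andP[tz zx].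
  by rewrite mulr_ge0 ?w0 ?h0// (le_trans st tz) (le_trans zx xe).
move: V0; set V2 := \int[mu]_(z in `[t, x]) _; set V1 := \int[mu]_(z in `[s, t]) (w z * h z).
set Z1 := \int[mu]_(z in `[s, t]) _; set Z2 := \int[mu]_(z in `[s, x]) _.
move=> V0 ZV ZZ; apply: (le_trans ZZ); rewrite exprS -mulrA ler_pM2l// mulrDr lerD//.
by rewrite ler_peMl// exprn_ege1// ler1n.
Qed.

Lemma gronwall s e w h S x : s <= x -> x <= e ->
  itg `[s, e] w -> itg `[s, e] (fun x => w x * h x) ->
  itg `[s, e] (fun x => w x * S x) ->
  (forall x, s <= x <= e -> 0 <= w x) -> (forall x, s <= x <= e -> 0 <= S x) ->
  (forall x, s <= x <= e -> 0 <= h x) ->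
  (forall x, s <= x <= e -> S x <= h x + \int[mu]_(t in `[s, x]) (w t * S t)) ->
  \int[mu]_(t in `[s, x]) (w t * S t) <=
  expR (2 * (\int[mu]_(t in `[s, e]) w t) + 1) * \int[mu]_(t in `[s, e]) (w t * h t).
Proof.
move=> sx xe wi whi wSi w0 S0 h0 HS; have se := le_trans sx xe.
set W := \int[mu]_(t in `[s, e]) w t.
have W0 : 0 <= W by apply: Rintegral_ge0 => z; rewrite /= in_itv/=; exact: w0.
have /andP[m1 m2] := truncn_itv (mulr_ge0 (ler0n R 2) W0).
set m := Num.truncn (2 * W) in m1 m2.
have Wx : \int[mu]_(t in `[s, x]) w t <= m.+1%:R / 2.
  apply: (@le_trans _ _ W).
    apply: le_Rint_sub => //.
      by move=> z; rewrite /= !in_itv/= => /andP[-> zx]; rewrite (le_trans zx xe).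
  by rewrite ler_pdivlMr// mulrC ltW.

apply: (le_trans (gronwall_pieces se wi whi wSi w0 S0 h0 HS sx xe Wx)).
have wh0 z : `[s, e]%classic z -> 0 <= w z * h z.
  by rewrite /= in_itv/= => zse; rewrite mulr_ge0 ?w0 ?h0.
apply: ler_pM.
- by rewrite exprn_ge0.
- apply: Rintegral_ge0 => z; rewrite /= in_itv/= => /andP[sz zx]; apply: wh0.
  by rewrite /= in_itv/= sz (le_trans zx xe).
- apply: (@le_trans _ _ (expR 1 ^+ m.+1)).
    by apply: lerXn2r; rewrite ?nnegrE ?expR_ge0//; have := expR_ge1Dx (1 : R); lra.
  by rewrite -expRM_natr ler_expR mul1r -natr1 lerD2r.
- apply: le_Rint_sub => // z; rewrite /= !in_itv/= => /andP[-> zx].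
  by rewrite (le_trans zx xe).
Qed.

End Gronwall.

Section BoundedMeasurable.
Variable R : realType.
Notation mu := (@lebesgue_measure R).
Notation itg D f := (mu.-integrable D (EFin \o (f : R -> R))).
Variables s e : R.
Implicit Types (f g h : R -> R).

Definition bounded_meas f : Prop :=
  measurable_fun `[s, e] f /\ exists M, forall x, s <= x <= e -> `|f x| <= M.

Lemma bounded_meas_cont f : {within `[s, e], continuous f} -> bounded_meas f.
Proof.
move=> cf; split.
  have : itg `[s, e] f by exact: itg_cont.
  exact: itg_meas.
have [se|es] := leP s e; last first.
  by exists 0 => x /andP[sx xe]; have := lt_le_trans es (le_trans sx xe); rewrite ltxx.
have cnf : {within `[s, e], continuous (fun x => `|f x|)}.
  by move=> x; apply: (continuous_comp (cf x)); exact: norm_continuous.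
have [c _ H] := EVT_max se cnf.
by exists `|f c| => x xse; apply: H; rewrite in_itv.
Qed.

Lemma bounded_meas_continuous f : continuous f -> bounded_meas f.
Proof. by move=> cf; apply: bounded_meas_cont; exact: continuous_subspaceT. Qed.

Lemma bounded_measD f g : bounded_meas f -> bounded_meas g ->
  bounded_meas (fun x => f x + g x).
Proof.
move=> [mf [M HM]] [mg [N HN]]; split; first exact: measurable_funD.
by exists (M + N) => x xse; rewrite (le_trans (ler_normD _ _))// lerD ?HM ?HN.
Qed.

Lemma bounded_measN f : bounded_meas f -> bounded_meas (fun x => - f x).
Proof.
move=> [mf [M HM]]; split; first exact: measurableT_comp.
by exists M => x xse; rewrite normrN HM.
Qed.

Lemma bounded_meas_abs f : bounded_meas f -> bounded_meas (fun x => `|f x|).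
Proof.
move=> [mf [M HM]]; split; first exact: measurableT_comp.
by exists M => x xse; rewrite normr_id HM.
Qed.

Lemma bounded_measM f g : bounded_meas f -> bounded_meas g ->
  bounded_meas (fun x => f x * g x).
Proof.
move=> [mf [M HM]] [mg [N HN]]; split; first exact: measurable_funM.
by exists (M * N) => x xse; rewrite normrM ler_pM ?HM ?HN.
Qed.

Lemma bounded_measX f n : bounded_meas f -> bounded_meas (fun x => f x ^+ n).
Proof.
move=> [mf [M HM]]; split; first exact: measurable_funX.
by exists (M ^+ n) => x xse; rewrite normrX lerXn2r// ?nnegrE ?HM// (le_trans _ (HM x xse)).
Qed.

Lemma bounded_meas_cst r : bounded_meas (fun=> r).
Proof. by split => //; exists `|r| => x _; rewrite lexx. Qed.

Lemma bounded_meas_itg f : bounded_meas f -> itg `[s, e] f.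
Proof.
move=> [mf [M HM]]; apply: (@itg_bnd _ _ _ M) => //; exact: mu_itv_lty.
Qed.

Lemma itgM_bounded_meas f g : itg `[s, e] f -> bounded_meas g -> itg `[s, e] (fun x => f x * g x).
Proof.
move=> fi [mg [M HM]]; exact: (@itgMb _ _ _ _ M).
Qed.

Lemma sq_itg_itg f : measurable_fun `[s, e] f -> itg `[s, e] (fun x => f x ^+ 2) -> itg `[s, e] f.
Proof.
move=> mf f2; apply: (@itg_le _ _ _ (fun x => 1 + f x ^+ 2)) => //.
  move=> x _; rewrite -(real_normK (num_real (f x))); move: `|f x| => u.
  by have := sqr_ge0 (u - 1); rewrite !expr2; nra.
by apply: itgD => //; exact: itg_cst.
Qed.

Lemma bounded_meas_int f : s <= e -> itg `[s, e] f ->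
  bounded_meas (fun x => \int[mu]_(t in `[s, x]) f t).
Proof. by move=> se fi; apply: bounded_meas_cont; exact: parameterized_integral_continuous. Qed.

End BoundedMeasurable.

Section LinearSystem.
Variable R : realType.
Notation mu := (@lebesgue_measure R).
Notation itg D f := (mu.-integrable D (EFin \o (f : R -> R))).
Variables (s e r : R) (a b A1 A2 B1 B2 : R -> R).
Hypotheses (se : s <= e) (es2 : e - s <= 2) (r0 : 0 <= r).
Hypotheses (ma : measurable_fun `[s, e] a) (mb : measurable_fun `[s, e] b).
Hypotheses (a2 : itg `[s, e] (fun x => a x ^+ 2)) (b2 : itg `[s, e] (fun x => b x ^+ 2)).
Hypothesis abr : \int[mu]_(x in `[s, e]) a x ^+ 2 + \int[mu]_(x in `[s, e]) b x ^+ 2 <= r ^+ 2.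
Hypotheses (bA1 : bounded_meas s e A1) (bA2 : bounded_meas s e A2).
Hypotheses (bB1 : bounded_meas s e B1) (bB2 : bounded_meas s e B2).
Hypothesis eA1 : forall x, s <= x <= e ->
  A1 x = 1 + \int[mu]_(t in `[s, x]) (a t * B1 t - b t * B2 t).
Hypothesis eA2 : forall x, s <= x <= e ->
  A2 x = - \int[mu]_(t in `[s, x]) (a t * B2 t + b t * B1 t).
Hypothesis eB1 : forall x, s <= x <= e ->
  B1 x = \int[mu]_(t in `[s, x]) (a t * A1 t - b t * A2 t).
Hypothesis eB2 : forall x, s <= x <= e ->
  B2 x = - \int[mu]_(t in `[s, x]) (a t * A2 t + b t * A1 t).

Let w x := `|a x| + `|b x|.
Let al x := `|A1 x - 1| + `|A2 x|.
Let be x := `|B1 x| + `|B2 x|.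
Let pa x := \int[mu]_(t in `[s, x]) a t.
Let pb x := \int[mu]_(t in `[s, x]) b t.
Let h x := `|pa x| + `|pb x|.
Let D := `[s, e]%classic.

Let mD : measurable D. Proof. exact: measurable_itv. Qed.
Let ai : itg D a. Proof. exact: sq_itg_itg. Qed.
Let bi : itg D b. Proof. exact: sq_itg_itg. Qed.
Let wi : itg D w. Proof. exact: (itgD mD (itg_abs mD ai) (itg_abs mD bi)). Qed.
Let bal : bounded_meas s e al.
Proof.
apply: bounded_measD; apply: bounded_meas_abs => //; apply: bounded_measD => //.
exact: bounded_meas_cst.
Qed.
Let bbe : bounded_meas s e be.
Proof. by apply: bounded_measD; apply: bounded_meas_abs. Qed.
Let bh : bounded_meas s e h.
Proof. by apply: bounded_measD; apply: bounded_meas_abs; exact: bounded_meas_int. Qed.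
Let w0 x : 0 <= w x. Proof. by rewrite addr_ge0. Qed.
Let al0 x : 0 <= al x. Proof. by rewrite addr_ge0. Qed.
Let be0 x : 0 <= be x. Proof. by rewrite addr_ge0. Qed.
Let h0 x : 0 <= h x. Proof. by rewrite addr_ge0. Qed.
Let wbe : itg D (fun x => w x * be x). Proof. exact: itgM_bounded_meas. Qed.
Let wal : itg D (fun x => w x * al x). Proof. exact: itgM_bounded_meas. Qed.
Let wh : itg D (fun x => w x * h x). Proof. exact: itgM_bounded_meas. Qed.

Let mw : measurable_fun D w.
Proof. exact: itg_meas. Qed.

Let wsq x : w x ^+ 2 <= 2 * (a x ^+ 2 + b x ^+ 2).
Proof.
rewrite /w -(real_normK (num_real (a x))) -(real_normK (num_real (b x))).
move: `|a x| `|b x| => u v; have := sqr_ge0 (u - v); rewrite !expr2; nra.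
Qed.

Let w2 : itg D (fun x => w x ^+ 2).
Proof.
apply: (@itg_le _ _ _ (fun x => 2 * (a x ^+ 2 + b x ^+ 2))) => //.
- exact: measurable_funX.
- by move=> x _; rewrite ger0_norm ?sqr_ge0.
- by apply: itgZ => //; exact: itgD.
Qed.

Let w2r : \int[mu]_(x in D) w x ^+ 2 <= 2 * r ^+ 2.
Proof.
apply: (@le_trans _ _ (\int[mu]_(x in D) (2 * (a x ^+ 2 + b x ^+ 2)))).
  by apply: le_Rintegral => //; apply: itgZ => //; exact: itgD.
rewrite RintegralZl//; last exact: itgD.
by rewrite RintegralD// ler_pM2l.
Qed.

Let w2_ge0 : 0 <= \int[mu]_(x in D) w x ^+ 2.
Proof. by apply: Rintegral_ge0 => x _; exact: sqr_ge0. Qed.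

Let wr : \int[mu]_(x in D) w x <= 2 * r.
Proof.
have H : (\int[mu]_(x in D) w x) ^+ 2 <= (2 * r) ^+ 2.
  have := @cauchy_schwarz R D (fun=> 1) w (measurable_itv _) _ mw _ w2.
  under eq_Rintegral do rewrite mul1r.
  move=> /(_ _ _)/le_trans; apply => //; first by rewrite expr1n; exact: itg_cst.
  rewrite expr1n Rint_itv// mul1r.
  have := ler_wpM2r w2_ge0 es2; have := w2r; rewrite exprMn; lra.
have W0 : 0 <= \int[mu]_(x in D) w x by apply: Rintegral_ge0.
by rewrite -(@ler_pXn2r _ 2)// nnegrE mulr_ge0.
Qed.

(* Both quadratic forms are controlled by w times the norm of the other pair of unknowns. *)
Let term_bound (f g u v : R -> R) x : s <= x <= e ->
  itg D (fun t => f t * u t) -> itg D (fun t => g t * v t) ->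
  itg D (fun t => `|f t| * `|u t|) -> itg D (fun t => `|g t| * `|v t|) ->
  `|\int[mu]_(t in `[s, x]) (f t * u t + g t * v t)| <=
  \int[mu]_(t in `[s, x]) (`|f t| * `|u t| + `|g t| * `|v t|).
Proof.
move=> /andP[sx xe] i1 i2 i3 i4.
have sub k : itg D k -> itg `[s, x] k by exact: itg_sub.
have i12 : itg `[s, x] (fun t => f t * u t + g t * v t) by apply: itgD => //; exact: sub.
apply: (le_trans (le_normr_Rintegral _ i12)) => //.
apply: le_Rintegral => //; first exact: itg_abs.
  by apply: itgD => //; exact: sub.
by move=> t _; rewrite (le_trans (ler_normD _ _))// !normrM.
Qed.

Let prod_itg f u : itg D f -> bounded_meas s e u ->
  itg D (fun t => f t * u t) /\ itg D (fun t => `|f t| * `|u t|).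
Proof.
move=> fi bu; split; first exact: itgM_bounded_meas.
by apply: itgM_bounded_meas; [exact: itg_abs|exact: bounded_meas_abs].
Qed.

Let pair_bound (f1 f2 g1 g2 u v : R -> R) x : s <= x <= e ->
  itg D f1 -> itg D f2 -> itg D g1 -> itg D g2 ->
  (forall t, `|f1 t| = `|a t|) -> (forall t, `|g1 t| = `|b t|) ->
  (forall t, `|f2 t| = `|a t|) -> (forall t, `|g2 t| = `|b t|) ->
  bounded_meas s e u -> bounded_meas s e v ->
  `|\int[mu]_(t in `[s, x]) (f1 t * u t + g1 t * v t)| +
  `|\int[mu]_(t in `[s, x]) (f2 t * v t + g2 t * u t)| <=
  \int[mu]_(t in `[s, x]) (w t * (`|u t| + `|v t|)).
Proof.
move=> xse i1 i2 i3 i4 e1 e2 e3 e4 bu bv.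
have [p1 p2] := prod_itg i1 bu; have [p3 p4] := prod_itg i3 bv.
have [p5 p6] := prod_itg i2 bv; have [p7 p8] := prod_itg i4 bu.
have T1 := term_bound xse p1 p3 p2 p4; have T2 := term_bound xse p5 p7 p6 p8.
apply: (le_trans (lerD T1 T2)).
have /andP[sx xe] := xse.
have sub k : itg D k -> itg `[s, x] k by exact: itg_sub.
rewrite -RintegralD//; [|by apply: itgD => //; exact: sub|by apply: itgD => //; exact: sub].
rewrite le_eqVlt; apply/orP; left; apply/eqP; apply: eq_Rintegral => t _.
by rewrite /w e1 e2 e3 e4; ring.
Qed.

Let al_le x : s <= x <= e -> al x <= \int[mu]_(t in `[s, x]) (w t * be t).
Proof.
move=> xse; rewrite /al eA1// eA2// addrAC subrr add0r normrN.
have := @pair_bound a a (fun t => - b t) b B1 B2 x xse ai ai (itgN (measurable_itv _) bi) bi.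
under eq_Rintegral do rewrite mulNr.
by apply => // t; rewrite normrN.
Qed.

Let diff_le x : s <= x <= e ->
  `|B1 x - pa x| + `|B2 x + pb x| <= \int[mu]_(t in `[s, x]) (w t * al t).
Proof.
move=> xse; have /andP[sx xe] := xse; rewrite /al eB1// eB2//.
have sub k : itg D k -> itg `[s, x] k by exact: itg_sub.
have bA1' : bounded_meas s e (fun t => A1 t - 1).
  by apply: bounded_measD => //; exact: bounded_meas_cst.
have [q1 _] := prod_itg ai bA1; have [q2 _] := prod_itg bi bA2.
have [q3 _] := prod_itg ai bA2; have [q4 _] := prod_itg bi bA1.
rewrite /pa /pb -RintegralB//; [|by apply: itgB => //; exact: sub|exact: sub].
rewrite -[X in _ + `|X|]opprK normrN opprD opprK -RintegralB//; [|by apply: itgD => //; exact: sub|exact: sub].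
have := @pair_bound a a (fun t => - b t) b (fun t => A1 t - 1) A2 x xse ai ai (itgN (measurable_itv _) bi) bi.
rewrite [X in `|X| + _](_ : _ = \int[mu]_(t in `[s, x]) (a t * A1 t - b t * A2 t - a t)); last first.
  by apply: eq_Rintegral => t _; ring.
rewrite [X in _ + `|X|](_ : _ = \int[mu]_(t in `[s, x]) (a t * A2 t + b t * A1 t - b t)); last first.
  by apply: eq_Rintegral => t _; ring.
by apply => // t; rewrite normrN.
Qed.

Let Iwbe := \int[mu]_(t in D) (w t * be t).
Let Iwh := \int[mu]_(t in D) (w t * h t).

Let int_mono (f : R -> R) x : s <= x <= e -> itg D f -> (forall t, 0 <= f t) ->
  \int[mu]_(t in `[s, x]) f t <= \int[mu]_(t in D) f t.
Proof.
move=> /andP[sx xe] fi f0; apply: le_Rint_sub => // z; rewrite /D /= !in_itv/= => /andP[-> zx].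
by rewrite (le_trans zx xe).
Qed.

Let h_le x : s <= x <= e -> h x <= be x + 2 * r * Iwbe.
Proof.
move=> xse; have /andP[sx xe] := xse.
have sub k : itg D k -> itg `[s, x] k by exact: itg_sub.
have : h x <= be x + (`|B1 x - pa x| + `|B2 x + pb x|).
  rewrite /h /be addrACA; apply: lerD.
    by rewrite -lerBlDl (le_trans (lerB_dist _ _))// distrC.
  rewrite -lerBlDl -(normrN (B2 x)) (le_trans (lerB_dist _ _))// opprK.
  by rewrite addrC.
move=> H; apply: (le_trans H); rewrite lerD2l (le_trans (diff_le xse))//.
have Iwbe0 : 0 <= Iwbe by apply: Rintegral_ge0 => t _; exact: mulr_ge0.
apply: (@le_trans _ _ (\int[mu]_(t in `[s, x]) (Iwbe * w t))).
  apply: le_Rintegral => //; [exact: sub|by apply: itgZ => //; exact: sub|].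
  move=> t; rewrite /= in_itv/= => /andP[st tx].
  have tse : s <= t <= e by rewrite st (le_trans tx xe).
  rewrite mulrC ler_wpM2r// (le_trans (al_le tse))// int_mono// => z.
  exact: mulr_ge0.
rewrite RintegralZl//; last exact: sub.
rewrite mulrC ler_wpM2r//; apply: le_trans wr; exact: int_mono.
Qed.

Let be_le x : s <= x <= e -> be x <= h x + expR (4 * r + 1) * Iwh.
Proof.
move=> xse; have /andP[sx xe] := xse.
have sub k : itg D k -> itg `[s, x] k by exact: itg_sub.
pose S t := al t + be t.
have wS : itg D (fun t => w t * S t) by apply: itgM_bounded_meas => //; exact: bounded_measD.
have HS t : s <= t <= e -> S t <= h t + \int[mu]_(z in `[s, t]) (w z * S z).
  move=> tse; have /andP[st te] := tse.
  have subt k : itg D k -> itg `[s, t] k by exact: itg_sub.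
  have -> : \int[mu]_(z in `[s, t]) (w z * S z) =
      \int[mu]_(z in `[s, t]) (w z * be z) + \int[mu]_(z in `[s, t]) (w z * al z).
    rewrite -RintegralD//; [|exact: subt|exact: subt].
    by apply: eq_Rintegral => z _; rewrite /S; ring.
  have H1 := al_le tse; have H2 := diff_le tse.
  have H3 : be t <= h t + (`|B1 t - pa t| + `|B2 t + pb t|).
    rewrite /h /be addrACA; apply: lerD.
      by rewrite -lerBlDl (le_trans (lerB_dist _ _)).
    by rewrite -lerBlDl -(normrN (pb t)) (le_trans (lerB_dist _ _))// opprK.
  by rewrite /S; lra.
have S0 t : 0 <= S t by exact: addr_ge0.
have := gronwall sx xe wi wh wS (fun x _ => w0 x) (fun x _ => S0 x) (fun x _ => h0 x) HS.
move=> G; have := HS x xse.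
have Iwh0 : 0 <= Iwh by apply: Rintegral_ge0 => t _; exact: mulr_ge0.
have E : expR (2 * (\int[mu]_(t in D) w t) + 1) * Iwh <= expR (4 * r + 1) * Iwh.
  by apply: ler_wpM2r => //; rewrite ler_expR lerD2r; have := wr; lra.
by rewrite -/Iwh in G; rewrite /S => H; have := al0 x; move: G E H; lra.
Qed.

Let int_sq (f : R -> R) : bounded_meas s e f ->
  (\int[mu]_(t in D) (w t * f t)) ^+ 2 <= 2 * r ^+ 2 * \int[mu]_(t in D) f t ^+ 2.
Proof.
move=> bf; have [mf _] := bf.
have f2 : itg D (fun x => f x ^+ 2) by apply: bounded_meas_itg; exact: bounded_measX.
apply: (le_trans (cauchy_schwarz _ mw mf w2 f2)) => //; apply: ler_wpM2r => //.
by apply: Rintegral_ge0 => x _; exact: sqr_ge0.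
Qed.

(* if f <= g + k pointwise with k constant then the integrals of the squares compare *)
Let int_sq_le (f g : R -> R) k c : bounded_meas s e f -> bounded_meas s e g -> 0 <= k ->
  (forall x, 0 <= f x) -> (forall x, s <= x <= e -> f x <= g x + k) ->
  k ^+ 2 <= c * \int[mu]_(t in D) g t ^+ 2 ->
  \int[mu]_(t in D) f t ^+ 2 <= (2 + 4 * c) * \int[mu]_(t in D) g t ^+ 2.
Proof.
move=> bf bg k0 f0 fg kc.
have g2 : itg D (fun x => g x ^+ 2) by apply: bounded_meas_itg; exact: bounded_measX.
have g2' : itg D (fun x => 2 * g x ^+ 2) by exact: itgZ.
have H : \int[mu]_(t in D) f t ^+ 2 <= \int[mu]_(t in D) (2 * g t ^+ 2 + 2 * k ^+ 2).
  apply: le_Rintegral => //.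
  - by apply: bounded_meas_itg; exact: bounded_measX.
  - by apply: itgD => //; exact: itg_cst.
  - move=> x; rewrite /D/= in_itv/= => /fg H.
    have : f x ^+ 2 <= (g x + k) ^+ 2.
      by rewrite lerXn2r ?nnegrE// (le_trans (f0 x)).
    by have := sqr_ge0 (g x - k); rewrite !expr2; nra.
apply: (le_trans H); rewrite RintegralD//; last exact: itg_cst.
rewrite RintegralZl// Rint_itv//.
have := ler_wpM2l (sqr_ge0 k) es2; move: kc.
set G := \int[mu]_(t in D) _; lra.
Qed.

Let sq2 (f g : R -> R) x : (`|f x| + `|g x|) ^+ 2 <= 2 * (f x ^+ 2 + g x ^+ 2) /\
  f x ^+ 2 + g x ^+ 2 <= (`|f x| + `|g x|) ^+ 2.
Proof.
rewrite -(real_normK (num_real (f x))) -(real_normK (num_real (g x))).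
have := normr_ge0 (f x); have := normr_ge0 (g x); move: `|f x| `|g x| => u v u0 v0.
by have := sqr_ge0 (u - v); have := mulr_ge0 u0 v0; rewrite !expr2; split; nra.
Qed.

Let int_sq2 (f g : R -> R) : bounded_meas s e f -> bounded_meas s e g ->
  \int[mu]_(t in D) (`|f t| + `|g t|) ^+ 2 <= 2 * \int[mu]_(t in D) (f t ^+ 2 + g t ^+ 2) /\
  \int[mu]_(t in D) (f t ^+ 2 + g t ^+ 2) <= \int[mu]_(t in D) (`|f t| + `|g t|) ^+ 2.
Proof.
move=> bf bg.
have i1 : itg D (fun t => f t ^+ 2 + g t ^+ 2).
  by apply: bounded_meas_itg; apply: bounded_measD; exact: bounded_measX.
have i2 : itg D (fun t => (`|f t| + `|g t|) ^+ 2).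
  by apply: bounded_meas_itg; apply: bounded_measX; apply: bounded_measD; exact: bounded_meas_abs.
split; last by apply: le_Rintegral => // x _; have [] := sq2 f g x.
rewrite -RintegralZl//; apply: le_Rintegral => //; first exact: itgZ.
by move=> x _; have [] := sq2 f g x.
Qed.

Lemma linear_system_lower :
  \int[mu]_(t in `[s, e]) (pa t ^+ 2 + pb t ^+ 2) <=
  (4 + 64 * r ^+ 4) * \int[mu]_(t in `[s, e]) (B1 t ^+ 2 + B2 t ^+ 2).
Proof.
have [_ H1] := int_sq2 (bounded_meas_int se ai) (bounded_meas_int se bi).
have [H2 _] := int_sq2 bB1 bB2.
have Iwbe0 : 0 <= Iwbe by apply: Rintegral_ge0 => t _; exact: mulr_ge0.
have k0 : 0 <= 2 * r * Iwbe by rewrite !mulr_ge0.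
have kc : (2 * r * Iwbe) ^+ 2 <= 8 * r ^+ 4 * \int[mu]_(t in D) be t ^+ 2.
  have := int_sq bbe; rewrite -/Iwbe => H.
  have r2 : 0 <= 4 * r ^+ 2 by rewrite mulr_ge0// sqr_ge0.
  have := ler_wpM2l r2 H; set X := \int[mu]_(t in D) _.
  rewrite (_ : (2 * r * Iwbe) ^+ 2 = 4 * r ^+ 2 * Iwbe ^+ 2); last by ring.
  by rewrite (_ : 8 * r ^+ 4 * X = 4 * r ^+ 2 * (2 * r ^+ 2 * X)); last by ring.
have H3 := int_sq_le bh bbe k0 h0 h_le kc.
apply: (le_trans H1); apply: (le_trans H3).
have c0 : 0 <= 2 + 4 * (8 * r ^+ 4) by rewrite addr_ge0// !mulr_ge0// exprn_ge0.
apply: (le_trans (ler_wpM2l c0 H2)); set X := \int[mu]_(t in D) _.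
by rewrite (_ : _ * (2 * X) = (4 + 64 * r ^+ 4) * X)//; ring.
Qed.

Lemma linear_system_upper :
  \int[mu]_(t in `[s, e]) (B1 t ^+ 2 + B2 t ^+ 2) <=
  (4 + 16 * expR (4 * r + 1) ^+ 2 * r ^+ 2) *
    \int[mu]_(t in `[s, e]) (pa t ^+ 2 + pb t ^+ 2).
Proof.
have [H2 _] := int_sq2 (bounded_meas_int se ai) (bounded_meas_int se bi).
have [_ H1] := int_sq2 bB1 bB2.
have Iwh0 : 0 <= Iwh by apply: Rintegral_ge0 => t _; exact: mulr_ge0.
have k0 : 0 <= expR (4 * r + 1) * Iwh by rewrite mulr_ge0// expR_ge0.
have kc : (expR (4 * r + 1) * Iwh) ^+ 2 <=
    2 * expR (4 * r + 1) ^+ 2 * r ^+ 2 * \int[mu]_(t in D) h t ^+ 2.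
  have := int_sq bh; rewrite -/Iwh => H.
  have := ler_wpM2l (sqr_ge0 (expR (4 * r + 1))) H; set X := \int[mu]_(t in D) _.
  move: (expR _) => E.
  rewrite (_ : (E * Iwh) ^+ 2 = E ^+ 2 * Iwh ^+ 2); last by ring.
  by rewrite (_ : 2 * E ^+ 2 * r ^+ 2 * X = E ^+ 2 * (2 * r ^+ 2 * X)); last by ring.
have H3 := int_sq_le bbe bh k0 be0 be_le kc.
apply: (le_trans H1); apply: (le_trans H3).
have c0 : 0 <= 2 + 4 * (2 * expR (4 * r + 1) ^+ 2 * r ^+ 2).
  by rewrite addr_ge0// !mulr_ge0// ?sqr_ge0.
apply: (le_trans (ler_wpM2l c0 H2)); set X := \int[mu]_(t in D) _; move: (expR _) => E.
by rewrite (_ : _ * (2 * X) = (4 + 16 * E ^+ 2 * r ^+ 2) * X)//; ring.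
Qed.

End LinearSystem.

Section FubiniTools.
Variable R : realType.
Notation mu := (@lebesgue_measure R).
Notation itg D f := (mu.-integrable D (EFin \o (f : R -> R))).
Implicit Types (f g h : R -> R).

Lemma emeasurable_param (f : R * R -> \bar R) : measurable_fun setT f ->
  measurable_fun setT (fun x => \int[mu]_y f (x, y))%E.
Proof.
move=> mf.
have E x : (\int[mu]_y f (x, y) = \int[mu]_y f^\+ (x, y) - \int[mu]_y f^\- (x, y))%E.
  rewrite [LHS]integralE.
  under eq_integral do rewrite funepos_comp/=.
  by under [X in (_ - X = _)%E]eq_integral do rewrite funeneg_comp/=.
rewrite (funext E); apply: emeasurable_funB.
- exact: (@measurable_fun_fubini_tonelli_F _ _ _ _ R mu _ (measurable_funepos mf)).
- exact: (@measurable_fun_fubini_tonelli_F _ _ _ _ R mu _ (measurable_funeneg mf)).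
Qed.

Lemma measurable_param (h : R * R -> R) : measurable_fun setT h ->
  measurable_fun setT (fun x => \int[mu]_y h (x, y)).
Proof.
move=> /measurable_EFinP /emeasurable_param mh.
rewrite -[X in measurable_fun _ X]/(fine \o (fun x => \int[mu]_y (EFin \o h) (x, y))%E).
by apply: measurableT_comp mh; exact: fine_measurable.
Qed.

Lemma fubini_bounded f g (k : R * R -> R) M : itg setT f -> itg setT g ->
  measurable_fun setT k -> (forall p, `|k p| <= M) ->
  \int[mu]_x (f x * \int[mu]_y (g y * k (x, y))) =
  \int[mu]_y (g y * \int[mu]_x (f x * k (x, y))).
Proof.
move=> fi gi mk kM.
have M0 : 0 <= M by rewrite (le_trans _ (kM (0, 0))).
have mf := itg_meas fi; have mg := itg_meas gi.
have mk1 x : measurable_fun setT (fun y => k (x, y)) by exact: measurable_fun_pair2.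
have mk2 y : measurable_fun setT (fun x => k (x, y)) by exact: measurable_fun_pair1.
have gk x : itg setT (fun y => g y * k (x, y)) by exact: itgMb.
have fk y : itg setT (fun x => f x * k (x, y)) by exact: itgMb.
pose F (p : R * R) := (f p.1 * (g p.2 * k p))%:E.
have mF : measurable_fun setT F.
  apply/measurable_EFinP; apply: measurable_funM; first exact: measurableT_comp.
  by apply: measurable_funM => //; exact: measurableT_comp.
have iF : (mu \x mu)%E.-integrable setT F.
  apply: (@integrable12ltyP _ _ _ _ R mu mu F mF).2.
  apply: (@le_lt_trans _ _ (\int[mu]_x (`|f x| * (M * \int[mu]_y `|g y|))%:E)%E).
    apply: ge0_le_integral => //.
    - by move=> x _; apply: integral_ge0.
    - apply: (@measurable_fun_fubini_tonelli_F _ _ _ _ R mu (fun p => `|F p|%E)) => //.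
      exact: measurableT_comp.
    - apply/measurable_EFinP; apply: measurable_funM => //; exact: measurableT_comp.
    - move=> x _; rewrite /F/=.
      have -> : (\int[mu]_y `|(f x * (g y * k (x, y)))%:E| = (\int[mu]_y (`|f x| * `|g y * k (x, y)|))%:E)%E.
        rewrite Rint_efin//; last by apply: itgZ => //; exact: itg_abs.
        by apply: eq_integral => y _; rewrite /= normrM.
      rewrite lee_fin RintegralZl//; last exact: itg_abs.
      rewrite ler_wpM2l// -RintegralZl//; last exact: itg_abs.
      apply: le_Rintegral => //; [exact: itg_abs|by apply: itgZ => //; exact: itg_abs|].
      by move=> y _; rewrite normrM mulrC ler_wpM2r.
  have : itg setT (fun x => (M * \int[mu]_y `|g y|) * `|f x|) by apply: itgZ => //; exact: itg_abs.
  move=> /integrableP[_]; apply: le_lt_trans.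
  rewrite le_eqVlt; apply/orP; left; apply/eqP; apply: eq_integral => x _ /=.
  rewrite [in RHS]ger0_norm; first by rewrite mulrC.
  by rewrite !mulr_ge0//; apply: Rintegral_ge0.
have := Fubini iF; rewrite /F/=.
set L := integral mu _ _; set Rt := integral mu _ _ => LR.
have -> : \int[mu]_x (f x * \int[mu]_y (g y * k (x, y))) = fine L.
  rewrite /Rintegral /L; congr (fine _); apply: eq_integral => x _.
  by rewrite -/(Rintegral _ _ _) -RintegralZl// Rint_efin//; exact: itgZ.
have -> : \int[mu]_y (g y * \int[mu]_x (f x * k (x, y))) = fine Rt.
  rewrite /Rintegral /Rt; congr (fine _); apply: eq_integral => y _.
  rewrite -/(Rintegral _ _ _) -RintegralZl// Rint_efin//; last exact: itgZ.
  by apply: eq_integral => x _; congr EFin; ring.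
by rewrite LR.
Qed.

Lemma Rint_indic D f : measurable D ->
  \int[mu]_x (\1_D x * f x) = \int[mu]_(x in D) f x.
Proof.
move=> mD; rewrite [RHS]Rintegral_mkcond; apply: eq_Rintegral => x _.
by rewrite patchE indicE; case: ifP => _; rewrite ?mul1r ?mul0r.
Qed.

Lemma itg_indic_itv (s e : R) : itg setT (\1_(`[s, e]%classic) : R -> R).
Proof.
apply: (@eq_integrable _ _ _ mu setT _ ((EFin \o cst 1) \_ `[s, e])) => //.
  by move=> x _; rewrite /= patchE indicE; case: ifP.
by rewrite -integrable_mkcond//; exact: itg_cst.
Qed.

Lemma indic_itv01 (s e x : R) : `|\1_(`[s, e]%classic) x : R| <= 1.
Proof. by rewrite indicE; case: (_ \in _); rewrite ?normr1 ?normr0. Qed.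

Lemma measurable_fun_fst f : measurable_fun setT f ->
  measurable_fun setT (fun p : R * R => f p.1).
Proof. by move=> mf; exact: measurableT_comp. Qed.

Lemma measurable_fun_snd f : measurable_fun setT f ->
  measurable_fun setT (fun p : R * R => f p.2).
Proof. by move=> mf; exact: measurableT_comp. Qed.

Lemma measurable_fun_if_le (f g k : R * R -> R) : measurable_fun setT f ->
  measurable_fun setT g -> measurable_fun setT k ->
  measurable_fun setT (fun p => if f p <= g p then k p else 0 : R).
Proof.
move=> mf mg mk; apply: measurable_fun_ifT => //; exact: measurable_fun_ler.
Qed.

End FubiniTools.

Section Triangles.
Variable R : realType.
Notation mu := (@lebesgue_measure R).
Notation itg D f := (mu.-integrable D (EFin \o (f : R -> R))).

Lemma mem_itvcc (u v z : R) : (z \in (`[u, v]%classic : set R)) = (u <= z <= v).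
Proof. by apply/idP/idP; rewrite inE/= in_itv. Qed.

Lemma itg_triangle (s e M : R) (F : R -> R -> R) : s <= e ->
  measurable_fun setT (fun p : R * R => F p.1 p.2) ->
  (forall x y, s <= x <= e -> s <= y <= e -> `|F x y| <= M) ->
  itg `[s, e] (fun y => \int[mu]_(x in `[y, e]) F x y).
Proof.
move=> se mF FM.
have M0 : 0 <= M by have := FM s s; rewrite lexx se => /(_ isT isT); apply: le_trans; exact: normr_ge0.
pose ch (x : R) : R := \1_(`[s, e]%classic) x.
have mch : measurable_fun setT ch by apply: measurable_indic; exact: measurable_itv.
pose k (p : R * R) : R := if p.1 <= p.2 then ch p.2 * F p.2 p.1 else 0.
have mk : measurable_fun setT k.
  apply: measurable_fun_if_le => //.
  apply: measurable_funM; first exact: measurable_fun_snd.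
  by apply: (@measurableT_comp _ _ _ _ _ _ _ _ (fun p : R * R => (p.2, p.1)) mF); exact: measurable_fun_pair.
have mFy y : measurable_fun setT (fun x => F x y) by exact: (measurable_fun_pair1 y mF).
have eqk y : s <= y <= e -> \int[mu]_x k (y, x) = \int[mu]_(x in `[y, e]) F x y.
  move=> /andP[sy ye]; rewrite -(@Rint_indic R `[y, e]%classic (fun x => F x y)); last exact: measurable_itv.
  apply: eq_Rintegral => x _; rewrite /k/= /ch !indicE !mem_itvcc.
  have [yx|xy] := leP y x; last by rewrite mul0r.
  by rewrite (le_trans sy yx).
apply: (@eq_integrable _ _ _ mu _ _ (EFin \o (fun y => \int[mu]_x k (y, x)))) => //.
  by move=> y; rewrite mem_itvcc /= => /eqk ->.
apply: (@itg_bnd _ _ _ (M * (e - s))) => //; first exact: mu_itv_lty.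
  exact: measurable_funS (measurable_param mk).
move=> y; rewrite /= in_itv/= => yse; have /andP[sy ye] := yse; rewrite (eqk _ yse).
have iF : itg `[y, e] (fun x => F x y).
  apply: (@itg_bnd _ _ _ M) => //; first exact: mu_itv_lty.
    exact: measurable_funS (mFy y).
  by move=> x; rewrite /= in_itv/= => /andP[yx xe]; rewrite FM// (le_trans sy yx).
apply: (le_trans (le_normr_Rintegral _ iF)) => //.
apply: (@le_trans _ _ (\int[mu]_(x in `[y, e]) M)).
  apply: le_Rintegral => //; [exact: itg_abs|exact: itg_cst|].
  by move=> x; rewrite /= in_itv/= => /andP[yx xe]; apply: FM; rewrite ?yse// (le_trans sy yx).
by rewrite Rint_itv// ler_wpM2l// lerB.
Qed.

(** The two triangles of a square carry the same integral of a symmetric function. *)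
Lemma Rint_square_triangle (s e M : R) (F : R -> R -> R) : s <= e ->
  measurable_fun setT (fun p : R * R => F p.1 p.2) ->
  (forall x y, s <= x <= e -> s <= y <= e -> `|F x y| <= M) ->
  (forall x y, F x y = F y x) ->
  \int[mu]_(y in `[s, e]) \int[mu]_(x in `[s, e]) F x y =
  2 * \int[mu]_(y in `[s, e]) \int[mu]_(x in `[y, e]) F x y.
Proof.
move=> se mF FM symF.
pose I : set R := `[s, e]%classic.
have M0 : 0 <= M by have := FM s s; rewrite lexx se => /(_ isT isT); apply: le_trans; exact: normr_ge0.
pose ch (x : R) : R := \1_I x.
have mch : measurable_fun setT ch by apply: measurable_indic; exact: measurable_itv.
have ich : itg setT ch by exact: itg_indic_itv.
pose k (p : R * R) : R := if p.2 <= p.1 then ch p.1 * (ch p.2 * F p.1 p.2) else 0.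
have mk : measurable_fun setT k.
  apply: measurable_fun_if_le => //.
  apply: measurable_funM; first exact: measurable_fun_fst.
  by apply: measurable_funM => //; exact: measurable_fun_snd.
have chI x : s <= x <= e -> ch x = 1 by move=> xse; rewrite /ch indicE mem_set//= in_itv.
have chNI x : ~ (s <= x <= e) -> ch x = 0.
  by move=> xse; rewrite /ch indicE memNset//= in_itv.
have kM p : `|k p| <= M.
  rewrite /k; case: ifP; rewrite ?normr0// => _.
  have [x1|/chNI ->] := pselect (s <= p.1 <= e); last by rewrite mul0r normr0.
  have [x2|/chNI ->] := pselect (s <= p.2 <= e); last by rewrite mul0r mulr0 normr0.
  by rewrite !chI// !mul1r FM.
have mFy y : measurable_fun setT (fun x => F x y) by exact: (measurable_fun_pair1 y mF).
have iF y : s <= y <= e -> itg `[s, e] (fun x => F x y).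
  move=> yse; apply: (@itg_bnd _ _ _ M) => //; first exact: mu_itv_lty.
    exact: measurable_funS (mFy y).
  by move=> x; rewrite /= in_itv/= => xse; exact: FM.
have param_itg (G : R -> R) (G' : R -> R) : measurable_fun setT G' ->
    (forall y, s <= y <= e -> G' y = G y) ->
    (forall y, s <= y <= e -> `|G y| <= M * (e - s)) -> itg `[s, e] G.
  move=> mG' GG' GM; apply: (@eq_integrable _ _ _ mu _ _ (EFin \o G')) => //.
    by move=> y /set_mem/= /[!in_itv]/= yse; rewrite /= GG'.
  apply: (@itg_bnd _ _ _ (M * (e - s))) => //; first exact: mu_itv_lty.
    exact: measurable_funS mG'.
  by move=> y; rewrite /= in_itv/= => yse; rewrite GG'// GM.
have sub_bound y x1 x2 : s <= y <= e -> s <= x1 -> x1 <= x2 -> x2 <= e ->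
    `|\int[mu]_(x in `[x1, x2]) F x y| <= M * (e - s).
  move=> yse sx xx xe; have i12 := itg_sub sx xe (iF _ yse).
  apply: (le_trans (le_normr_Rintegral _ i12)) => //.
  apply: (@le_trans _ _ (\int[mu]_(x in `[x1, x2]) M)).
    apply: le_Rintegral => //; [exact: itg_abs|exact: itg_cst|].
    move=> x; rewrite /= in_itv/= => /andP[x1x xx2]; apply: FM => //.
    by rewrite (le_trans sx x1x) (le_trans xx2 xe).
  by rewrite Rint_itv// ler_wpM2l// lerB.
have low y : s <= y <= e -> \int[mu]_x (ch x * k (x, y)) = \int[mu]_(x in `[y, e]) F x y.
  move=> yse; rewrite /= -(@Rint_indic R `[y, e]%classic (fun x => F x y)) //; apply: eq_Rintegral => x _.
  rewrite /k/= (chI _ yse) mul1r [in RHS]indicE mem_itvcc.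
  have [x1|nx] := pselect (s <= x <= e).
    by rewrite (chI _ x1) !mul1r; case/andP: x1 => _ ->; case: (y <= x); rewrite ?mul1r ?mul0r.
  rewrite chNI// mul0r; case: (boolP (y <= x <= e)) => [/andP[yx xe]|_]; last by rewrite mul0r.
  exfalso; apply: nx; rewrite xe andbT; case/andP: yse => sy _; exact: le_trans yx.
have up x : s <= x <= e -> \int[mu]_y (ch y * k (x, y)) = \int[mu]_(y in `[s, x]) F y x.
  move=> xse; rewrite /= -(@Rint_indic R `[s, x]%classic (fun y => F y x)) //; apply: eq_Rintegral => y _.
  rewrite /k/= (chI _ xse) mul1r [in RHS]indicE mem_itvcc symF.
  have [y1|ny] := pselect (s <= y <= e).
    by rewrite (chI _ y1) !mul1r; case/andP: y1 => -> _ /=; case: (y <= x); rewrite ?mul1r ?mul0r.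
  rewrite chNI// mul0r; case: (boolP (s <= y <= x)) => [/andP[sy yx]|_]; last by rewrite mul0r.
  exfalso; apply: ny; rewrite sy; case/andP: xse => _; exact: le_trans.
have i1 := itg_triangle se mF FM.
have i2 : itg `[s, e] (fun y => \int[mu]_(x in `[s, y]) F x y).
  apply: (param_itg _ (fun x => \int[mu]_y (ch y * k (x, y)))).
    apply: (@measurable_param R (fun p => ch p.2 * k p)).
    by apply: measurable_funM mk; exact: measurable_fun_snd.
    by move=> x xse; rewrite up//; apply: eq_Rintegral => y _; rewrite symF.
  by move=> y yse; have /andP[sy ye] := yse; exact: sub_bound.
have sw := fubini_bounded ich ich mk kM.
have triL : \int[mu]_y (ch y * \int[mu]_x (ch x * k (x, y))) =
    \int[mu]_(y in `[s, e]) \int[mu]_(x in `[y, e]) F x y.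
  rewrite (@Rint_indic R I (fun y => \int[mu]_x (ch x * k (x, y)))); last exact: measurable_itv.
  by apply: eq_Rintegral => y; rewrite mem_itvcc; exact: low.
have triU : \int[mu]_x (ch x * \int[mu]_y (ch y * k (x, y))) =
    \int[mu]_(x in `[s, e]) \int[mu]_(y in `[s, x]) F y x.
  rewrite (@Rint_indic R I (fun x => \int[mu]_y (ch y * k (x, y)))); last exact: measurable_itv.
  by apply: eq_Rintegral => x; rewrite mem_itvcc; exact: up.
rewrite mulr_natl mulr2n -{1}triL -sw triU -RintegralD; [|exact: measurable_itv|by []|by []].
apply: eq_Rintegral => y /set_mem/= /[!in_itv]/= yse.
have /andP[sy ye] := yse; rewrite (Rint_split sy ye); last exact: iF.
by rewrite addrC; congr (_ + _); apply: eq_Rintegral => x _; rewrite symF.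
Qed.

End Triangles.

Section L2Facts.
Variable R : realType.
Notation mu := (@lebesgue_measure R).
Notation itg D f := (mu.-integrable D (EFin \o (f : R -> R))).
Implicit Types (q f : R -> R[i]).
Local Notation Re := complex.Re.
Local Notation Im := complex.Im.
Local Notation normc := ComplexField.Normc.normc.

Lemma normc_sqr (z : R[i]) : normc z ^+ 2 = Re z ^+ 2 + Im z ^+ 2.
Proof. by case: z => x y /=; rewrite sqr_sqrtr// addr_ge0// sqr_ge0. Qed.

Lemma normc_nneg (z : R[i]) : 0 <= normc z.
Proof. by case: z => x y; exact: sqrtr_ge0. Qed.

Lemma L2norm_ge0 f : (0 <= L2norm f)%E.
Proof. exact: Lnorm_ge0. Qed.

Lemma L2norm_sqr f : (L2norm f `^ 2 = \int[mu]_x (normc (f x) ^+ 2)%:E)%E.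
Proof.
rewrite /L2norm powR_Lnorm//; apply: eq_integral => x _.
rewrite gee0_abs ?lee_fin ?normc_nneg//.
by rewrite poweR_EFin -powR_mulrn// normc_nneg.
Qed.

Lemma measurable_normc_sqr f : cmeasurable f ->
  measurable_fun setT (fun x => normc (f x) ^+ 2).
Proof.
move=> [mr mi]; rewrite (_ : (fun x => _) = (fun x => Re (f x) ^+ 2 + Im (f x) ^+ 2)).
  by apply: measurable_funD; exact: measurable_funX.
by apply/funext => x; rewrite normc_sqr.
Qed.

Lemma is_L2P f : is_L2 f <-> cmeasurable f /\ itg setT (fun x => normc (f x) ^+ 2).
Proof.
split=> -[mf f2]; split=> //.
- apply/integrableP; split; first by apply/measurable_EFinP; exact: measurable_normc_sqr.
  under eq_integral do rewrite /= ger0_norm ?sqr_ge0//.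
  by rewrite -L2norm_sqr poweR_lty.
- have /integrableP[_] := f2; under eq_integral do rewrite /= ger0_norm ?sqr_ge0//.
  rewrite -L2norm_sqr; have := L2norm_ge0 f.
  by case: (L2norm f) => [x _ _|_|//]; rewrite ?ltry// poweRyr.
Qed.

Lemma is_L2_components f : is_L2 f ->
  [/\ measurable_fun setT (fun x => Re (f x)), measurable_fun setT (fun x => Im (f x)),
      itg setT (fun x => Re (f x) ^+ 2) & itg setT (fun x => Im (f x) ^+ 2)].
Proof.
move=> /is_L2P[[mr mi] f2]; split => //; apply: (itg_le _ _ _ f2) => //.
- exact: measurable_funX.
- by move=> x _; rewrite ger0_norm ?sqr_ge0// normc_sqr lerDl sqr_ge0.
- exact: measurable_funX.
- by move=> x _; rewrite ger0_norm ?sqr_ge0// normc_sqr lerDr sqr_ge0.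
Qed.

Lemma is_L2_fine_sqr f : is_L2 f ->
  (fine (L2norm f)) ^+ 2 = \int[mu]_x Re (f x) ^+ 2 + \int[mu]_x Im (f x) ^+ 2.
Proof.
move=> fL; have [mr mi r2 i2] := is_L2_components fL.
rewrite -RintegralD//; have [_ foo] := fL; have f0 := L2norm_ge0 f.
have ffin : L2norm f \is a fin_num by rewrite ge0_fin_numE.
rewrite -powR_mulrn ?fine_ge0// -[LHS]/(fine (fine (L2norm f) `^ 2)%:E) -poweR_EFin fineK//.
by rewrite L2norm_sqr; congr fine; apply: eq_integral => x _; rewrite normc_sqr.
Qed.

End L2Facts.

Lemma det_2x2 (R : comNzRingType) (A : 'M[R]_2) : \det A = A 0 0 * A 1 1 - A 0 1 * A 1 0.
Proof.
rewrite (expand_det_row _ ord0) !big_ord_recl big_ord0 /cofactor !det_mx11 !mxE /= expr0 expr1.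
have l0 : lift ord0 ord0 = 1 :> 'I_2 by exact/val_inj.
have l1 : lift 1 ord0 = 0 :> 'I_2 by exact/val_inj.
have l2 : ord0 = 0 :> 'I_2 by exact/val_inj.
rewrite !l0 ?l1 ?l2; ring.
Qed.

Section WindowOscillation.
Variable R : realType.
Notation mu := (@lebesgue_measure R).
Notation itg D f := (mu.-integrable D (EFin \o (f : R -> R))).
Implicit Types (a : R -> R) (s e : R).

Lemma itgX2_restrict a s e : itg `[s, e] (fun x => a x ^+ 2) ->
  itg setT (fun x => (a \_ `[s, e]) x ^+ 2).
Proof.
move=> a2; rewrite (_ : (fun x => (a \_ `[s, e]) x ^+ 2) = (fun x => a x ^+ 2) \_ `[s, e]); first by apply/(itg_mkcond _ _).1.
by apply/funext => x; rewrite !patchE; case: ifP => // _; rewrite expr0n.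
Qed.

Lemma local_primitive a s e : measurable_fun setT a -> itg setT (fun x => a x ^+ 2) ->
  exists2 P : R -> R, continuous P & forall y x, s <= y -> y <= x -> x <= e ->
    \int[mu]_(t in `[y, x]) a t = P x - P y.
Proof.
move=> ma a2; pose h := a \_ `[s, e].
have ai : itg `[s, e] a.
  by apply: sq_itg_itg; [exact: measurable_funS ma|exact: itg_mono a2].
have hi : itg setT h by apply/(itg_mkcond _ _).1.
have h2 : itg setT (fun x => h x ^+ 2) by apply: itgX2_restrict; exact: itg_mono a2.
exists (primitive h).
  by apply: loc_ac_continuous => u v; apply: primitive_ac => //; exact: itg_meas hi.
move=> y x sy yx xe; rewrite primitiveB//; apply: eq_Rintegral => t.
by rewrite mem_itvcc => /andP[yt tx]; rewrite /h patchE mem_itvcc (le_trans sy yt) (le_trans tx xe).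
Qed.

(** The mean oscillation of a primitive of [a] over the window [s, s + 2]; it measures [a] in a local negative Sobolev norm. *)
Definition window_osc s a : R :=
  \int[mu]_(y in `[s, s + 2]) \int[mu]_(x in `[y, s + 2]) (\int[mu]_(t in `[y, x]) a t) ^+ 2.

Lemma itg_window_osc s a : measurable_fun setT a -> itg setT (fun x => a x ^+ 2) ->
  itg `[s, s + 2] (fun y => \int[mu]_(x in `[y, s + 2]) (\int[mu]_(t in `[y, x]) a t) ^+ 2).
Proof.
move=> ma a2; have [P cP HP] := local_primitive s (s + 2) ma a2.
have [mP [M HM]] := bounded_meas_continuous s (s + 2) cP.
have se : s <= s + 2 by rewrite lerDl.
apply: (@eq_integrable _ _ _ mu _ _ (EFin \o (fun y => \int[mu]_(x in `[y, s + 2]) (P x - P y) ^+ 2))) => //.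
  move=> y; rewrite mem_itvcc => /andP[sy ye] /=; congr EFin; apply: eq_Rintegral => x.
  by rewrite mem_itvcc => /andP[yx xe]; rewrite HP.
apply: (@itg_triangle _ _ _ ((M + M) ^+ 2)) => //.
  apply: measurable_funX; apply: measurable_funB.
    by apply: measurable_fun_fst; exact: continuous_measurable_fun.
  by apply: measurable_fun_snd; exact: continuous_measurable_fun.
move=> x y xs ys; rewrite normrX lerXn2r ?nnegrE//.
  by rewrite addr_ge0// (le_trans _ (HM _ xs)).
by rewrite (le_trans (ler_normB _ _))// lerD ?HM.
Qed.

Lemma window_osc_ge0 s a : 0 <= window_osc s a.
Proof. by apply: Rintegral_ge0 => y _; apply: Rintegral_ge0 => x _; exact: sqr_ge0. Qed.

End WindowOscillation.

Section FundamentalSolution.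
Variable R : realType.
Notation mu := (@lebesgue_measure R).
Notation itg D f := (mu.-integrable D (EFin \o (f : R -> R))).
Local Notation Re := complex.Re.
Local Notation Im := complex.Im.
Variables (q : R -> R[i]) (N : R -> 'M[R]_2).
Hypotheses (qL2 : is_L2 q) (Nsol : is_fundamental_solution (Qmx q) N).

Let a (x : R) : R := Re (q x).
Let b (x : R) : R := Im (q x).
Let n00 (x : R) : R := N x 0 0.
Let n01 (x : R) : R := N x 0 1.
Let n10 (x : R) : R := N x 1 0.
Let n11 (x : R) : R := N x 1 1.

Let ac00 : loc_abs_continuous n00. Proof. by case: Nsol => H _ _; exact: H. Qed.
Let ac01 : loc_abs_continuous n01. Proof. by case: Nsol => H _ _; exact: H. Qed.
Let ac10 : loc_abs_continuous n10. Proof. by case: Nsol => H _ _; exact: H. Qed.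
Let ac11 : loc_abs_continuous n11. Proof. by case: Nsol => H _ _; exact: H. Qed.

Let ode : {ae mu, forall x,
  [/\ is_derive x (1 : R) n00 (a x * n00 x - b x * n10 x),
      is_derive x (1 : R) n01 (a x * n01 x - b x * n11 x),
      is_derive x (1 : R) n10 (- (b x * n00 x) - a x * n10 x) &
      is_derive x (1 : R) n11 (- (b x * n01 x) - a x * n11 x)]}.
Proof.
have [_ H _] := Nsol; apply: filterS H; first exact: (ae_filter_ringOfSetsType mu).
move=> x [D dD /matrixP E].
have E' i j := E i j; move: E' => {}E.
have e00 := E 0 0; have e01 := E 0 1; have e10 := E 1 0; have e11 := E 1 1.
rewrite !mxE !big_ord_recl !big_ord0 /Jmx /Qmx /mx22 !mxE/= in e00 e01 e10 e11.
have l0 : lift ord0 ord0 = 1 :> 'I_2 by exact/val_inj.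
have l1 : ord0 = 0 :> 'I_2 by exact/val_inj.
rewrite !l0 !l1 in e00 e01 e10 e11.
have d00 := dD 0 0; have d01 := dD 0 1; have d10 := dD 1 0; have d11 := dD 1 1.
split.
- rewrite (_ : _ - _ = D 0 0)//; rewrite /a /b /n00 /n10; move: e10; lra.
- rewrite (_ : _ - _ = D 0 1)//; rewrite /a /b /n01 /n11; move: e11; lra.
- rewrite (_ : _ - _ = D 1 0)//; rewrite /a /b /n00 /n10; move: e00; lra.
- rewrite (_ : _ - _ = D 1 1)//; rewrite /a /b /n01 /n11; move: e01; lra.
Qed.

Let det x := n00 x * n11 x - n01 x * n10 x.

Let bnd (f : R -> R) (s e : R) : loc_abs_continuous f -> exists M : R, forall x, s <= x <= e -> `|f x| <= M.
Proof. by move=> /loc_ac_continuous /bounded_meas_continuous H; have [] := H s e. Qed.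

Let acM_loc (f g : R -> R) : loc_abs_continuous f -> loc_abs_continuous g ->
  loc_abs_continuous (fun x => f x * g x).
Proof.
move=> fac gac s e; have [M HM] := bnd s e fac; have [M' HM'] := bnd s e gac.
apply: (@acM _ _ _ _ _ (Num.max M M')) => // x xse; rewrite le_max ?HM ?HM' ?orbT//.
Qed.

Let det_ac : loc_abs_continuous det.
Proof. by move=> s e; apply: acB; apply: acM_loc. Qed.

Lemma fundamental_det1 x : det x = 1.
Proof.
have det0 : det 0 = 1.
  have [_ _ N0] := Nsol; rewrite /det /n00 /n01 /n10 /n11 N0 !mxE/=; ring.
have dd : {ae mu, forall x, is_derive x (1 : R) det 0}.
  apply: filterS ode; first exact: (ae_filter_ringOfSetsType mu).
  move=> t [d00 d01 d10 d11].
  have := is_deriveB (is_deriveM d00 d11) (is_deriveM d01 d10).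
  by move=> /is_derive_eq; apply; rewrite /GRing.scale/=; ring.
have cst s e : s <= e -> det e = det s.
  move=> se; apply: ac_ae_deriv0_cst => //.
  by apply: filterS dd; first exact: (ae_filter_ringOfSetsType mu).
by have [x0|/ltW x0] := leP 0 x; [rewrite (cst 0)|rewrite -(cst _ 0 x0)].
Qed.

Let ma : measurable_fun setT a. Proof. by have [] := is_L2_components qL2. Qed.
Let mb : measurable_fun setT b. Proof. by have [] := is_L2_components qL2. Qed.
Let a2 : itg setT (fun x => a x ^+ 2). Proof. by have [] := is_L2_components qL2. Qed.
Let b2 : itg setT (fun x => b x ^+ 2). Proof. by have [] := is_L2_components qL2. Qed.

Let aS (s e : R) : [/\ measurable_fun `[s, e] a, measurable_fun `[s, e] b,
  itg `[s, e] (fun x => a x ^+ 2) & itg `[s, e] (fun x => b x ^+ 2)].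
Proof.
by split; [exact: measurable_funS ma|exact: measurable_funS mb|exact: itg_mono a2|exact: itg_mono b2].
Qed.

Let bn (f : R -> R) (s e : R) : loc_abs_continuous f -> bounded_meas s e f.
Proof. by move=> /loc_ac_continuous /bounded_meas_continuous; apply. Qed.

Let sqM (f g : R -> R) (s e : R) : measurable_fun `[s, e] f -> itg `[s, e] (fun x => f x ^+ 2) ->
  bounded_meas s e g ->
  measurable_fun `[s, e] (fun x => f x * g x) /\ itg `[s, e] (fun x => (f x * g x) ^+ 2).
Proof.
move=> mf f2 bg; split; first by apply: measurable_funM mf _; case: bg.
rewrite (_ : (fun x => _) = (fun x => f x ^+ 2 * g x ^+ 2)); last by apply/funext => x; ring.
by apply: itgM_bounded_meas => //; exact: bounded_measX.
Qed.

Let acZ r (f : R -> R) : loc_abs_continuous f -> loc_abs_continuous (fun x => r * f x).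
Proof.
move=> fac; apply: acM_loc => // s e eps eps0; exists 1 => // n x y _ _ _.
by rewrite big1// => i _; rewrite subrr normr0.
Qed.

Let acD (f g : R -> R) : loc_abs_continuous f -> loc_abs_continuous g ->
  loc_abs_continuous (fun x => f x + g x).
Proof.
move=> fac gac s e; have := acB (fac s e) (acZ (-1) gac s e).
by rewrite (_ : (fun x => f x - -1 * g x) = (fun x => f x + g x))//; apply/funext => x; ring.
Qed.

(* The rows of N solve f0' = a f0 - b f1, f1' = - b f0 - a f1, and so do constant combinations. *)
Let comb (u v : R) (x : R) := (u * n00 x + v * n01 x, u * n10 x + v * n11 x).

Let comb_ac u v : loc_abs_continuous (fun x => (comb u v x).1) /\
  loc_abs_continuous (fun x => (comb u v x).2).
Proof.
by split; apply: acD; exact: acZ.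
Qed.

Let quad_FTC (u v u' v' s e : R) : s <= e ->
  let F x := (comb u v x).1 + (comb u' v' x).2 in
  F e - F s = \int[mu]_(t in `[s, e])
    (a t * ((comb u v t).1 - (comb u' v' t).2) - b t * ((comb u v t).2 + (comb u' v' t).1)).
Proof.
move=> se F; have [ac1 ac2] := comb_ac u v; have [ac1' ac2'] := comb_ac u' v'.
have [mas mbs a2s b2s] := aS s e.
have bd1 : bounded_meas s e (fun t => (comb u v t).1 - (comb u' v' t).2).
  by apply: bounded_measD; [|apply: bounded_measN]; exact: bn.
have bd2 : bounded_meas s e (fun t => (comb u v t).2 + (comb u' v' t).1).
  by apply: bounded_measD; exact: bn.
have [m1 i1] := sqM mas a2s bd1; have [m2 i2] := sqM mbs b2s bd2.
apply: ac_FTC => //.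
- exact: acD.
- exact: measurable_funB.
- have : itg `[s, e] (fun t => 2 * ((a t * ((comb u v t).1 - (comb u' v' t).2)) ^+ 2 +
      (b t * ((comb u v t).2 + (comb u' v' t).1)) ^+ 2)) by apply: itgZ => //; exact: itgD.
  apply: itg_le => //; first by apply: measurable_funX; exact: measurable_funB.
  move=> t _; rewrite ger0_norm ?sqr_ge0//.
  move: (a t * _) (b t * _) => y z; have := sqr_ge0 (y + z); rewrite !expr2; nra.
- apply: filterS ode; first exact: (ae_filter_ringOfSetsType mu).
  move=> t [d00 d01 d10 d11] _.
  have := is_deriveD (is_deriveD (is_deriveZ u d00) (is_deriveZ v d01))
                     (is_deriveD (is_deriveZ u' d10) (is_deriveZ v' d11)).
  by move=> /is_derive_eq; apply; rewrite /GRing.scale/= /comb/=; ring.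
Qed.

(* The components of the transition matrix N x (N y)^-1 = z |-> A z + B z^*, with A = A1 + i A2 and B = B1 + i B2. *)
Let A1 y x := (n00 x * n11 y - n01 x * n10 y - n10 x * n01 y + n11 x * n00 y) / 2.
Let A2 y x := (n10 x * n11 y - n11 x * n10 y + n00 x * n01 y - n01 x * n00 y) / 2.
Let B1 y x := (n00 x * n11 y - n01 x * n10 y + n10 x * n01 y - n11 x * n00 y) / 2.
Let B2 y x := (n10 x * n11 y - n11 x * n10 y - n00 x * n01 y + n01 x * n00 y) / 2.

Let eqA1 y x : y <= x -> A1 y x = 1 + \int[mu]_(t in `[y, x]) (a t * B1 y t - b t * B2 y t).
Proof.
move=> yx; have := quad_FTC (n11 y / 2) (- n10 y / 2) (- n01 y / 2) (n00 y / 2) yx.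
rewrite [X in _ = X -> _](_ : _ = \int[mu]_(t in `[y, x]) (a t * B1 y t - b t * B2 y t)); last first.
  by apply: eq_Rintegral => t _; rewrite /comb/= /B1 /B2; ring.
by move=> <-; have := fundamental_det1 y; rewrite /det /A1 /comb/=; lra.
Qed.

Let eqA2 y x : y <= x -> A2 y x = - \int[mu]_(t in `[y, x]) (a t * B2 y t + b t * B1 y t).
Proof.
move=> yx; have := quad_FTC (- n01 y / 2) (n00 y / 2) (- n11 y / 2) (n10 y / 2) yx.
rewrite [X in _ = X -> _](_ : _ = \int[mu]_(t in `[y, x]) (a t * B2 y t + b t * B1 y t)); last first.
  by apply: eq_Rintegral => t _; rewrite /comb/= /B1 /B2; ring.
by move=> <-; rewrite /A2 /comb/=; ring.
Qed.

Let eqB1 y x : y <= x -> B1 y x = \int[mu]_(t in `[y, x]) (a t * A1 y t - b t * A2 y t).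
Proof.
move=> yx; have := quad_FTC (n11 y / 2) (- n10 y / 2) (n01 y / 2) (- n00 y / 2) yx.
rewrite [X in _ = X -> _](_ : _ = \int[mu]_(t in `[y, x]) (a t * A1 y t - b t * A2 y t)); last first.
  by apply: eq_Rintegral => t _; rewrite /comb/= /A1 /A2; ring.
by move=> <-; rewrite /B1 /comb/=; ring.
Qed.

Let eqB2 y x : y <= x -> B2 y x = - \int[mu]_(t in `[y, x]) (a t * A2 y t + b t * A1 y t).
Proof.
move=> yx; have := quad_FTC (n01 y / 2) (- n00 y / 2) (- n11 y / 2) (n10 y / 2) yx.
rewrite [X in _ = X -> _](_ : _ = \int[mu]_(t in `[y, x]) (a t * A2 y t + b t * A1 y t)); last first.
  by apply: eq_Rintegral => t _; rewrite /comb/= /A1 /A2; ring.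
by move=> <-; rewrite /B2 /comb/=; ring.
Qed.

Variable s : R.
Let e : R := s + 2.
Let r : R := fine (L2norm q).

Let se : s <= e. Proof. by rewrite lerDl. Qed.

Let nice (F : R -> R -> R) : Prop := measurable_fun setT (fun p : R * R => F p.1 p.2) /\
  exists M : R, forall x y, s <= x <= e -> s <= y <= e -> `|F x y| <= M.

Let niceD F G : nice F -> nice G -> nice (fun x y => F x y + G x y).
Proof.
move=> [mF [M HM]] [mG [M' HM']]; split; first exact: measurable_funD.
by exists (M + M') => x y xs ys; rewrite (le_trans (ler_normD _ _))// lerD ?HM ?HM'.
Qed.

Let niceM F G : nice F -> nice G -> nice (fun x y => F x y * G x y).
Proof.
move=> [mF [M HM]] [mG [M' HM']]; split; first exact: measurable_funM.
by exists (M * M') => x y xs ys; rewrite normrM ler_pM ?HM ?HM'.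
Qed.

Let niceN F : nice F -> nice (fun x y => - F x y).
Proof.
move=> [mF [M HM]]; split; first exact: measurableT_comp.
by exists M => x y xs ys; rewrite normrN HM.
Qed.

Let nice_cst c : nice (fun _ _ => c).
Proof. by split; [exact: measurable_cst|exists `|c|]. Qed.

Let nice_fst f : continuous f -> nice (fun x _ => f x).
Proof.
move=> cf; split.
  by apply: measurable_fun_fst; exact: continuous_measurable_fun.
by have [_ [M HM]] := bounded_meas_continuous s e cf; exists M => x y xs _; exact: HM.
Qed.

Let nice_snd f : continuous f -> nice (fun _ y => f y).
Proof.
move=> cf; split.
  by apply: measurable_fun_snd; exact: continuous_measurable_fun.
by have [_ [M HM]] := bounded_meas_continuous s e cf; exists M => x y _ ys; exact: HM.
Qed.

Let nice2 F : nice F -> nice (fun x y => F x y ^+ 2).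
Proof.
by move=> nF; exact: (niceM nF nF).
Qed.

Let c00 : continuous n00. Proof. exact: loc_ac_continuous. Qed.
Let c01 : continuous n01. Proof. exact: loc_ac_continuous. Qed.
Let c10 : continuous n10. Proof. exact: loc_ac_continuous. Qed.
Let c11 : continuous n11. Proof. exact: loc_ac_continuous. Qed.

Let G x y := B1 y x ^+ 2 + B2 y x ^+ 2.

Let niceG : nice G.
Proof.
apply: niceD; apply: nice2; rewrite /B1 /B2.
- apply: niceM; last exact: nice_cst.
  do 3 (apply: niceD; last (try apply: niceN; by apply: niceM; [exact: nice_fst|exact: nice_snd])).
  by apply: niceM; [exact: nice_fst|exact: nice_snd].
- apply: niceM; last exact: nice_cst.
  do 3 (apply: niceD; last (try apply: niceN; by apply: niceM; [exact: nice_fst|exact: nice_snd])).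
  by apply: niceM; [exact: nice_fst|exact: nice_snd].
Qed.

Let symG x y : G x y = G y x.
Proof. by rewrite /G /B1 /B2; ring. Qed.

(* 4 |B|^2 is the squared Hilbert-Schmidt norm of N x (N y)^-1 minus 2. *)
Let GE x y : G x y = 4^-1 * ((n00 y ^+ 2 + n10 y ^+ 2) * (n01 x ^+ 2 + n11 x ^+ 2)
  + (n01 y ^+ 2 + n11 y ^+ 2) * (n00 x ^+ 2 + n10 x ^+ 2)
  - 2 * (n00 y * n01 y + n10 y * n11 y) * (n00 x * n01 x + n10 x * n11 x) - 2).
Proof.
have : det x * det y = 1 by rewrite !fundamental_det1 mul1r.
by rewrite /G /B1 /B2 /det; lra.
Qed.

Let h00 := \int[mu]_(x in `[s, e]) (n00 x ^+ 2 + n10 x ^+ 2).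
Let h01 := \int[mu]_(x in `[s, e]) (n00 x * n01 x + n10 x * n11 x).
Let h11 := \int[mu]_(x in `[s, e]) (n01 x ^+ 2 + n11 x ^+ 2).

Let lin4 (f1 f2 f3 : R -> R) (k1 k2 k3 k4 : R) :
  bounded_meas s e f1 -> bounded_meas s e f2 -> bounded_meas s e f3 ->
  \int[mu]_(x in `[s, e]) (k1 * f1 x + k2 * f2 x + k3 * f3 x + k4) =
  k1 * \int[mu]_(x in `[s, e]) f1 x + k2 * \int[mu]_(x in `[s, e]) f2 x +
  k3 * \int[mu]_(x in `[s, e]) f3 x + k4 * 2.
Proof.
move=> /bounded_meas_itg b1 /bounded_meas_itg b2' /bounded_meas_itg b3.
have i1 := itgZ k1 (measurable_itv _) b1; have i2 := itgZ k2 (measurable_itv _) b2'.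
have i3 := itgZ k3 (measurable_itv _) b3; have i12 := itgD (measurable_itv _) i1 i2.
have i123 := itgD (measurable_itv _) i12 i3.
rewrite RintegralD//; last exact: itg_cst.
rewrite RintegralD// RintegralD// !RintegralZl// Rint_itv//.
by rewrite (_ : e - s = 2)// /e addrAC subrr add0r.
Qed.

Let bH00 : bounded_meas s e (fun x => n00 x ^+ 2 + n10 x ^+ 2).
Proof. by apply: bounded_measD; apply: bounded_measX; exact: bn. Qed.
Let bH01 : bounded_meas s e (fun x => n00 x * n01 x + n10 x * n11 x).
Proof. by apply: bounded_measD; apply: bounded_measM; exact: bn. Qed.
Let bH11 : bounded_meas s e (fun x => n01 x ^+ 2 + n11 x ^+ 2).
Proof. by apply: bounded_measD; apply: bounded_measX; exact: bn. Qed.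

Let square_G : \int[mu]_(y in `[s, e]) \int[mu]_(x in `[s, e]) G x y =
  2^-1 * (h00 * h11 - h01 ^+ 2) - 2.
Proof.
transitivity (\int[mu]_(y in `[s, e]) ((4^-1 * h11) * (n00 y ^+ 2 + n10 y ^+ 2) +
   (4^-1 * h00) * (n01 y ^+ 2 + n11 y ^+ 2) +
   (- 2^-1 * h01) * (n00 y * n01 y + n10 y * n11 y) + -1)).
  apply: eq_Rintegral => y _.
  transitivity (\int[mu]_(x in `[s, e]) ((4^-1 * (n00 y ^+ 2 + n10 y ^+ 2)) * (n01 x ^+ 2 + n11 x ^+ 2) +
     (4^-1 * (n01 y ^+ 2 + n11 y ^+ 2)) * (n00 x ^+ 2 + n10 x ^+ 2) +
     (- 2^-1 * (n00 y * n01 y + n10 y * n11 y)) * (n00 x * n01 x + n10 x * n11 x) + - 2^-1)).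
    by apply: eq_Rintegral => x _; rewrite GE; field.
  by rewrite lin4// -/h00 -/h01 -/h11; field.
by rewrite lin4// -/h00 -/h01 -/h11; field.
Qed.

Let detE : \det (mxintegral `[s, s + 2] (fun x => (N x)^T *m N x)) = h00 * h11 - h01 ^+ 2.
Proof.
rewrite det_2x2 !mxE expr2; congr (_ * _ - _ * _); apply: eq_Rintegral => x _;
  rewrite !mxE !big_ord_recl big_ord0 !mxE /n00 /n01 /n10 /n11 ?addr0 ?expr2;
  have -> : lift ord0 ord0 = 1 :> 'I_2 by [exact/val_inj]; have -> : ord0 = 0 :> 'I_2 by [exact/val_inj].
all: by ring.
Qed.

Let tri_det : \det (mxintegral `[s, s + 2] (fun x => (N x)^T *m N x)) - 4 =
  4 * \int[mu]_(y in `[s, e]) \int[mu]_(x in `[y, e]) G x y.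
Proof.
have [mG [M GM]] := niceG; have := Rint_square_triangle se mG GM symG.
rewrite square_G detE; set T := \int[mu]_(y in _) _; set H := h00 * h11 - h01 ^+ 2.
by clearbody T H; lra.
Qed.

Let r0 : 0 <= r. Proof. by apply: fine_ge0; exact: L2norm_ge0. Qed.

Let tri_le (F F' : R -> R) : itg `[s, e] F -> itg `[s, e] F' -> (forall y, s <= y <= e -> F y <= F' y) ->
  \int[mu]_(y in `[s, e]) F y <= \int[mu]_(y in `[s, e]) F' y.
Proof. by move=> iF iF' FF; apply: le_Rintegral => // y; rewrite /= in_itv; exact: FF. Qed.

Let abr y : \int[mu]_(x in `[y, e]) a x ^+ 2 + \int[mu]_(x in `[y, e]) b x ^+ 2 <= r ^+ 2.
Proof.
rewrite /r is_L2_fine_sqr//; apply: lerD.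
- by apply: le_Rint_sub => // x _; exact: sqr_ge0.
- by apply: le_Rint_sub => // x _; exact: sqr_ge0.
Qed.

Let pq y := \int[mu]_(x in `[y, e])
  ((\int[mu]_(t in `[y, x]) a t) ^+ 2 + (\int[mu]_(t in `[y, x]) b t) ^+ 2).
Let Gy y := \int[mu]_(x in `[y, e]) G x y.

Let bAB y y' : [/\ bounded_meas y' e (A1 y), bounded_meas y' e (A2 y),
  bounded_meas y' e (B1 y) & bounded_meas y' e (B2 y)].
Proof.
have H (k1 k2 k3 k4 : R) : bounded_meas y' e
    (fun x => (n00 x * k1 + n01 x * k2 + n10 x * k3 + n11 x * k4) / 2).
  have Hk f k : loc_abs_continuous f -> bounded_meas y' e (fun x => f x * k).
    by move=> fac; apply: bounded_measM; [exact: bn|exact: bounded_meas_cst].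
  apply: bounded_measM; last exact: bounded_meas_cst.
  by do 3 (apply: bounded_measD; last exact: Hk); exact: Hk.
split.
- rewrite (_ : A1 y = fun x => (n00 x * n11 y + n01 x * (- n10 y) + n10 x * (- n01 y) + n11 x * n00 y) / 2)//.
  by apply/funext => x; rewrite /A1; ring.
- rewrite (_ : A2 y = fun x => (n00 x * n01 y + n01 x * (- n00 y) + n10 x * n11 y + n11 x * (- n10 y)) / 2)//.
  by apply/funext => x; rewrite /A2; ring.
- rewrite (_ : B1 y = fun x => (n00 x * n11 y + n01 x * (- n10 y) + n10 x * n01 y + n11 x * (- n00 y)) / 2)//.
  by apply/funext => x; rewrite /B1; ring.
- rewrite (_ : B2 y = fun x => (n00 x * (- n01 y) + n01 x * n00 y + n10 x * n11 y + n11 x * (- n10 y)) / 2)//.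
  by apply/funext => x; rewrite /B2; ring.
Qed.

Let system_bounds y : s <= y <= e ->
  pq y <= (4 + 64 * r ^+ 4) * Gy y /\
  Gy y <= (4 + 16 * expR (4 * r + 1) ^+ 2 * r ^+ 2) * pq y.
Proof.
move=> /andP[sy ye]; have [mas mbs a2s b2s] := aS y e; have [bA1 bA2 bB1 bB2] := bAB y y.
have ey : e - y <= 2 by move: sy; rewrite /e; lra.
split.
- apply: (linear_system_lower ye ey r0 mas mbs a2s b2s (abr y) bA1 bA2 bB1 bB2).
  + by move=> x /andP[yx _]; exact: eqA1.
  + by move=> x /andP[yx _]; exact: eqA2.
  + by move=> x /andP[yx _]; exact: eqB1.
  + by move=> x /andP[yx _]; exact: eqB2.
- apply: (linear_system_upper ye ey r0 mas mbs a2s b2s (abr y) bA1 bA2 bB1 bB2).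
  + by move=> x /andP[yx _]; exact: eqA1.
  + by move=> x /andP[yx _]; exact: eqA2.
  + by move=> x /andP[yx _]; exact: eqB1.
  + by move=> x /andP[yx _]; exact: eqB2.
Qed.

Let itgGy : itg `[s, e] Gy.
Proof. by have [mG [M GM]] := niceG; exact: (itg_triangle se mG GM). Qed.

Let osc2 : itg `[s, e] pq /\ \int[mu]_(y in `[s, e]) pq y = window_osc s a + window_osc s b.
Proof.
have ia := itg_window_osc s ma a2; have ib := itg_window_osc s mb b2.
have pqE y : y \in `[s, e]%classic -> \int[mu]_(x in `[y, e]) (\int[mu]_(t in `[y, x]) a t) ^+ 2 +
    \int[mu]_(x in `[y, e]) (\int[mu]_(t in `[y, x]) b t) ^+ 2 = pq y.
  rewrite mem_itvcc => /andP[sy ye]; have [mas mbs a2s b2s] := aS y e.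
  rewrite /pq RintegralD//.
  - by apply: bounded_meas_itg; apply: bounded_measX; apply: bounded_meas_int => //; exact: sq_itg_itg.
  - by apply: bounded_meas_itg; apply: bounded_measX; apply: bounded_meas_int => //; exact: sq_itg_itg.
split.
  apply: (@eq_integrable _ _ _ mu _ (measurable_itv _) _ (EFin \o pq) _ (itgD (measurable_itv _) ia ib)).
  by move=> y yse; rewrite /= pqE.
by rewrite /window_osc -RintegralD//; apply: eq_Rintegral => y yse; rewrite pqE.
Qed.

Let t := \det (mxintegral `[s, s + 2] (fun x => (N x)^T *m N x)) - 4.

Lemma det_window_ge0 : 0 <= t.
Proof.
rewrite /t tri_det mulr_ge0//; apply: Rintegral_ge0 => y _; apply: Rintegral_ge0 => x _.
by rewrite addr_ge0// sqr_ge0.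
Qed.

Lemma window_osc_le_det : window_osc s a + window_osc s b <= (1 + 16 * r ^+ 4) * t.
Proof.
have [ipq <-] := osc2; rewrite /t tri_det -/Gy.
apply: (@le_trans _ _ (\int[mu]_(y in `[s, e]) ((4 + 64 * r ^+ 4) * Gy y))).
  by apply: tri_le => //; [exact: itgZ|move=> y /system_bounds[]].
rewrite RintegralZl//; set X := \int[mu]_(y in _) _; clearbody X.
by rewrite le_eqVlt; apply/orP; left; apply/eqP; ring.
Qed.

Lemma det_le_window_osc : t <=
  (16 + 64 * expR (4 * r + 1) ^+ 2 * r ^+ 2) * (window_osc s a + window_osc s b).
Proof.
have [ipq <-] := osc2; rewrite /t tri_det -/Gy.
apply: (@le_trans _ _ (4 * \int[mu]_(y in `[s, e]) ((4 + 16 * expR (4 * r + 1) ^+ 2 * r ^+ 2) * pq y))).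
  by rewrite ler_pM2l//; apply: tri_le => //; [exact: itgZ|move=> y /system_bounds[]].
rewrite RintegralZl//; set X := \int[mu]_(y in _) _; clearbody X.
by move: (expR _) => E; rewrite le_eqVlt; apply/orP; left; apply/eqP; ring.
Qed.

End FundamentalSolution.

Section TrigBounds.
Variable R : realType.
Notation mu := (@lebesgue_measure R).
Notation itg D f := (mu.-integrable D (EFin \o (f : R -> R))).

Lemma is_derive_sinM (z x : R) : is_derive x (1 : R) (fun t => sin (t * z)) (z * cos (x * z)).
Proof.
have H : is_derive x (1 : R) (fun t : R => t * z) z.
  have := is_deriveM (is_derive_id x 1) (is_derive_cst z x 1).
  by move=> /is_derive_eq; apply; rewrite /GRing.scale/= mulr0 add0r mulr1.
have := @is_derive1_comp _ sin _ x _ _ (is_derive_sin (x * z)) H.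
by move=> /is_derive_eq; apply; rewrite mulrC.
Qed.

Lemma is_derive_cosM (z x : R) : is_derive x (1 : R) (fun t => cos (t * z)) (- (z * sin (x * z))).
Proof.
have H : is_derive x (1 : R) (fun t : R => t * z) z.
  have := is_deriveM (is_derive_id x 1) (is_derive_cst z x 1).
  by move=> /is_derive_eq; apply; rewrite /GRing.scale/= mulr0 add0r mulr1.
have := @is_derive1_comp _ cos _ x _ _ (is_derive_cos (x * z)) H.
by move=> /is_derive_eq; apply; rewrite mulrC mulrN.
Qed.

Lemma continuous_mulr_cst (z : R) : continuous (fun t : R => t * z).
Proof. by move=> x; apply: cvgM; [exact: cvg_id|exact: cvg_cst]. Qed.

Lemma continuous_sinM (z : R) : continuous (fun t : R => sin (t * z)).
Proof.
move=> x; apply: (@continuous_comp _ _ _ (fun t : R => t * z) sin); last exact: continuous_sin.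
exact: continuous_mulr_cst.
Qed.

Lemma continuous_cosM (z : R) : continuous (fun t : R => cos (t * z)).
Proof.
move=> x; apply: (@continuous_comp _ _ _ (fun t : R => t * z) cos); last exact: continuous_cos.
exact: continuous_mulr_cst.
Qed.

Lemma sin_ge0_le (x : R) : 0 <= x -> sin x <= x.
Proof.
rewrite le_eqVlt => /predU1P[<-|x0]; first by rewrite sin0.
have [|c _] := @MVT R sin cos 0 x x0 (fun t _ => is_derive_sin t).
  by apply: continuous_subspaceT => ?; exact: continuous_sin.
by rewrite sin0 !subr0 => ->; rewrite -[leRHS]mul1r ler_wpM2r ?cos_le1// ltW.
Qed.

Lemma normr_sin_le (x : R) : `|sin x| <= `|x|.
Proof.
wlog x0 : x / 0 <= x.
  move=> H; have [/H//|/ltW x0] := leP 0 x.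
  by rewrite -(normrN x) -(normrN (sin x)) -sinN H// oppr_ge0.
rewrite (ger0_norm x0) ler_norml sin_ge0_le// andbT.
have [x1|x1] := leP x 1; last by rewrite (le_trans _ (sin_geN1 x))// lerN2 ltW.
rewrite lerNl; rewrite -sinN.
have [->|xn0] := eqVneq x 0; first by rewrite oppr0 sin0.
have xp : 0 < x by rewrite lt_def xn0.
have [|c _] := @MVT R sin cos 0 x xp (fun t _ => is_derive_sin t).
  by apply: continuous_subspaceT => ?; exact: continuous_sin.
rewrite sin0 !subr0 sinN => ->; by rewrite -mulNr -[leRHS]mul1r ler_wpM2r// lerNl cos_geN1.
Qed.

Lemma cosE_half (x : R) : cos x = 1 - 2 * sin (x / 2) ^+ 2.
Proof.
have -> : cos x = cos (x / 2 + x / 2) by congr cos; field.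
by rewrite cosD -!expr2; have := cos2Dsin2 (x / 2); lra.
Qed.

Lemma cos_ge_quad (x : R) : 1 - x ^+ 2 / 2 <= cos x.
Proof.
rewrite cosE_half lerD2l lerN2.
have : sin (x / 2) ^+ 2 <= (x / 2) ^+ 2.
  by rewrite -(real_normK (num_real (sin _))) -(real_normK (num_real (x / 2))) lerXn2r ?nnegrE// normr_sin_le.
by rewrite exprMn exprVn (_ : 2 ^+ 2 = 4 :> R)//; [lra|ring].
Qed.

Lemma cos_le_quad (x : R) : `|x| <= 2 -> cos x <= 1 - x ^+ 2 / 8.
Proof.
wlog x0 : x / 0 <= x.
  move=> H; have [/H//|/ltW x0] := leP 0 x.
  by rewrite -(normrN x) -cosN -sqrrN => /H; apply; rewrite oppr_ge0.
rewrite ger0_norm// => x2; rewrite cosE_half lerD2l lerN2.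
suff : x / 4 <= sin (x / 2).
  move=> H; have : (x / 4) ^+ 2 <= sin (x / 2) ^+ 2.
    by rewrite lerXn2r ?nnegrE ?divr_ge0// (le_trans _ H)// divr_ge0.
  by rewrite exprMn exprVn (_ : 4 ^+ 2 = 16 :> R)//; [lra|ring].
have [->|xn0] := eqVneq x 0; first by rewrite !mul0r sin0.
have xp : 0 < x / 2 by rewrite divr_gt0// lt_def xn0.
have [|c] := @MVT R sin cos 0 (x / 2) xp (fun t _ => is_derive_sin t).
  by apply: continuous_subspaceT => ?; exact: continuous_sin.
rewrite in_itv/= sin0 !subr0 => /andP[c0 cx] ->.
have c1 : c <= 1 by lra.
have := cos_ge_quad c; have : c ^+ 2 <= 1 by rewrite expr_le1// ltW.
move=> h1 h2; have : 1 / 2 <= cos c by lra.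
by move=> h3; have := ler_wpM2r (ltW xp) h3; lra.
Qed.

Lemma FTC2_continuous (f F : R -> R) a b : a <= b -> (forall x, is_derive x (1 : R) F (f x)) ->
  continuous f -> \int[mu]_(x in `[a, b]) f x = F b - F a.
Proof.
rewrite le_eqVlt => /predU1P[->|ab] dF cf.
  by rewrite set_itv1 Rintegral_set1 subrr.
have cF : continuous F.
  by move=> x; apply: differentiable_continuous; apply/derivable1_diffP; have [] := dF x.
rewrite /Rintegral (@continuous_FTC2 _ _ F)//.
- exact: continuous_subspaceT.
- split; first by move=> x _; have [] := dF x.
  + by apply: cvg_at_right_filter; exact: cF.
  + by apply: cvg_at_left_filter; exact: cF.
- by move=> x _; rewrite derive1E; have [_ ->] := dF x.
Qed.

End TrigBounds.

Section FejerKernel.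
Variable R : realType.
Notation mu := (@lebesgue_measure R).
Notation itg D f := (mu.-integrable D (EFin \o (f : R -> R))).
Variable L : R.
Hypothesis L0 : 0 < L.

Let L0' : 0 <= L. Proof. exact: ltW. Qed.

Definition fejer (z : R) : R := \int[mu]_(t in `[0, L]) ((1 - t / L) * cos (t * z)).

Let c1 : continuous (fun t : R => 1 - t / L).
Proof.
move=> x; apply: cvgB; first exact: cvg_cst.
exact: continuous_mulr_cst.
Qed.

Let cint z : continuous (fun t : R => (1 - t / L) * cos (t * z)).
Proof. by move=> x; apply: cvgM; [exact: c1|exact: continuous_cosM]. Qed.

Lemma itg_fejer z : itg `[0, L] (fun t => (1 - t / L) * cos (t * z)).
Proof. by apply: itg_cont; apply: continuous_subspaceT; exact: cint. Qed.

Let w01 t : 0 <= t <= L -> 0 <= 1 - t / L <= 1.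
Proof.
move=> /andP[t0 tL]; rewrite subr_ge0 ler_pdivrMr// mul1r tL/=.
by rewrite gerDl oppr_le0 divr_ge0.
Qed.

Lemma fejerE z : z != 0 -> fejer z = (1 - cos (L * z)) / (L * z ^+ 2).
Proof.
move=> z0.
pose F t := ((1 - t / L) * sin (t * z)) * z^-1 - cos (t * z) * (L * z ^+ 2)^-1.
have dF t : is_derive t (1 : R) F ((1 - t / L) * cos (t * z)).
  have dlin : is_derive t (1 : R) (fun t : R => 1 - t * L^-1) (- L^-1).
    have := is_deriveB (is_derive_cst (1 : R) t 1) (is_deriveM (is_derive_id t 1) (is_derive_cst L^-1 t 1)).
    by move=> /is_derive_eq; apply; rewrite /GRing.scale/=; ring.
  have := is_deriveB (is_deriveM (is_deriveM dlin (is_derive_sinM z t)) (is_derive_cst z^-1 t 1))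
    (is_deriveM (is_derive_cosM z t) (is_derive_cst (L * z ^+ 2)^-1 t 1)).
  move=> /is_derive_eq; apply; rewrite /GRing.scale/=; field.
  by rewrite z0 gt_eqF.
rewrite /fejer (FTC2_continuous (ltW L0) dF); last exact: cint.
rewrite /F !mul0r sin0 cos0 divff ?gt_eqF// subrr !mul0r !mulr0 !mul0r; field.
by rewrite z0 gt_eqF.
Qed.

Lemma fejer_ge0 z : 0 <= fejer z.
Proof.
have [->|z0] := eqVneq z 0.
  apply: Rintegral_ge0 => t; rewrite /= in_itv/= => /w01 /andP[w0 _].
  by rewrite mulr0 cos0 mulr1.
rewrite fejerE//; apply: divr_ge0; first by have := cos_le1 (L * z); lra.
by rewrite mulr_ge0 ?sqr_ge0.
Qed.

Lemma fejer_le z : fejer z <= L.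
Proof.
apply: (@le_trans _ _ (\int[mu]_(t in `[0, L]) 1)); last by rewrite Rint_itv// mul1r subr0.
apply: le_Rintegral => //; [exact: itg_fejer|exact: itg_cst|].
move=> t; rewrite /= in_itv/= => /w01 /andP[w0 w1].
rewrite -[leRHS]mulr1; apply: (le_trans (ler_wpM2l w0 (cos_le1 _))).
by rewrite !mulr1.
Qed.

Lemma fejer_le_far z : z != 0 -> fejer z <= 2 / (L * z ^+ 2).
Proof.
move=> z0; rewrite fejerE// ler_wpM2r//.
  by rewrite invr_ge0 mulr_ge0 ?sqr_ge0.
by have := cos_geN1 (L * z); lra.
Qed.

Lemma fejer_le_poisson z : fejer z <= 3 * L / (1 + (L * z) ^+ 2).
Proof.
have p0 : 0 < 1 + (L * z) ^+ 2 by rewrite ltr_wpDr// sqr_ge0.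
rewrite ler_pdivlMr// mulrDr mulr1.
have H : fejer z * (L * z) ^+ 2 <= 2 * L.
  have [->|z0] := eqVneq z 0; first by rewrite mulr0 expr0n/= mulr0 mulr_ge0.
  have := ler_wpM2r (sqr_ge0 (L * z)) (fejer_le_far z0).
  by rewrite (_ : 2 / _ * _ = 2 * L)//; field; rewrite z0 gt_eqF.
by have := fejer_le z; lra.
Qed.

Lemma fejer_ge z : `|z| <= L^-1 -> L / 8 <= fejer z.
Proof.
move=> zL; have H t : 0 <= t <= L -> 2^-1 <= cos (t * z).
  move=> /andP[t0 tL]; have := cos_ge_quad (t * z).
  have : (t * z) ^+ 2 <= 1.
    rewrite -(real_normK (num_real (t * z))) expr_le1// normrM (ger0_norm t0).
    apply: (le_trans (ler_pM t0 (normr_ge0 _) tL zL)).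
    by rewrite divff// gt_eqF.
  by lra.
have L2 : 0 <= L / 2 by rewrite divr_ge0.
apply: (@le_trans _ _ (\int[mu]_(t in `[0, L / 2]) ((1 - t / L) * cos (t * z)))).
  rewrite (_ : L / 8 = 4^-1 * (L / 2 - 0)); last by field.
  rewrite -Rint_itv//; apply: le_Rintegral => //; first exact: itg_cst.
    by apply: itg_cont; apply: continuous_subspaceT; exact: cint.
  move=> t; rewrite /= in_itv/= => /andP[t0 tL2].
  have tL : t <= L by move: tL2; have := L0; lra.
  have wt : 2^-1 <= 1 - t / L.
    by rewrite lerBrDr -lerBrDl ler_pdivrMr//; move: tL2; lra.
  have ct : 2^-1 <= cos (t * z) by apply: H; rewrite t0.
  rewrite (_ : 4^-1 = 2^-1 * 2^-1 :> R); last by field.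
  exact: ler_pM.
rewrite /fejer; apply: le_Rint_sub => //.
- by move=> t; rewrite /= !in_itv/= => /andP[-> tL2]/=; move: tL2; have := L0; lra.
- exact: itg_fejer.
- move=> t; rewrite /= in_itv/= => tL; have /andP[w0 _] := w01 tL.
  by rewrite mulr_ge0//; apply: le_trans (H _ tL).
Qed.

Lemma measurable_fejer : measurable_fun setT fejer.
Proof.
pose ch (t : R) : R := \1_(`[0, L]%classic) t.
have mch : measurable_fun setT ch by apply: measurable_indic; exact: measurable_itv.
rewrite (_ : fejer = fun z => \int[mu]_t (ch t * ((1 - t / L) * cos (t * z)))); last first.
  by apply/funext => z; rewrite (@Rint_indic R `[0, L]%classic (fun t => (1 - t / L) * cos (t * z))).
apply: (@measurable_param R (fun p => ch p.2 * ((1 - p.2 / L) * cos (p.2 * p.1)))).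
apply: measurable_funM; first exact: measurable_fun_snd.
apply: measurable_funM.
  by apply: (@measurable_fun_snd R (fun t => 1 - t / L)); exact: continuous_measurable_fun c1.
apply: measurableT_comp; first by apply: continuous_measurable_fun; exact: continuous_cos.
by apply: measurable_funM; [exact: measurable_snd|exact: measurable_fst].
Qed.

(** The mass of the kernel is bounded independently of L and of the window. *)
Lemma fejer_mass (x A : R) : 0 <= A -> \int[mu]_(y in `[- A, A]) fejer (x - y) <= 12.
Proof.
move=> A0; have AA : - A <= A by rewrite (le_trans _ A0)// oppr_le0.
pose F y : R := - (3 * atan (L * (x - y))).
have dF y : is_derive y (1 : R) F (3 * L / (1 + (L * (x - y)) ^+ 2)).
  have dlin : is_derive y (1 : R) (fun y : R => L * (x - y)) (- L).
    have := is_deriveM (is_derive_cst L y 1) (is_deriveB (is_derive_cst x y 1) (is_derive_id y 1)).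
    by move=> /is_derive_eq; apply; rewrite /GRing.scale/=; ring.
  have := @is_derive1_comp _ atan _ y _ _ (is_derive1_atan (L * (x - y))) dlin.
  move=> /(is_deriveZ (3 : R)) /is_deriveN /is_derive_eq; apply; rewrite /GRing.scale/=; ring.
have cP : continuous (fun y : R => 3 * L / (1 + (L * (x - y)) ^+ 2)).
  move=> y; apply: cvgM; first exact: cvg_cst.
  apply: cvgV; first by rewrite gt_eqF// ltr_wpDr// sqr_ge0.
  apply: cvgD; first exact: cvg_cst.
  have cl : {for y, continuous (fun y : R => L * (x - y))}.
    by apply: cvgM; [exact: cvg_cst|apply: cvgB; [exact: cvg_cst|exact: cvg_id]].
  exact: (continuous_comp cl (@exprn_continuous _ 2 _)).
apply: (@le_trans _ _ (\int[mu]_(y in `[- A, A]) (3 * L / (1 + (L * (x - y)) ^+ 2)))).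
  apply: le_Rintegral => //.
  - apply: (@itg_bnd _ _ _ L) => //; first exact: mu_itv_lty.
      apply: (measurable_funS _ (@subsetT _ _)) => //.
      apply: measurableT_comp; first exact: measurable_fejer.
      by apply: measurable_funB => //; exact: measurable_cst.
    by move=> y _; rewrite ger0_norm ?fejer_ge0 ?fejer_le.
  - by apply: itg_cont; exact: continuous_subspaceT.
  - by move=> y _; exact: fejer_le_poisson.
rewrite (FTC2_continuous AA dF cP) /F.
have pi4 : pi / 2 <= 2 :> R by have [/andP[]] := pihalf_02_cos_pihalf R.
rewrite (opprK A).
have := atan_ltpi2 (L * (x + A)); have := atan_gtNpi2 (L * (x - A)).
set u := atan (L * (x - A)); set v := atan (L * (x + A)).
move: pi4; set p := pi / 2 => *; clearbody u v p. lra.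
Qed.

End FejerKernel.

Section Spectrum.
Variable R : realType.
Notation mu := (@lebesgue_measure R).
Notation itg D f := (mu.-integrable D (EFin \o (f : R -> R))).
Implicit Types (b g : R -> R).

Definition fcos b (eta : R) : R := \int[mu]_x (b x * cos (eta * x)).
Definition fsin b (eta : R) : R := \int[mu]_x (b x * sin (eta * x)).
Definition power_spectrum b (eta : R) : R := fcos b eta ^+ 2 + fsin b eta ^+ 2.

Lemma power_spectrum_ge0 b eta : 0 <= power_spectrum b eta.
Proof. by rewrite addr_ge0// sqr_ge0. Qed.

Lemma measurable_cosM2 : measurable_fun setT (fun p : R * R => cos (p.1 * p.2)).
Proof.
apply: measurableT_comp; first by apply: continuous_measurable_fun; exact: continuous_cos.
by apply: measurable_funM; [exact: measurable_fst|exact: measurable_snd].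
Qed.

Lemma measurable_sinM2 : measurable_fun setT (fun p : R * R => sin (p.1 * p.2)).
Proof.
apply: measurableT_comp; first by apply: continuous_measurable_fun; exact: continuous_sin.
by apply: measurable_funM; [exact: measurable_fst|exact: measurable_snd].
Qed.

Lemma itg_cos b eta : itg setT b -> itg setT (fun x => b x * cos (eta * x)).
Proof.
move=> bi; apply: (@itgMb _ _ _ _ 1) => //; last by move=> x _; exact: cos_max.
exact: (measurable_fun_pair2 eta measurable_cosM2).
Qed.

Lemma itg_sin b eta : itg setT b -> itg setT (fun x => b x * sin (eta * x)).
Proof.
move=> bi; apply: (@itgMb _ _ _ _ 1) => //; last by move=> x _; exact: sin_max.
exact: (measurable_fun_pair2 eta measurable_sinM2).
Qed.

Lemma measurable_fcos b : itg setT b -> measurable_fun setT (fcos b).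
Proof.
move=> bi; apply: (@measurable_param R (fun p => b p.2 * cos (p.1 * p.2))).
apply: measurable_funM; last exact: measurable_cosM2.
by apply: measurable_fun_snd; exact: itg_meas bi.
Qed.

Lemma measurable_fsin b : itg setT b -> measurable_fun setT (fsin b).
Proof.
move=> bi; apply: (@measurable_param R (fun p => b p.2 * sin (p.1 * p.2))).
apply: measurable_funM; last exact: measurable_sinM2.
by apply: measurable_fun_snd; exact: itg_meas bi.
Qed.

Lemma measurable_power_spectrum b : itg setT b -> measurable_fun setT (power_spectrum b).
Proof.
move=> bi; apply: measurable_funD; apply: measurable_funX.
- exact: measurable_fcos.
- exact: measurable_fsin.
Qed.

Lemma normr_fcos_le b eta : itg setT b -> `|fcos b eta| <= \int[mu]_x `|b x|.
Proof.
move=> bi; have ci := itg_cos eta bi.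
apply: (le_trans (le_normr_Rintegral _ ci)) => //; apply: le_Rintegral => //; [exact: itg_abs|exact: itg_abs|].
by move=> x _; rewrite normrM -[leRHS]mulr1 ler_wpM2l// cos_max.
Qed.

Lemma normr_fsin_le b eta : itg setT b -> `|fsin b eta| <= \int[mu]_x `|b x|.
Proof.
move=> bi; have ci := itg_sin eta bi.
apply: (le_trans (le_normr_Rintegral _ ci)) => //; apply: le_Rintegral => //; [exact: itg_abs|exact: itg_abs|].
by move=> x _; rewrite normrM -[leRHS]mulr1 ler_wpM2l// sin_max.
Qed.

Lemma fcos_shift b eta x : itg setT b ->
  \int[mu]_y (b y * cos (eta * (x - y))) =
  fcos b eta * cos (eta * x) + fsin b eta * sin (eta * x).
Proof.
move=> bi; have ci := itg_cos eta bi; have si := itg_sin eta bi.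
rewrite -RintegralZr// -RintegralZr// -RintegralD//; last 2 first.
- by move: (itgZ (cos (eta * x)) measurableT ci); under [X in _ -> itg _ X]eq_fun do rewrite mulrC.
- by move: (itgZ (sin (eta * x)) measurableT si); under [X in _ -> itg _ X]eq_fun do rewrite mulrC.
by apply: eq_Rintegral => y _; rewrite mulrBr cosB; ring.
Qed.

Lemma power_spectrumE b eta : itg setT b ->
  power_spectrum b eta =
  \int[mu]_x (b x * (fcos b eta * cos (eta * x) + fsin b eta * sin (eta * x))).
Proof.
move=> bi; have ci := itg_cos eta bi; have si := itg_sin eta bi.
transitivity (\int[mu]_x (fcos b eta * (b x * cos (eta * x)) + fsin b eta * (b x * sin (eta * x)))).
  by rewrite RintegralD// ?RintegralZl//; [exact: itgZ|exact: itgZ].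
by apply: eq_Rintegral => x _; ring.
Qed.

(** Integrating the spectrum against the Fejer weight gives the quadratic form of the Fejer kernel. *)
Lemma fejer_power_spectrum b L : 0 < L -> itg setT b ->
  \int[mu]_(eta in `[0, L]) ((1 - eta / L) * power_spectrum b eta) =
  \int[mu]_x (b x * \int[mu]_y (b y * fejer L (x - y))).
Proof.
move=> L0 bi; set M := \int[mu]_x `|b x|.
have M0 : 0 <= M by exact: Rintegral_ge0.
pose om : R -> R := (fun eta => 1 - eta / L) \_ `[0, L].
have omi : itg setT om.
  apply/(itg_mkcond _ (measurable_itv _)).1; apply: itg_cont; apply: continuous_subspaceT => x.
  by apply: cvgB; [exact: cvg_cst|exact: continuous_mulr_cst].
have omE (F : R -> R) : \int[mu]_(eta in `[0, L]) ((1 - eta / L) * F eta) = \int[mu]_eta (om eta * F eta).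
  rewrite Rintegral_mkcond; apply: eq_Rintegral => x _; rewrite /om !patchE.
  by case: ifP => // _; rewrite mul0r.
have mfc := measurable_fcos bi; have mfs := measurable_fsin bi.
pose k (p : R * R) := fcos b p.1 * cos (p.1 * p.2) + fsin b p.1 * sin (p.1 * p.2).
have mk : measurable_fun setT k.
  apply: measurable_funD; apply: measurable_funM.
  - exact: measurable_fun_fst.
  - exact: measurable_cosM2.
  - exact: measurable_fun_fst.
  - exact: measurable_sinM2.
have kM p : `|k p| <= M + M.
  rewrite (le_trans (ler_normD _ _))// !normrM lerD//.
  - by rewrite -[leRHS]mulr1 ler_pM// ?cos_max//; exact: normr_fcos_le.
  - by rewrite -[leRHS]mulr1 ler_pM// ?sin_max//; exact: normr_fsin_le.
rewrite omE; transitivity (\int[mu]_eta (om eta * \int[mu]_x (b x * k (eta, x)))).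
  by apply: eq_Rintegral => eta _; rewrite power_spectrumE.
rewrite (fubini_bounded omi bi mk kM); apply: eq_Rintegral => x _; congr (_ * _).
pose k' (p : R * R) := cos (p.1 * (x - p.2)).
have mk' : measurable_fun setT k'.
  apply: (@measurableT_comp _ _ _ _ _ _ _ _ (fun p : R * R => p.1 * (x - p.2))).
    by apply: continuous_measurable_fun; exact: continuous_cos.
  apply: measurable_funM; first exact: measurable_fst.
  by apply: measurable_funB; [exact: measurable_cst|exact: measurable_snd].
have k'M p : `|k' p| <= 1 by exact: cos_max.
transitivity (\int[mu]_eta (om eta * \int[mu]_y (b y * k' (eta, y)))).
  by apply: eq_Rintegral => eta _; rewrite /k/= /k'/= fcos_shift.
rewrite (fubini_bounded omi bi mk' k'M); apply: eq_Rintegral => y _; congr (_ * _).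
by rewrite /fejer omE.
Qed.

End Spectrum.

Section Bessel.
Variable R : realType.
Notation mu := (@lebesgue_measure R).
Notation itg D f := (mu.-integrable D (EFin \o (f : R -> R))).
Implicit Types (b g : R -> R).

(** Square-integrable functions vanishing outside [- A, A] *)
Definition compact_L2 (A : R) b : Prop :=
  [/\ measurable_fun setT b, itg setT (fun x => b x ^+ 2) &
      forall x, ~~ (- A <= x <= A) -> b x = 0].

Lemma compact_L2_itg A b : compact_L2 A b -> itg setT b.
Proof.
move=> [mb b2 bA].
apply: (@itg_le _ _ _ (fun x => \1_(`[- A, A]%classic) x + b x ^+ 2)) => //.
  move=> x _; rewrite indicE mem_itvcc; case: (boolP (_ <= _ <= _)) => [_|/bA ->]; last first.
    by rewrite normr0 add0r sqr_ge0.
  rewrite -[X in _ <= X + _]/(1 : R) -(real_normK (num_real (b x))); move: `|b x| => u.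
  by have := sqr_ge0 (u - 1); rewrite !expr2; nra.
by apply: itgD => //; exact: itg_indic_itv.
Qed.

Lemma fejerN L (z : R) : fejer L (- z) = fejer L z.
Proof. by apply: eq_Rintegral => t _; rewrite mulrN cosN. Qed.

Lemma measurable_fejerB (L : R) : 0 < L -> measurable_fun setT (fun p : R * R => fejer L (p.1 - p.2)).
Proof.
move=> L0; apply: measurableT_comp; first exact: measurable_fejer.
by apply: measurable_funB; [exact: measurable_fst|exact: measurable_snd].
Qed.

Lemma fejer_form_le A b L : 0 < L -> 0 <= A -> compact_L2 A b ->
  \int[mu]_x (b x * \int[mu]_y (b y * fejer L (x - y))) <= 12 * \int[mu]_x b x ^+ 2.
Proof.
move=> L0 A0 bA; have bi := compact_L2_itg bA; have [mb b2 bsupp] := bA.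
pose ch (x : R) : R := \1_(`[- A, A]%classic) x.
have chi : itg setT ch by exact: itg_indic_itv.
have mch := itg_meas chi.
have bch x : b x = ch x * b x.
  rewrite /ch indicE mem_itvcc; case: (boolP (_ <= _ <= _)) => [_|/bsupp ->]; by rewrite ?mul1r ?mulr0.
have ch01 x : ch x = 0 \/ ch x = 1 by rewrite /ch indicE; case: (_ \in _); [right|left].
pose K (p : R * R) := fejer L (p.1 - p.2).
have mK : measurable_fun setT K by exact: measurable_fejerB.
have KL p : `|K p| <= L by rewrite ger0_norm ?fejer_ge0 ?fejer_le.
have K0 p : 0 <= K p by exact: fejer_ge0.
have mK1 x : measurable_fun setT (fun y => K (x, y)) by exact: (measurable_fun_pair2 x mK).
have mass x : \int[mu]_y (ch y * K (x, y)) <= 12.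
  rewrite (@Rint_indic R `[- A, A]%classic (fun y => K (x, y))); last exact: measurable_itv.
  exact: fejer_mass.
have massi x : itg setT (fun y => ch y * K (x, y)) by apply: itgMb.
have b2Ki x : itg setT (fun y => b y ^+ 2 * K (x, y)) by apply: itgMb.
have bKi x : itg setT (fun y => b y * K (x, y)) by apply: itgMb.
pose F1 x := \int[mu]_y (ch y * K (x, y)); pose F2 x := \int[mu]_y (b y ^+ 2 * K (x, y)).
have mF1 : measurable_fun setT F1.
  apply: (@measurable_param R (fun p => ch p.2 * K p)).
  by apply: measurable_funM => //; exact: measurable_fun_snd.
have mF2 : measurable_fun setT F2.
  apply: (@measurable_param R (fun p => b p.2 ^+ 2 * K p)).
  apply: measurable_funM => //; apply: (@measurable_fun_snd R (fun y => b y ^+ 2)).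
  exact: measurable_funX.
have F10 x : 0 <= F1 x.
  by apply: Rintegral_ge0 => y _; rewrite mulr_ge0//; case: (ch01 y) => ->.
have F20 x : 0 <= F2 x by apply: Rintegral_ge0 => y _; rewrite mulr_ge0// sqr_ge0.
have F2M x : F2 x <= L * \int[mu]_y b y ^+ 2.
  rewrite -RintegralZl//; apply: le_Rintegral => //; first exact: itgZ.
  move=> y _; rewrite mulrC ler_wpM2r ?sqr_ge0//.
  by rewrite (le_trans (ler_norm _)).
have i1 : itg setT (fun x => b x ^+ 2 * F1 x).
  by apply: (@itgMb _ _ _ _ 12) => // x _; rewrite ger0_norm// mass.
have i2 : itg setT (fun x => ch x * F2 x).
  by apply: (@itgMb _ _ _ _ (L * \int[mu]_y b y ^+ 2)) => // x _; rewrite ger0_norm.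
have i12 : itg setT (fun x => 2^-1 * (b x ^+ 2 * F1 x + ch x * F2 x)).
  by apply: itgZ => //; exact: itgD.
have iL : itg setT (fun x => b x * \int[mu]_y (b y * K (x, y))).
  apply: (@itgMb _ _ _ _ (L * \int[mu]_y `|b y|)) => //.
    apply: (@measurable_param R (fun p => b p.2 * K p)).
    by apply: measurable_funM => //; exact: measurable_fun_snd.
  move=> x _; apply: (le_trans (le_normr_Rintegral _ (bKi x))) => //.
  rewrite -RintegralZl//; last exact: itg_abs.
  apply: le_Rintegral => //; [exact: itg_abs|by apply: itgZ => //; exact: itg_abs|].
  by move=> y _; rewrite normrM mulrC ler_wpM2r.
have S1 : \int[mu]_y (b y ^+ 2 * F1 y) <= 12 * \int[mu]_y b y ^+ 2.
  rewrite -RintegralZl//; apply: le_Rintegral => //; first exact: itgZ.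
  by move=> x _; rewrite mulrC ler_wpM2r ?sqr_ge0// mass.
have pw x : b x * \int[mu]_y (b y * K (x, y)) <= 2^-1 * (b x ^+ 2 * F1 x + ch x * F2 x).
  have [chx|chx] := ch01 x.
    have -> : b x = 0 by rewrite bch chx mul0r.
    by rewrite mul0r expr0n mul0r add0r chx mul0r mulr0.
  rewrite chx mul1r /F1 /F2 -!RintegralZl//.
  rewrite -RintegralD//; last exact: itgZ.
  rewrite -RintegralZl//; last by apply: itgD => //; exact: itgZ.
  apply: le_Rintegral => //; first exact: itgZ.
    by apply: itgZ => //; apply: itgD => //; exact: itgZ.
  move=> y _; rewrite mulrA (_ : 2^-1 * _ = (2^-1 * (b x ^+ 2 * ch y + b y ^+ 2)) * K (x, y)); last by ring.
  apply: ler_wpM2r => //; rewrite (bch y); case: (ch01 y) => ->.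
    by rewrite !mul0r !mulr0 expr0n addr0 mulr0.
  by have := sqr_ge0 (b x - b y); rewrite !expr2; nra.
have S2 : \int[mu]_x (ch x * F2 x) = \int[mu]_y (b y ^+ 2 * F1 y).
  rewrite /F2 (fubini_bounded chi b2 mK KL); apply: eq_Rintegral => y _; congr (_ * _).
  by apply: eq_Rintegral => x _; rewrite /K/= -fejerN opprB.
apply: (le_trans (le_Rintegral measurableT iL i12 (fun x _ => pw x))).
rewrite (RintegralZl _ measurableT (itgD measurableT i1 i2)) (RintegralD measurableT i1 i2) S2.
by move: S1; set X := \int[mu]_y _; set Y := \int[mu]_x _ => S1; clear -S1; lra.
Qed.

End Bessel.

Section Bessel2.
Variable R : realType.
Notation mu := (@lebesgue_measure R).
Notation itg D f := (mu.-integrable D (EFin \o (f : R -> R))).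
Implicit Types (b g : R -> R).

Let itg_weighted b L : 0 < L -> itg setT b ->
  itg `[0, L] (fun eta => (1 - eta / L) * power_spectrum b eta).
Proof.
move=> L0 bi; set M := \int[mu]_x `|b x|.
apply: (@itgMb _ _ _ _ (M ^+ 2 + M ^+ 2)) => //.
- apply: itg_cont; apply: continuous_subspaceT => x.
  by apply: cvgB; [exact: cvg_cst|exact: continuous_mulr_cst].
- exact: measurable_funS (measurable_power_spectrum bi).
- move=> x _; rewrite ger0_norm ?power_spectrum_ge0// /power_spectrum.
  rewrite -(real_normK (num_real (fcos b x))) -(real_normK (num_real (fsin b x))).
  have M0 : 0 <= M by exact: Rintegral_ge0.
  by rewrite lerD// lerXn2r ?nnegrE//; [exact: normr_fcos_le|exact: normr_fsin_le].
Qed.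

Let itg_ps b L : itg setT b -> itg `[0, L] (power_spectrum b).
Proof.
move=> bi; set M := \int[mu]_x `|b x|.
apply: (@itg_bnd _ _ _ (M ^+ 2 + M ^+ 2)) => //; first exact: mu_itv_lty.
- exact: measurable_funS (measurable_power_spectrum bi).
- move=> x _; rewrite ger0_norm ?power_spectrum_ge0// /power_spectrum.
  rewrite -(real_normK (num_real (fcos b x))) -(real_normK (num_real (fsin b x))).
  have M0 : 0 <= M by exact: Rintegral_ge0.
  by rewrite lerD// lerXn2r ?nnegrE//; [exact: normr_fcos_le|exact: normr_fsin_le].
Qed.

Lemma bessel A b : 0 <= A -> compact_L2 A b ->
  (\int[mu]_(eta in `[0%R, +oo[) (power_spectrum b eta)%:E <= (24 * \int[mu]_x b x ^+ 2)%:E)%E.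
Proof.
move=> A0 bA; have bi := compact_L2_itg bA.
have fin n : \int[mu]_(eta in `[0, n%:R]) power_spectrum b eta <= 24 * \int[mu]_x b x ^+ 2.
  case: n => [|n]; first by rewrite set_itv1 Rintegral_set1 mulr_ge0//; apply: Rintegral_ge0 => x _; exact: sqr_ge0.
  pose L : R := 2 * n.+1%:R; have L0 : 0 < L by rewrite mulr_gt0.
  have := fejer_form_le L0 A0 bA; rewrite -fejer_power_spectrum// => H.
  have H2 : \int[mu]_(eta in `[0, n.+1%:R]) (2^-1 * power_spectrum b eta) <=
      \int[mu]_(eta in `[0, L]) ((1 - eta / L) * power_spectrum b eta).
    have sub : `[0, n.+1%:R]%classic `<=` `[0, L]%classic.
      move=> x; rewrite /= !in_itv/= => /andP[-> xn]/=; rewrite (le_trans xn)// /L.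
      by rewrite ler_peMl// ler1n.
    apply: (@le_trans _ _ (\int[mu]_(eta in `[0, n.+1%:R]) ((1 - eta / L) * power_spectrum b eta))).
      apply: le_Rintegral => //.
      - by apply: itgZ => //; exact: itg_ps.
      - exact: itg_mono (itg_weighted L0 bi).
      - move=> x; rewrite /= in_itv/= => /andP[x0 xn].
        rewrite ler_wpM2r ?power_spectrum_ge0// lerBrDr -lerBrDl ler_pdivrMr//.
        by rewrite (_ : (1 - 2^-1) * L = n.+1%:R)// /L; field.
    apply: le_Rint_sub => //; first exact: itg_weighted.
    move=> x; rewrite /= in_itv/= => /andP[x0 xL]; rewrite mulr_ge0 ?power_spectrum_ge0//.
    by rewrite subr_ge0 ler_pdivrMr// mul1r.
  rewrite RintegralZl// in H2; last exact: itg_ps.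
  by move: (le_trans H2 H); set X := \int[mu]_(_ in _) _; set Y := \int[mu]_x _; lra.
have f0 x : 0 <= power_spectrum b x := power_spectrum_ge0 b x.
have H : (\int[mu]_(x in `[0%R, n%:R]) (power_spectrum b x)%:E @[n --> \oo] -->
    \int[mu]_(x in `[0%R, +oo[) (power_spectrum b x)%:E)%E.
  exact: ge0_cvgn_integral f0 (measurable_power_spectrum bi).
rewrite -(cvg_lim _ H)//; apply: lime_le; first by apply/cvg_ex; eexists; exact: H.
by near=> n; rewrite -Rint_efin ?lee_fin//; exact: itg_ps.
Unshelve. all: by end_near. Qed.

Lemma itg_power_spectrum A b : 0 <= A -> compact_L2 A b -> itg `[0, +oo[ (power_spectrum b).
Proof.
move=> A0 bA; have bi := compact_L2_itg bA; apply/integrableP; split.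
  by apply/measurable_EFinP; exact: measurable_funS (measurable_power_spectrum bi).
under eq_integral do rewrite /= ger0_norm ?power_spectrum_ge0//.
by rewrite (le_lt_trans (bessel A0 bA))// ltry.
Qed.

Lemma fejer_form_ge A M g L d ep : 1 <= L -> 0 <= A -> 0 < d -> 0 <= ep -> compact_L2 A g ->
  (forall x, `|g x| <= M) -> (forall x y, `|x - y| < d -> `|g x - g y| <= ep) ->
  4^-1 * \int[mu]_x g x ^+ 2 - (12 * ep + (M + M) * (2 / (L * d ^+ 2)) * (2 * (A + 1))) * \int[mu]_x `|g x|
  <= \int[mu]_x (g x * \int[mu]_y (g y * fejer L (x - y))).
Proof.
move=> L1 A0 d0 ep0 gA gM gep.
have L0 : 0 < L by exact: lt_le_trans L1.
have M0 : 0 <= M by exact: le_trans (gM 0).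
have gi := compact_L2_itg gA; have [mg g2 gsupp] := gA.
set c := (M + M) * (2 / (L * d ^+ 2)).
have c0 : 0 <= c by rewrite mulr_ge0 ?addr_ge0// divr_ge0// mulr_ge0 ?sqr_ge0// ltW.
have B0 : 0 <= A + 1 by rewrite addr_ge0.
pose ch (x : R) : R := \1_(`[- (A + 1), A + 1]%classic) x.
have chi : itg setT ch by exact: itg_indic_itv.
have mch := itg_meas chi.
have gch x : g x = ch x * g x.
  rewrite /ch indicE mem_itvcc; have [xA|/negP] := boolP (- A <= x <= A); last first.
    by move=> /negP/gsupp ->; rewrite mulr0.
  rewrite (_ : _ <= x <= _ = true) ?mul1r//; apply/andP; move: xA => /andP[? ?]; split; lra.
have ch01 x : ch x = 0 \/ ch x = 1 by rewrite /ch indicE; case: (_ \in _); [right|left].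
pose K (p : R * R) := fejer L (p.1 - p.2).
have mK : measurable_fun setT K by exact: measurable_fejerB.
have KL p : `|K p| <= L by rewrite ger0_norm ?fejer_ge0 ?fejer_le.
have K0 p : 0 <= K p by exact: fejer_ge0.
have mK1 x : measurable_fun setT (fun y => K (x, y)) by exact: (measurable_fun_pair2 x mK).
have mass x : \int[mu]_y (ch y * K (x, y)) <= 12.
  rewrite (@Rint_indic R `[- (A + 1), A + 1]%classic (fun y => K (x, y))); last exact: measurable_itv.
  exact: fejer_mass.
have massi x : itg setT (fun y => ch y * K (x, y)) by apply: itgMb.
have gKi x : itg setT (fun y => g y * K (x, y)) by apply: itgMb.
have mass_ge x : - A <= x <= A -> 4^-1 <= \int[mu]_y (ch y * K (x, y)).
  move=> /andP[Ax xA].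
  rewrite (@Rint_indic R `[- (A + 1), A + 1]%classic (fun y => K (x, y))); last exact: measurable_itv.
  have Li1 : L^-1 <= 1 by rewrite invf_le1.
  have Li0 : 0 < L^-1 by rewrite invr_gt0.
  have KI u v : itg `[u, v] (fun y => K (x, y)).
    apply: (@itg_bnd _ _ _ L) => //; first exact: mu_itv_lty.
    exact: measurable_funS (mK1 x).
  have xx : x - L^-1 <= x + L^-1 by lra.
  apply: (@le_trans _ _ (\int[mu]_(y in `[x - L^-1, x + L^-1]) K (x, y))).
    apply: (@le_trans _ _ (\int[mu]_(y in `[x - L^-1, x + L^-1]) (L / 8))).
      rewrite Rint_itv// (_ : L / 8 * _ = 4^-1)//; field; exact: lt0r_neq0.
    apply: le_Rintegral => //; first exact: itg_cst.
    move=> y; rewrite /= in_itv/= => /andP[y1 y2]; apply: fejer_ge => //.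
    by rewrite /= ler_norml; apply/andP; split; lra.
  apply: le_Rint_sub => // y; rewrite /= !in_itv/= => /andP[y1 y2]; apply/andP; split; lra.
have pw x : 4^-1 * g x ^+ 2 - (12 * ep + c * (2 * (A + 1))) * `|g x| <= g x * \int[mu]_y (g y * K (x, y)).
  have [xA|/gsupp ->] := boolP (- A <= x <= A); last by rewrite normr0 expr0n !mulr0 subr0 mul0r.
  have i1 := itgZ (g x ^+ 2) measurableT (massi x).
  have i2 := itgZ (`|g x|) measurableT (itgD measurableT (itgZ ep measurableT (massi x)) (itgZ c measurableT chi)).
  have H : \int[mu]_y (g x ^+ 2 * (ch y * K (x, y)) - `|g x| * (ep * (ch y * K (x, y)) + c * ch y)) <=
      \int[mu]_y (g x * (g y * K (x, y))).
    apply: le_Rintegral; [exact: measurableT|exact: itgB|exact: itgZ|].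
    move=> y _; rewrite (gch y); case: (ch01 y) => ->; first by rewrite !(mul0r, mulr0) addr0 mulr0 subr0.
    rewrite !mul1r mulr1.
    have key : `|g x - g y| * K (x, y) <= ep * K (x, y) + c.
      have [xy|xy] := ltP `|x - y| d.
        by rewrite (le_trans (ler_wpM2r (K0 _) (gep _ _ xy)))// lerDl.
      have xy0 : x - y != 0 by rewrite -normr_gt0 (lt_le_trans d0).
      apply: (@le_trans _ _ c); last by rewrite lerDr mulr_ge0.
      rewrite /c; apply: ler_pM => //; first by rewrite (le_trans (ler_normB _ _))// lerD.
      apply: (le_trans (fejer_le_far L0 xy0)); rewrite ler_wpM2l// lef_pV2 ?posrE.
      - rewrite ler_wpM2l ?(ltW L0)// -(real_normK (num_real (x - y))) lerXn2r ?nnegrE//; exact: ltW.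
      - by rewrite mulr_gt0// exprn_even_gt0.
      - by rewrite mulr_gt0// exprn_gt0.
    have := ler_wpM2l (normr_ge0 (g x)) key.
    have : g x * (g x - g y) * K (x, y) <= `|g x| * (`|g x - g y| * K (x, y)).
      by rewrite mulrA ler_wpM2r// -normrM ler_norm.
    move=> h1 h2; rewrite -subr_ge0.
    by have := le_trans h1 h2; rewrite -subr_ge0; congr (0 <= _); ring.
  rewrite RintegralZl// in H; apply: le_trans H.
  rewrite (RintegralB measurableT i1 i2) (RintegralZl _ measurableT (massi x)).
  rewrite (RintegralZl _ measurableT (itgD measurableT (itgZ ep measurableT (massi x)) (itgZ c measurableT chi))).
  rewrite (RintegralD measurableT (itgZ ep measurableT (massi x)) (itgZ c measurableT chi)).
  rewrite (RintegralZl _ measurableT (massi x)) (RintegralZl _ measurableT chi).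
  have -> : \int[mu]_y ch y = 2 * (A + 1).
    transitivity (\int[mu]_y (ch y * 1)); first by apply: eq_Rintegral => y _; rewrite mulr1.
    rewrite (@Rint_indic R `[- (A + 1), A + 1]%classic (fun=> 1)); last exact: measurable_itv.
    by rewrite Rint_itv; [ring|lra].
  have m1 := mass x; have m2 := mass_ge x xA.
  move: m1 m2; set m := \int[mu]_y _ => m1 m2.
  apply: lerB; first by rewrite [leLHS]mulrC ler_wpM2l ?sqr_ge0.
  by rewrite [leRHS]mulrC ler_wpM2l// lerD2r [leRHS]mulrC ler_wpM2l.
have iL : itg setT (fun x => g x * \int[mu]_y (g y * K (x, y))).
  apply: (@itgMb _ _ _ _ (L * \int[mu]_y `|g y|)) => [//|//||].
    apply: (@measurable_param R (fun p => g p.2 * K p)).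
    by apply: measurable_funM mK; exact: measurable_fun_snd.
  move=> x _; apply: (le_trans (le_normr_Rintegral measurableT (gKi x))).
  rewrite -(RintegralZl _ measurableT (itg_abs measurableT gi)).
  apply: le_Rintegral; [exact: measurableT|exact: itg_abs|by apply: itgZ; [|exact: itg_abs]|].
  by move=> y _; rewrite normrM mulrC ler_wpM2r.
have i1 := itgZ 4^-1 measurableT g2.
have i2 := itgZ (12 * ep + c * (2 * (A + 1))) measurableT (itg_abs measurableT gi).
rewrite -(RintegralZl _ measurableT g2) -(RintegralZl _ measurableT (itg_abs measurableT gi)).
rewrite -(RintegralB measurableT i1 i2).
exact: (le_Rintegral measurableT (itgB measurableT i1 i2) iL (fun x _ => pw x)).
Qed.

(** The reverse of Bessel's inequality up to a constant: uniform continuity makes the Fejer kernel an approximate identity. *)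
Lemma reverse_bessel A M g : 0 <= A -> compact_L2 A g -> (forall x, `|g x| <= M) ->
  (forall ep, 0 < ep -> exists2 d, 0 < d & forall x y, `|x - y| < d -> `|g x - g y| <= ep) ->
  \int[mu]_x g x ^+ 2 <= 4 * \int[mu]_(eta in `[0, +oo[) power_spectrum g eta.
Proof.
move=> A0 gA gM gu; have gi := compact_L2_itg gA.
set S := \int[mu]_(eta in `[0, +oo[) _; set G := \int[mu]_x g x ^+ 2; set N := \int[mu]_x `|g x|.
have N0 : 0 <= N by exact: Rintegral_ge0.
have M0 : 0 <= M by exact: le_trans (gM 0).
rewrite -ler_pdivrMl//.
apply/ler_addgt0Pl => e e0.
pose ep := e / (24 * (N + 1)).
have N1 : 0 < N + 1 by rewrite ltr_wpDl.
have ep0 : 0 < ep by rewrite divr_gt0// mulr_gt0.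
have [d d0 gd] := gu _ ep0.
pose k := (M + M) * 2 * (2 * (A + 1)) / d ^+ 2.
have k0 : 0 <= k by rewrite divr_ge0 ?sqr_ge0// !mulr_ge0 ?addr_ge0.
pose L := 1 + 2 * k * (N + 1) / e.
have L1 : 1 <= L.
  rewrite lerDl; apply: divr_ge0; last exact: ltW.
  by apply: mulr_ge0; [exact: mulr_ge0|exact: ltW].
have L0 : 0 < L by exact: lt_le_trans L1.
have := fejer_form_ge L1 A0 d0 (ltW ep0) gA gM gd.
rewrite -fejer_power_spectrum// -/G -/N => H.
have H2 : \int[mu]_(eta in `[0, L]) ((1 - eta / L) * power_spectrum g eta) <= S.
  apply: (@le_trans _ _ (\int[mu]_(eta in `[0, L]) power_spectrum g eta)).
    apply: le_Rintegral => //; [exact: itg_weighted|exact: itg_ps|].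
    move=> x; rewrite /= in_itv/= => /andP[x0 xL].
    by rewrite -[leRHS]mul1r ler_wpM2r ?power_spectrum_ge0// gerDl oppr_le0 divr_ge0// ltW.
  rewrite /S; apply: le_Rint_sub => //.
  - by move=> x; rewrite /= !in_itv/= => /andP[->].
  - exact: itg_power_spectrum gA.
  - by move=> x _; exact: power_spectrum_ge0.
have H3 := le_trans H H2.
have E1 : 12 * ep * N <= e / 2.
  rewrite /ep (_ : 12 * (e / (24 * (N + 1))) * N = (e / 2) * (N / (N + 1))); last by field; rewrite gt_eqF.
  by rewrite -[leRHS]mulr1 ler_wpM2l ?divr_ge0 ?(ltW e0)// ler_pdivrMr// mul1r lerDl.
have E2 : (M + M) * (2 / (L * d ^+ 2)) * (2 * (A + 1)) * N <= e / 2.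
  rewrite (_ : (M + M) * (2 / (L * d ^+ 2)) * (2 * (A + 1)) * N = k * N / L); last first.
    by rewrite /k; field; rewrite !gt_eqF.
  rewrite ler_pdivrMr// (_ : e / 2 * L = e / 2 + k * (N + 1)); last first.
    by rewrite /L; field; rewrite gt_eqF.
  rewrite mulrDr mulr1 addrCA lerDl addr_ge0// divr_ge0// ltW//.
move: H3; rewrite mulrDl; move: E1 E2.
set X := 12 * ep * N; set Y := _ * N => E1 E2 H3; clear -E1 E2 H3; lra.
Qed.

End Bessel2.

Section BoxAverage.
Variable R : realType.
Notation mu := (@lebesgue_measure R).
Notation itg D f := (mu.-integrable D (EFin \o (f : R -> R))).
Variables (A : R) (b : R -> R).
Hypotheses (A0 : 0 <= A) (bA : compact_L2 A b).

Let bi : itg setT b. Proof. exact: compact_L2_itg bA. Qed.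
Let mb : measurable_fun setT b. Proof. exact: itg_meas bi. Qed.
Let b2 : itg setT (fun x => b x ^+ 2). Proof. by case: bA. Qed.
Let biI (u v : R) : itg `[u, v] b. Proof. exact: itg_mono bi. Qed.

Definition box_sum (b : R -> R) (t x : R) : R := \int[mu]_(s in `[x, x + t]) b s.

Lemma box_sum_primitive t x : 0 <= t -> box_sum b t x = primitive b (x + t) - primitive b x.
Proof. by move=> t0; rewrite primitiveB// lerDl. Qed.

Lemma primitive_continuous : continuous (primitive b).
Proof. by apply: loc_ac_continuous => u v; exact: primitive_ac. Qed.

Lemma box_sum_continuous t : 0 <= t -> continuous (box_sum b t).
Proof.
move=> t0; rewrite (_ : box_sum b t = fun x => primitive b (x + t) - primitive b x); last first.
  by apply/funext => x; rewrite box_sum_primitive.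
move=> x; apply: cvgB; last exact: primitive_continuous.
apply: (@continuous_comp _ _ _ (fun x => x + t) (primitive b)); last exact: primitive_continuous.
by apply: cvgD; [exact: cvg_id|exact: cvg_cst].
Qed.

Lemma primitive_holder x y : x <= y ->
  (primitive b y - primitive b x) ^+ 2 <= (y - x) * \int[mu]_z b z ^+ 2.
Proof.
move=> xy; rewrite primitiveB//.
have mbI : measurable_fun `[x, y] b by exact: measurable_funS mb.
have b2I : itg `[x, y] (fun x => b x ^+ 2) by exact: itg_mono b2.
have := @cauchy_schwarz R `[x, y] (fun=> 1) b (measurable_itv _) _ mbI _ b2I.
under eq_Rintegral do rewrite mul1r.
move=> /(_ (measurable_cst _)); rewrite expr1n => /(_ (itg_cst _ _ _)).
rewrite Rint_itv// mul1r => H; apply: (le_trans H).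
apply: ler_wpM2l; first by rewrite subr_ge0.
by apply: le_Rint_sub => // z _; exact: sqr_ge0.
Qed.

Lemma box_sum_unif_cont t : 0 <= t -> forall ep, 0 < ep ->
  exists2 d, 0 < d & forall x y, `|x - y| < d -> `|box_sum b t x - box_sum b t y| <= ep.
Proof.
move=> t0 ep ep0; set G := \int[mu]_z b z ^+ 2.
have G0 : 0 <= G by apply: Rintegral_ge0 => x _; exact: sqr_ge0.
have G1 : 0 < G + 1 by rewrite ltr_wpDl.
pose d := (ep / 2) ^+ 2 / (G + 1).
have d0 : 0 < d by rewrite divr_gt0// exprn_gt0// divr_gt0.
have H x y : x <= y -> y - x < d -> `|primitive b y - primitive b x| <= ep / 2.
  move=> xy yxd; rewrite -(@ler_pXn2r _ 2)// ?nnegrE ?divr_ge0 ?(ltW ep0)//.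
  rewrite real_normK ?num_real//; apply: (le_trans (primitive_holder xy)); rewrite -/G.
  apply: (@le_trans _ _ (d * G)); first by rewrite ler_wpM2r// ltW.
  by rewrite /d mulrAC ler_pdivrMr// ler_wpM2l ?sqr_ge0// lerDl.
have H' x y : `|x - y| < d -> `|primitive b x - primitive b y| <= ep / 2.
  have [xy|/ltW yx] := leP x y; last by rewrite ger0_norm ?subr_ge0// => /H; exact.
  by rewrite distrC ger0_norm ?subr_ge0// => yxd; rewrite distrC H.
exists d => // x y xyd; rewrite !box_sum_primitive//.
rewrite (_ : _ - _ = (primitive b (x + t) - primitive b (y + t)) - (primitive b x - primitive b y)); last by ring.
rewrite (le_trans (ler_normB _ _))// [leRHS](splitr ep) lerD// ?H'//.
by rewrite (_ : x + t - (y + t) = x - y)//; ring.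
Qed.

Lemma box_sum_le t x : `|box_sum b t x| <= \int[mu]_y `|b y|.
Proof.
apply: (le_trans (le_normr_Rintegral _ (biI _ _))) => //.
by apply: le_Rint_sub => //; exact: itg_abs.
Qed.

Lemma box_sum_supp t x : 0 <= t -> ~~ (- (A + t) <= x <= A + t) -> box_sum b t x = 0.
Proof.
move=> t0 xA; have [_ _ bsupp] := bA.
rewrite /box_sum (@eq_Rintegral _ _ _ mu _ (fun=> 0)); first by rewrite Rintegral_cst// mul0r.
move=> s; rewrite mem_itvcc => /andP[xs st]; apply: bsupp; apply: contra xA => /andP[As sA].
by apply/andP; split; lra.
Qed.

Lemma compact_L2_box_sum t : 0 <= t -> compact_L2 (A + t) (box_sum b t).
Proof.
move=> t0; have mg : measurable_fun setT (box_sum b t).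
  by apply: continuous_measurable_fun; exact: box_sum_continuous.
split => //; last by move=> x; exact: box_sum_supp.
set M := \int[mu]_y `|b y|.
apply: (@itg_le _ _ _ (fun x => M ^+ 2 * \1_(`[- (A + t), A + t]%classic) x)) => //.
- exact: measurable_funX.
- move=> x _; rewrite ger0_norm ?sqr_ge0// indicE mem_itvcc.
  case: (boolP (_ <= _ <= _)) => [_|/(box_sum_supp t0) ->]; last by rewrite mulr0 expr0n.
  rewrite mulr1 -(real_normK (num_real (box_sum b t x))) lerXn2r ?nnegrE ?box_sum_le//.
  exact: Rintegral_ge0.
- by apply: itgZ => //; exact: itg_indic_itv.
Qed.

Let kap t (p : R * R) : R := if p.1 <= p.2 then (if p.2 <= p.1 + t then 1 else 0) else 0.

Let mkap t : measurable_fun setT (kap t).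
Proof.
apply: measurable_fun_if_le; [exact: measurable_fst|exact: measurable_snd|].
apply: measurable_fun_if_le; [exact: measurable_snd| |exact: measurable_cst].
by apply: measurable_funD; [exact: measurable_fst|exact: measurable_cst].
Qed.

(* Fubini: pairing a box sum with c is pairing b with the backward box sums of c. *)
Let box_sum_pairing t (c : R -> R) : 0 <= t -> continuous c ->
  \int[mu]_x (box_sum b t x * c x) = \int[mu]_s (b s * \int[mu]_(x in `[s - t, s]) c x).
Proof.
move=> t0 cc; pose I : set R := `[- (A + t), A + t]%classic.
pose ch : R -> R := c \_ I.
have chi : itg setT ch.
  by apply/(itg_mkcond _ (measurable_itv _)).1; apply: itg_cont; exact: continuous_subspaceT.
have kM p : `|kap t p| <= 1.
  by rewrite /kap; case: ifP => _; [case: ifP => _|]; rewrite ?normr1 ?normr0.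
transitivity (\int[mu]_x (ch x * \int[mu]_s (b s * kap t (x, s)))).
  apply: eq_Rintegral => x _.
  rewrite (_ : \int[mu]_s (b s * kap t (x, s)) = box_sum b t x); last first.
    rewrite /box_sum -(@Rint_indic R `[x, x + t]%classic b) //; apply: eq_Rintegral => s _.
    rewrite /kap/= indicE mem_itvcc mulrC.
    by case: (x <= s) => /=; rewrite ?mul0r//; case: (s <= x + t); rewrite ?mul0r ?mul1r.
  rewrite /ch patchE mem_itvcc; case: (boolP (_ <= _ <= _)) => [_|/(box_sum_supp t0) ->].
    by rewrite mulrC.
  by rewrite !mul0r.
rewrite (fubini_bounded chi bi (mkap t) kM); apply: eq_Rintegral => s _.
have [_ _ bsupp] := bA; have [/andP[As sA]|/bsupp ->] := boolP (- A <= s <= A); last by rewrite !mul0r.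
congr (_ * _); rewrite -(@Rint_indic R `[s - t, s]%classic c) //; apply: eq_Rintegral => x _.
rewrite /kap/= indicE mem_itvcc /ch patchE mem_itvcc lerBlDr.
have [xs|] := boolP (x <= s); last by rewrite andbF mulr0 mul0r.
have [sx|] := boolP (s <= x + t); last by rewrite /= mulr0 mul0r.
rewrite /= (_ : (- (A + t) <= x <= A + t) = true) ?mulr1 ?mul1r//.
by apply/andP; split; lra.
Qed.

Let ci eta : itg setT (fun x => b x * cos (eta * x)). Proof. exact: itg_cos. Qed.
Let si eta : itg setT (fun x => b x * sin (eta * x)). Proof. exact: itg_sin. Qed.

Lemma fcos_box_sum t eta : 0 <= t -> eta * fcos (box_sum b t) eta =
  (1 - cos (eta * t)) * fsin b eta + sin (eta * t) * fcos b eta.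
Proof.
move=> t0; have cc : continuous (fun x : R => cos (x * eta)) by exact: continuous_cosM.
rewrite /fcos.
rewrite [X in eta * X](_ : _ = \int[mu]_x (box_sum b t x * cos (x * eta))); last first.
  by apply: eq_Rintegral => x _; rewrite (mulrC eta).
rewrite box_sum_pairing//.
have inner s : eta * \int[mu]_(x in `[s - t, s]) cos (x * eta) =
    (1 - cos (eta * t)) * sin (eta * s) + sin (eta * t) * cos (eta * s).
  have cint : itg `[s - t, s] (fun x => cos (x * eta)).
    by apply: itg_cont; exact: continuous_subspaceT.
  have sts : s - t <= s by rewrite gerBl.
  have cf : continuous (fun x : R => eta * cos (x * eta)).
    by move=> x; apply: cvgM; [exact: cvg_cst|exact: continuous_cosM].
  rewrite -RintegralZl// (FTC2_continuous sts (is_derive_sinM eta) cf).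
  by rewrite mulrBl sinB (mulrC s) (mulrC t); ring.
have bint : itg setT (fun s => b s * \int[mu]_(x in `[s - t, s]) cos (x * eta)).
  apply: (@itgMb _ _ _ _ t) => //.
    have -> : (fun s => \int[mu]_(x in `[s - t, s]) cos (x * eta)) =
       (fun s => \int[mu]_x (kap t (x, s) * cos (x * eta))).
      apply/funext => s; rewrite -(@Rint_indic R `[s - t, s]%classic (fun x => cos (x * eta))) //.
      apply: eq_Rintegral => x _; rewrite /kap/= indicE mem_itvcc lerBlDr andbC.
      by case: (x <= s) => //=; case: (s <= x + t).
    apply: (@measurable_param R (fun p => kap t (p.2, p.1) * cos (p.2 * eta))).
    apply: measurable_funM.
      by apply: (@measurableT_comp _ _ _ _ _ _ _ _ (fun p : R * R => (p.2, p.1)) (mkap t)); exact: measurable_fun_pair.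
    by apply: (@measurable_fun_snd R (fun x => cos (x * eta))); exact: continuous_measurable_fun.
  move=> s _; have st : s - t <= s by rewrite gerBl.
  have cint : itg `[s - t, s] (fun x => cos (x * eta)) by apply: itg_cont; exact: continuous_subspaceT.
  apply: (le_trans (le_normr_Rintegral _ cint)) => //.
  apply: (@le_trans _ _ (\int[mu]_(x in `[s - t, s]) 1)).
    apply: le_Rintegral => //; [exact: itg_abs|exact: itg_cst|by move=> x _; exact: cos_max].
  by rewrite Rint_itv// mul1r opprB addrCA subrr addr0.
rewrite -RintegralZl//.
transitivity (\int[mu]_s ((1 - cos (eta * t)) * (b s * sin (eta * s)) + sin (eta * t) * (b s * cos (eta * s)))).
  by apply: eq_Rintegral => s _; rewrite mulrCA inner; ring.
by rewrite RintegralD ?RintegralZl//; [exact: itgZ|exact: itgZ].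
Qed.

Lemma fsin_box_sum t eta : 0 <= t -> eta * fsin (box_sum b t) eta =
  (cos (eta * t) - 1) * fcos b eta + sin (eta * t) * fsin b eta.
Proof.
move=> t0; have cc : continuous (fun x : R => sin (x * eta)) by exact: continuous_sinM.
rewrite /fsin.
rewrite [X in eta * X](_ : _ = \int[mu]_x (box_sum b t x * sin (x * eta))); last first.
  by apply: eq_Rintegral => x _; rewrite (mulrC eta).
rewrite box_sum_pairing//.
have inner s : eta * \int[mu]_(x in `[s - t, s]) sin (x * eta) =
    (cos (eta * t) - 1) * cos (eta * s) + sin (eta * t) * sin (eta * s).
  have cint : itg `[s - t, s] (fun x => sin (x * eta)).
    by apply: itg_cont; exact: continuous_subspaceT.
  have sts : s - t <= s by rewrite gerBl.
  have cf : continuous (fun x : R => eta * sin (x * eta)).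
    by move=> x; apply: cvgM; [exact: cvg_cst|exact: continuous_sinM].
  have dF x : is_derive x (1 : R) (fun x => - cos (x * eta)) (eta * sin (x * eta)).
    by have := is_deriveN (is_derive_cosM eta x); rewrite opprK.
  rewrite -RintegralZl// (FTC2_continuous sts dF cf).
  by rewrite mulrBl cosB (mulrC s) (mulrC t); ring.
have bint : itg setT (fun s => b s * \int[mu]_(x in `[s - t, s]) sin (x * eta)).
  apply: (@itgMb _ _ _ _ t) => //.
    have -> : (fun s => \int[mu]_(x in `[s - t, s]) sin (x * eta)) =
       (fun s => \int[mu]_x (kap t (x, s) * sin (x * eta))).
      apply/funext => s; rewrite -(@Rint_indic R `[s - t, s]%classic (fun x => sin (x * eta))) //.
      apply: eq_Rintegral => x _; rewrite /kap/= indicE mem_itvcc lerBlDr andbC.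
      by case: (x <= s) => //=; case: (s <= x + t).
    apply: (@measurable_param R (fun p => kap t (p.2, p.1) * sin (p.2 * eta))).
    apply: measurable_funM.
      by apply: (@measurableT_comp _ _ _ _ _ _ _ _ (fun p : R * R => (p.2, p.1)) (mkap t)); exact: measurable_fun_pair.
    by apply: (@measurable_fun_snd R (fun x => sin (x * eta))); exact: continuous_measurable_fun.
  move=> s _; have st : s - t <= s by rewrite gerBl.
  have cint : itg `[s - t, s] (fun x => sin (x * eta)) by apply: itg_cont; exact: continuous_subspaceT.
  apply: (le_trans (le_normr_Rintegral _ cint)) => //.
  apply: (@le_trans _ _ (\int[mu]_(x in `[s - t, s]) 1)).
    apply: le_Rintegral => //; [exact: itg_abs|exact: itg_cst|by move=> x _; exact: sin_max].
  by rewrite Rint_itv// mul1r opprB addrCA subrr addr0.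
rewrite -RintegralZl//.
transitivity (\int[mu]_s ((cos (eta * t) - 1) * (b s * cos (eta * s)) + sin (eta * t) * (b s * sin (eta * s)))).
  by apply: eq_Rintegral => s _; rewrite mulrCA inner; ring.
by rewrite RintegralD ?RintegralZl//; [exact: itgZ|exact: itgZ].
Qed.

Lemma power_spectrum_box_sum t eta : 0 <= t ->
  eta ^+ 2 * power_spectrum (box_sum b t) eta = (2 - 2 * cos (eta * t)) * power_spectrum b eta.
Proof.
move=> t0; have e1 := fcos_box_sum eta t0; have e2 := fsin_box_sum eta t0.
rewrite /power_spectrum mulrDr -!exprMn e1 e2.
have := cos2Dsin2 (eta * t); move: (cos _) (sin _) (fcos b eta) (fsin b eta) => c s C S cs.
have -> : (2 - 2 * c) * (C ^+ 2 + S ^+ 2) = (1 - 2 * c + (c ^+ 2 + s ^+ 2)) * (C ^+ 2 + S ^+ 2).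
  by rewrite cs; ring.
ring.
Qed.

End BoxAverage.

Section TonelliTools.
Variable R : realType.
Notation mu := (@lebesgue_measure R).
Notation itg D f := (mu.-integrable D (EFin \o (f : R -> R))).

Lemma tonelli_sets (D E : set R) (f : R * R -> \bar R) : measurable D -> measurable E ->
  measurable_fun setT f -> (forall p, 0 <= f p)%E ->
  (\int[mu]_(x in D) \int[mu]_(y in E) f (x, y) = \int[mu]_(y in E) \int[mu]_(x in D) f (x, y))%E.
Proof.
move=> mD mE mf f0.
pose F (p : R * R) := ((\1_D p.1)%:E * ((\1_E p.2)%:E * f p))%E.
have mF : measurable_fun setT F.
  apply: emeasurable_funM.
    apply/measurable_EFinP; apply: (@measurable_fun_fst R (\1_D)).
    by apply: measurable_indic; exact: mD.
  apply: emeasurable_funM => //.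
  apply/measurable_EFinP; apply: (@measurable_fun_snd R (\1_E)).
  by apply: measurable_indic; exact: mE.
have F0 p : (0 <= F p)%E by rewrite mule_ge0 ?mule_ge0// lee_fin indicE.
have F1 x y : x \in D -> y \in E -> F (x, y) = f (x, y).
  by rewrite /F !indicE => /= -> ->; rewrite !mul1e.
have F2 x y : x \notin D -> F (x, y) = 0%E.
  by rewrite /F !indicE => /= /negbTE ->; rewrite mul0e.
have F3 x y : y \notin E -> F (x, y) = 0%E.
  by rewrite /F !indicE => /= /negbTE ->; rewrite mul0e mule0.
have L : (\int[mu]_(x in D) \int[mu]_(y in E) f (x, y) = \int[mu]_x \int[mu]_y F (x, y))%E.
  rewrite integral_mkcond; apply: eq_integral => x _; rewrite patchE.
  case: ifPn => xD; last by rewrite integral0_eq// => y _; exact: F2.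
  rewrite integral_mkcond; apply: eq_integral => y _; rewrite patchE.
  by case: ifPn => yE; [rewrite F1|rewrite F3].
have Rr : (\int[mu]_(y in E) \int[mu]_(x in D) f (x, y) = \int[mu]_y \int[mu]_x F (x, y))%E.
  rewrite integral_mkcond; apply: eq_integral => y _; rewrite patchE.
  case: ifPn => yE; last by rewrite integral0_eq// => x _; exact: F3.
  rewrite integral_mkcond; apply: eq_integral => x _; rewrite patchE.
  by case: ifPn => xD; [rewrite F1|rewrite F2].
rewrite L Rr; exact: (@fubini_tonelli _ _ _ _ R mu mu F mF F0).
Qed.

Lemma Rint_translate (F : R -> R) (y T : R) : 0 <= T -> continuous F ->
  \int[mu]_(x in `[y, y + T]) F x = \int[mu]_(t in `[0, T]) F (y + t).
Proof.
move=> T0 cF; pose G t : R := y + t.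
have dG t : is_derive t (1 : R) G 1.
  have := is_deriveD (is_derive_cst y t 1) (is_derive_id t 1).
  by move=> /is_derive_eq; apply; rewrite add0r.
have G1 : G^`()%classic = cst 1.
  by apply/funext => t; rewrite derive1E; have [_ ->] := dG t.
have := @integration_by_substitution_increasing _ G F 0 T T0.
rewrite G1 /G addr0 /Rintegral => -> //.
- by congr fine; apply: eq_integral => t _; rewrite /= mulr1.
- by move=> u v _ _; rewrite ltrD2l.
- by move=> t _; exact: cst_continuous.
- exact: is_cvg_cst.
- exact: is_cvg_cst.
- have cG : continuous G by move=> t; apply: cvgD; [exact: cvg_cst|exact: cvg_id].
  split; first by move=> t _; have [] := dG t.
  + by apply: cvg_at_right_filter; exact: cG.
  + by apply: cvg_at_left_filter; exact: cG.
- exact: continuous_subspaceT.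
Qed.

Lemma integral_cst_itv (c : \bar R) (u v : R) : u <= v ->
  (\int[mu]_(x in `[u, v]) cst c x = c * (v - u)%:E)%E.
Proof. by move=> uv; rewrite integral_cst//; congr (c * _)%E; exact: mu_itvcc. Qed.

End TonelliTools.

Section SlidingOscillation.
Variable R : realType.
Notation mu := (@lebesgue_measure R).
Notation itg D f := (mu.-integrable D (EFin \o (f : R -> R))).

(** The window [y, y + T] slides with y, so that the total over y is translation invariant. *)
Definition sliding_osc (b : R -> R) (T y : R) : R :=
  \int[mu]_(x in `[y, y + T]) (\int[mu]_(s in `[y, x]) b s) ^+ 2.

(** The H^-1 energy carried by the nonnegative frequencies *)
Definition spectral_energy (b : R -> R) : \bar R :=
  (\int[mu]_(eta in `[0%R, +oo[) (power_spectrum b eta / (1 + eta ^+ 2))%:E)%E.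

Variables (A : R) (b : R -> R).
Hypotheses (A0 : 0 <= A) (bA : compact_L2 A b).
Let bi : itg setT b. Proof. exact: compact_L2_itg bA. Qed.
Let P := primitive b.
Let cP : continuous P. Proof. exact: primitive_continuous bA. Qed.
Let mP : measurable_fun setT P. Proof. exact: continuous_measurable_fun. Qed.

Lemma sliding_oscE T y : 0 <= T ->
  sliding_osc b T y = \int[mu]_(t in `[0, T]) box_sum b t y ^+ 2.
Proof.
move=> T0; have cF : continuous (fun x => (P x - P y) ^+ 2).
  move=> x; apply: (@continuous_comp _ _ _ (fun x => P x - P y) (fun z => z ^+ 2)).
    by apply: cvgB; [exact: cP|exact: cvg_cst].
  exact: exprn_continuous.
transitivity (\int[mu]_(x in `[y, y + T]) (P x - P y) ^+ 2).
  by apply: eq_Rintegral => x; rewrite mem_itvcc => /andP[yx _]; rewrite primitiveB.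
rewrite Rint_translate//; apply: eq_Rintegral => t; rewrite mem_itvcc => /andP[t0 _].
by rewrite (box_sum_primitive bA).
Qed.

Lemma sliding_osc_ge0 T y : 0 <= sliding_osc b T y.
Proof. by apply: Rintegral_ge0 => x _; exact: sqr_ge0. Qed.

Let fsq (p : R * R) : \bar R := ((P (p.1 + p.2) - P p.1) ^+ 2)%:E.

Let mfsq : measurable_fun setT fsq.
Proof.
apply/measurable_EFinP; apply: measurable_funX; apply: measurable_funB; last exact: measurable_fun_fst.
apply: (@measurableT_comp _ _ _ _ _ _ P _ (fun p : R * R => p.1 + p.2) mP).
by apply: measurable_funD; [exact: measurable_fst|exact: measurable_snd].
Qed.

Let cfsq y : continuous (fun t : R => (P (y + t) - P y) ^+ 2).
Proof.
move=> x; apply: (@continuous_comp _ _ _ (fun x => P (y + x) - P y) (fun z => z ^+ 2)).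
  apply: cvgB; last exact: cvg_cst.
  apply: (@continuous_comp _ _ _ (fun x => y + x) P); last exact: cP.
  by apply: cvgD; [exact: cvg_cst|exact: cvg_id].
exact: exprn_continuous.
Qed.

Let sliding_fsq T y : 0 <= T -> (sliding_osc b T y)%:E = (\int[mu]_(t in `[0%R, T]) fsq (y, t))%E.
Proof.
move=> T0; rewrite sliding_oscE// Rint_efin//.
  apply: eq_integral => t; rewrite mem_itvcc => /andP[t0 _].
  by rewrite /fsq/= (box_sum_primitive bA).
apply: (@eq_integrable _ _ _ mu _ (measurable_itv _) (EFin \o (fun t => (P (y + t) - P y) ^+ 2))).
  by move=> t; rewrite mem_itvcc => /andP[t0 _] /=; rewrite (box_sum_primitive bA).
by apply: itg_cont; apply: continuous_subspaceT; exact: cfsq.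
Qed.

Lemma measurable_sliding_osc T : 0 <= T -> measurable_fun setT (sliding_osc b T).
Proof.
move=> T0; apply/measurable_EFinP.
rewrite (_ : EFin \o _ = fun y => (\int[mu]_t ((\1_(`[0%R, T]%classic) t)%:E * fsq (y, t)))%E); last first.
  apply/funext => y; rewrite /= sliding_fsq// integral_mkcond; apply: eq_integral => t _.
  by rewrite patchE indicE; case: ifP => _; rewrite ?mul1e ?mul0e.
apply: (@emeasurable_param R (fun p => (\1_(`[0%R, T]%classic) p.2)%:E * fsq p)%E).
apply: emeasurable_funM => //; apply/measurable_EFinP.
by apply: (@measurable_fun_snd R (\1_(`[0%R, T]%classic))); apply: measurable_indic; exact: measurable_itv.
Qed.

Lemma total_sliding_osc T : 0 <= T ->
  (\int[mu]_y (sliding_osc b T y)%:E =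
   \int[mu]_(t in `[0%R, T]) \int[mu]_x (box_sum b t x ^+ 2)%:E)%E.
Proof.
move=> T0; under eq_integral do rewrite sliding_fsq//.
rewrite tonelli_sets; [|exact: measurableT|exact: measurable_itv|exact: mfsq|]; last first.
  by move=> p; rewrite lee_fin sqr_ge0.
apply: eq_integral => t; rewrite mem_itvcc => /andP[t0 _]; apply: eq_integral => x _.
by rewrite /fsq/= (box_sum_primitive bA).
Qed.

Let ps_ge0 (c : R -> R) (eta : R) : 0 <= power_spectrum c eta. Proof. exact: power_spectrum_ge0. Qed.

Let den_gt0 (eta : R) : 0 < 1 + eta ^+ 2.
Proof. by rewrite ltr_wpDr// sqr_ge0. Qed.

Let itvoyS (f : R -> R) : measurable_fun setT f ->
  (\int[mu]_(x in `[0%R, +oo[) (f x)%:E = \int[mu]_(x in `]0%R, +oo[) (f x)%:E)%E.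
Proof.
move=> mf; rewrite integral_itv_obnd_cbnd//.
by apply/measurable_EFinP; exact: measurable_funS mf.
Qed.

Let mden (c : R -> R) : itg setT c ->
  measurable_fun setT (fun eta => power_spectrum c eta / (1 + eta ^+ 2)).
Proof.
move=> ci; apply: measurable_funM; first exact: measurable_power_spectrum.
apply: continuous_measurable_fun => x; apply: cvgV; first by rewrite gt_eqF.
apply: cvgD; first exact: cvg_cst.
exact: exprn_continuous.
Qed.

(** The multiplier 2 - 2 cos (t eta), divided by eta^2, is at most 8 / (1 + eta^2) when t <= 2 ... *)
Let multiplier_le (t eta : R) : 0 <= t <= 2 -> 0 < eta ->
  power_spectrum (box_sum b t) eta <= 8 * (power_spectrum b eta / (1 + eta ^+ 2)).
Proof.
move=> /andP[t0 t2] e0; rewrite mulrA ler_pdivlMr//.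
have H := power_spectrum_box_sum bA eta t0.
have e2 : 0 < eta ^+ 2 by rewrite exprn_gt0.
have c1 := cos_geN1 (eta * t); have c2 := cos_ge_quad (eta * t).
have p0 := ps_ge0 b eta.
have t4 : t ^+ 2 <= 4 by rewrite expr2; nra.
have h1 : (2 - 2 * cos (eta * t)) * power_spectrum b eta <= 4 * power_spectrum b eta.
  by apply: ler_wpM2r => //; lra.
have h2 : eta ^+ 2 * power_spectrum (box_sum b t) eta <= eta ^+ 2 * (4 * power_spectrum b eta).
  rewrite H mulrA ler_wpM2r// (le_trans (_ : _ <= eta ^+ 2 * t ^+ 2))//.
    by move: c2; rewrite exprMn; lra.
  by rewrite ler_wpM2l// ltW.
rewrite ler_pM2l// in h2; rewrite mulrDr mulr1 (mulrC _ (eta ^+ 2)) H.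
by lra.
Qed.

(** ... and its mean over t in [0, 1] is at least (1/12) / (1 + eta^2). *)
Let multiplier_ge (eta : R) : 0 < eta -> eta ^+ 2 <= 12 * (1 + eta ^+ 2) * \int[mu]_(t in `[0, 1]) (2 - 2 * cos (t * eta)).
Proof.
move=> e0; have e2 : 0 < eta ^+ 2 by rewrite exprn_gt0.
have c2 : continuous (fun t : R => 2 - 2 * cos (t * eta)).
  move=> t; apply: cvgB; first exact: cvg_cst.
  by apply: cvgM; [exact: cvg_cst|exact: continuous_cosM].
have ci : itg `[0, 1] (fun t => 2 - 2 * cos (t * eta)).
  by apply: itg_cont; exact: continuous_subspaceT.
set k := \int[mu]_(t in _) _.
have [eta2|eta2] := leP eta 2.
  have kge : eta ^+ 2 / 12 <= k.
    have cq : continuous (fun t : R => eta ^+ 2 / 4 * t ^+ 2).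
      by move=> t; apply: cvgM; [exact: cvg_cst|exact: exprn_continuous].
    have dq (t : R) : is_derive t (1 : R) (fun t : R => eta ^+ 2 / 12 * (t * (t * t))) (eta ^+ 2 / 4 * t ^+ 2).
      have did := is_derive_id t (1 : R).
      have := is_deriveM (is_derive_cst (eta ^+ 2 / 12) t 1) (is_deriveM did (is_deriveM did did)).
      by move=> /is_derive_eq; apply; rewrite /GRing.scale !fctE /=; field.
    have <- : \int[mu]_(t in `[0, 1]) (eta ^+ 2 / 4 * t ^+ 2) = eta ^+ 2 / 12.
      by rewrite (FTC2_continuous ler01 dq cq) mul0r mulr0 subr0 !mulr1.
    apply: le_Rintegral => //; first by apply: itg_cont; exact: continuous_subspaceT.
    move=> t; rewrite /= in_itv/= => /andP[t0 t1].
    have te : `|t * eta| <= 2 by rewrite ger0_norm ?mulr_ge0 ?(ltW e0)//; nra.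
    by have := cos_le_quad te; rewrite exprMn; lra.
  have k0 : 0 <= k by apply: le_trans kge; rewrite divr_ge0// ltW.
  have : 0 <= eta ^+ 2 * k by rewrite mulr_ge0// ltW.
  by move: kge; clearbody k; lra.
have k1 : 1 <= k.
  have en0 : eta != 0 by rewrite gt_eqF.
  have dF (t : R) : is_derive t (1 : R) (fun t : R => 2 * t - 2 / eta * sin (t * eta)) (2 - 2 * cos (t * eta)).
    have := is_deriveB (is_deriveM (is_derive_cst (2 : R) t 1) (is_derive_id t (1 : R)))
      (is_deriveM (is_derive_cst (2 / eta) t 1) (is_derive_sinM eta t)).
    by move=> /is_derive_eq; apply; rewrite /GRing.scale/=; field.
  rewrite /k (FTC2_continuous ler01 dF c2) !mul0r mul1r !mulr0 sin0 mulr0 subrr subr0 mulr1.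
  have : 2 / eta * sin eta <= 1; last by lra.
  rewrite mulrAC ler_pdivrMr// mul1r.
  by have := sin_le1 eta; lra.
have := ler_wpM2l (ltW (den_gt0 eta)) k1; clearbody k; lra.
Qed.

Lemma sliding_osc_le_energy : (\int[mu]_y (sliding_osc b 2 y)%:E <= 64%:E * spectral_energy b)%E.
Proof.
rewrite total_sliding_osc//.
have step t : 0 <= t <= 2 -> (\int[mu]_x (box_sum b t x ^+ 2)%:E <= 32%:E * spectral_energy b)%E.
  move=> t02; have /andP[t0 t2] := t02.
  have gA := compact_L2_box_sum bA t0; have gi := compact_L2_itg gA; have [mg g2 _] := gA.
  have At : 0 <= A + t by rewrite addr_ge0.
  have := reverse_bessel At gA (box_sum_le bA t) (box_sum_unif_cont bA t0).
  rewrite -lee_fin Rint_efin// EFinM Rint_efin//; last exact: itg_power_spectrum gA.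
  move=> H; apply: (le_trans H).
  rewrite (_ : 32%:E = 4%:E * 8%:E)%E; last by rewrite -EFinM; congr EFin; ring.
  rewrite -muleA lee_pmul2l// /spectral_energy -ge0_integralZl//; last 2 first.
  - by apply/measurable_EFinP; exact: measurable_funS (mden bi).
  - by move=> eta _; rewrite lee_fin divr_ge0// ltW.
  under [leRHS]eq_integral do rewrite -EFinM.
  rewrite itvoyS; last exact: measurable_power_spectrum.
  rewrite [leRHS]itvoyS; last by apply: measurable_funM; [exact: measurable_cst|exact: mden].
  apply: ge0_le_integral => //.
  - by move=> eta _; rewrite lee_fin.
  - by apply/measurable_EFinP; exact: measurable_funS (measurable_power_spectrum gi).
  - apply/measurable_EFinP; apply: (measurable_funS _ (@subsetT _ _)) => //.
    by apply: measurable_funM; [exact: measurable_cst|exact: mden].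
  - move=> eta; rewrite /= in_itv/= andbT => e0; rewrite lee_fin; exact: multiplier_le.
apply: (@le_trans _ _ (\int[mu]_(t in `[0%R, 2%R]) (cst (32%:E * spectral_energy b) t))%E).
  apply: ge0_le_integral => //.
  - by move=> t _; apply: integral_ge0 => x _; rewrite lee_fin sqr_ge0.
  - apply: (@eq_measurable_fun _ _ _ _ _ (fun t => \int[mu]_x fsq (x, t))%E).
      move=> t; rewrite mem_itvcc => /andP[t0 _]; apply: eq_integral => x _.
      by rewrite /fsq/= (box_sum_primitive bA).
    apply: (measurable_funS _ (@subsetT _ _)) => //.
    apply: (@emeasurable_param R (fun p => fsq (p.2, p.1))).
    by apply: (@measurableT_comp _ _ _ _ _ _ _ _ (fun p : R * R => (p.2, p.1)) mfsq); exact: measurable_fun_pair.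
rewrite integral_cst_itv// subr0.
by rewrite muleAC -EFinM (_ : 32 * 2 = 64)//; ring.
Qed.

Lemma energy_le_sliding_osc : (spectral_energy b <= 288%:E * \int[mu]_y (sliding_osc b 1 y)%:E)%E.
Proof.
rewrite total_sliding_osc// /spectral_energy itvoyS; last exact: mden.
pose w : R -> R := (fun eta : R => (eta ^+ 2)^-1 : R) \_ (`]0, +oo[%classic : set R).
have w0 (eta : R) : 0 <= w eta by rewrite /w patchE; case: ifP => // _; rewrite invr_ge0 sqr_ge0.
have mw : measurable_fun setT w.
  apply/(measurable_restrictT _ _).1 => //; apply: open_continuous_measurable_fun => //.
  move=> x; rewrite inE/= in_itv/= andbT => x0; apply: cvgV; first by rewrite gt_eqF// exprn_gt0.
  exact: exprn_continuous.
have wE (eta : R) : 0 < eta -> w eta = (eta ^+ 2)^-1 by move=> e0; rewrite /w patchE mem_set//= in_itv/= e0.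
pose f (p : R * R) : \bar R := (w p.1 * ((2 - 2 * cos (p.1 * p.2)) * power_spectrum b p.1))%:E.
have mf : measurable_fun setT f.
  apply/measurable_EFinP; apply: measurable_funM; first exact: measurable_fun_fst.
  apply: measurable_funM; last by apply: measurable_fun_fst; exact: measurable_power_spectrum.
  apply: measurable_funB; first exact: measurable_cst.
  by apply: measurable_funM; [exact: measurable_cst|exact: measurable_cosM2].
have f0 p : (0 <= f p)%E.
  rewrite lee_fin; apply: mulr_ge0; first exact: w0.
  apply: mulr_ge0; last exact: ps_ge0.
  by have := cos_le1 (p.1 * p.2); lra.
have fE (eta t : R) : 0 < eta -> 0 <= t -> f (eta, t) = (power_spectrum (box_sum b t) eta)%:E.
  move=> e0 t0; congr EFin; rewrite /= wE// -(power_spectrum_box_sum bA)//.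
  by rewrite mulKf// gt_eqF// exprn_gt0.
have mft : measurable_fun setT (fun eta => \int[mu]_(t in `[0%R, 1%R]) f (eta, t))%E.
  rewrite (_ : (fun eta => _) = fun eta => (\int[mu]_t ((\1_(`[0%R, 1%R]%classic) t)%:E * f (eta, t)))%E); last first.
    apply/funext => y; rewrite integral_mkcond; apply: eq_integral => t _.
    by rewrite patchE indicE; case: ifP => _; rewrite ?mul1e ?mul0e.
  apply: (@emeasurable_param R (fun p => (\1_(`[0%R, 1%R]%classic) p.2)%:E * f p)%E).
  apply: emeasurable_funM => //; apply/measurable_EFinP.
  by apply: (@measurable_fun_snd R (\1_(`[0%R, 1%R]%classic))); apply: measurable_indic; exact: measurable_itv.
have H1 : (\int[mu]_(eta in `]0%R, +oo[) (power_spectrum b eta / (1 + eta ^+ 2))%:E <=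
    \int[mu]_(eta in `]0%R, +oo[) (12%:E * \int[mu]_(t in `[0%R, 1%R]) f (eta, t)))%E.
  apply: ge0_le_integral => //.
  - by move=> eta _; rewrite lee_fin divr_ge0// ltW.
  - by apply/measurable_EFinP; exact: measurable_funS (mden bi).
  - apply: emeasurable_funM => //; exact: measurable_funS mft.
  - move=> eta; rewrite /= in_itv/= andbT => e0.
    have e2 : 0 < eta ^+ 2 by rewrite exprn_gt0.
    have c2 : continuous (fun t : R => 2 - 2 * cos (t * eta)).
      move=> t; apply: cvgB; first exact: cvg_cst.
      by apply: cvgM; [exact: cvg_cst|exact: continuous_cosM].
    have ci : itg `[0, 1] (fun t => 2 - 2 * cos (t * eta)).
      by apply: itg_cont; exact: continuous_subspaceT.
    have -> : (\int[mu]_(t in `[0%R, 1%R]) f (eta, t) =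
        (w eta * power_spectrum b eta * \int[mu]_(t in `[0%R, 1%R]) (2 - 2 * cos (t * eta)))%:E)%E.
      rewrite -RintegralZl// Rint_efin//; last exact: itgZ.
      by apply: eq_integral => t _; rewrite /f/= (mulrC eta); congr EFin; ring.
    rewrite -EFinM lee_fin ler_pdivrMr// wE//.
    have := ler_wpM2l (ps_ge0 b eta) (multiplier_ge e0).
    rewrite -(@ler_pM2l _ (eta ^+ 2)^-1) ?invr_gt0//.
    set k := \int[mu]_(t in _) _; move: (power_spectrum b eta) => p.
    rewrite mulrCA mulVf ?gt_eqF// mulr1 => H; apply: (le_trans H).
    by rewrite le_eqVlt; apply/orP; left; apply/eqP; ring.
apply: (le_trans H1); clear H1; rewrite ge0_integralZl//; last 2 first.
- exact: measurable_funS mft.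
- by move=> eta _; apply: integral_ge0.
rewrite (_ : 288%:E = 12%:E * 24%:E)%E; last by rewrite -EFinM; congr EFin; ring.
rewrite -muleA lee_pmul2l// tonelli_sets; [|exact: measurable_itv|exact: measurable_itv|exact: mf|exact: f0].
have mg : measurable_fun setT (fun t => \int[mu]_x fsq (x, t))%E.
  apply: (@emeasurable_param R (fun p => fsq (p.2, p.1))).
  by apply: (@measurableT_comp _ _ _ _ _ _ _ _ (fun p : R * R => (p.2, p.1)) mfsq); exact: measurable_fun_pair.
have gE t : 0 <= t -> (\int[mu]_x (box_sum b t x ^+ 2)%:E = \int[mu]_x fsq (x, t))%E.
  by move=> t0; apply: eq_integral => x _; rewrite /fsq/= (box_sum_primitive bA).
rewrite [X in (_ * X)%E](_ : _ = \int[mu]_(t in `[0%R, 1%R]) \int[mu]_x fsq (x, t))%E; last first.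
  by apply: eq_integral => t; rewrite mem_itvcc => /andP[t0 _]; rewrite gE.
have fsq0 t : (0 <= \int[mu]_x fsq (x, t))%E by apply: integral_ge0 => x _; rewrite lee_fin sqr_ge0.
rewrite -ge0_integralZl//; last exact: measurable_funS mg.
apply: ge0_le_integral; [exact: measurable_itv|by move=> t _; apply: integral_ge0| | |].
- apply: (measurable_funS measurableT (@subsetT _ _)).
  rewrite (_ : (fun t => _) = fun t => (\int[mu]_eta ((\1_(`]0%R, +oo[%classic) eta)%:E * f (eta, t)))%E); last first.
    apply/funext => y; rewrite integral_mkcond; apply: eq_integral => t _.
    by rewrite patchE indicE; case: ifP => _; rewrite ?mul1e ?mul0e.
  apply: (@emeasurable_param R (fun p => (\1_(`]0%R, +oo[%classic) p.2)%:E * f (p.2, p.1))%E).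
  apply: emeasurable_funM.
    apply/measurable_EFinP; apply: (@measurable_fun_snd R (\1_(`]0%R, +oo[%classic))).
    by apply: measurable_indic; exact: measurable_itv.
  by apply: (@measurableT_comp _ _ _ _ _ _ _ _ (fun p : R * R => (p.2, p.1)) mf); exact: measurable_fun_pair.
- apply: emeasurable_funM; [exact: measurable_cst|exact: measurable_funS mg].
- move=> t; rewrite /= in_itv/= => /andP[t0 _].
  have gA := compact_L2_box_sum bA t0; have gi := compact_L2_itg gA; have [mgt g2 _] := gA.
  have At : 0 <= A + t by rewrite addr_ge0.
  have := bessel At gA; rewrite itvoyS; last exact: measurable_power_spectrum.
  rewrite EFinM Rint_efin// gE// => H; apply: le_trans H.
  rewrite le_eqVlt; apply/orP; left; apply/eqP; apply: eq_integral => eta.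
  by rewrite inE/= in_itv/= andbT => e0; rewrite fE.
Qed.

End SlidingOscillation.

Section WindowSums.
Variable R : realType.
Notation mu := (@lebesgue_measure R).
Notation itg D f := (mu.-integrable D (EFin \o (f : R -> R))).
Variables (A : R) (b : R -> R).
Hypotheses (A0 : 0 <= A) (bA : compact_L2 A b).
Let bi : itg setT b. Proof. exact: compact_L2_itg bA. Qed.
Let mb : measurable_fun setT b. Proof. by case: bA. Qed.
Let b2 : itg setT (fun x => b x ^+ 2). Proof. by case: bA. Qed.

Let iosc y z : itg `[y, z] (fun x => (\int[mu]_(s in `[y, x]) b s) ^+ 2).
Proof.
have cP := primitive_continuous bA.
apply: (@eq_integrable _ _ _ mu _ (measurable_itv _) (EFin \o (fun x => (primitive b x - primitive b y) ^+ 2))).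
  by move=> x; rewrite mem_itvcc => /andP[yx _] /=; rewrite primitiveB.
apply: itg_cont; apply: continuous_subspaceT => x.
apply: (@continuous_comp _ _ _ (fun x => primitive b x - primitive b y) (fun z => z ^+ 2)).
  by apply: cvgB; [exact: cP|exact: cvg_cst].
exact: exprn_continuous.
Qed.

Let msl T : 0 <= T -> measurable_fun setT (fun y => (sliding_osc b T y)%:E).
Proof. by move=> T0; apply/measurable_EFinP; exact: measurable_sliding_osc bA _ T0. Qed.

Lemma window_osc_le_sliding (k : R) :
  ((window_osc k b)%:E <= \int[mu]_(y in `[k, (k + 2)%R]) (sliding_osc b 2 y)%:E)%E.
Proof.
rewrite /window_osc (Rint_efin (measurable_itv _) (itg_window_osc k mb b2)).
apply: ge0_le_integral => //.
- by move=> y _; rewrite lee_fin; apply: Rintegral_ge0 => x _; exact: sqr_ge0.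
- exact: (measurable_int mu (itg_window_osc _ mb b2)).
- exact: measurable_funS (msl _).
- move=> y; rewrite /= in_itv/= => /andP[ky yk]; rewrite lee_fin /sliding_osc.
  apply: le_Rint_sub => //; last by move=> x _; exact: sqr_ge0.
  by move=> x; rewrite /= !in_itv/= => /andP[-> xk]; rewrite (le_trans xk)// lerD2r.
Qed.

Lemma sliding_le_window_osc (k : R) :
  (\int[mu]_(y in `[k, (k + 1)%R[) (sliding_osc b 1 y)%:E <= (window_osc k b)%:E)%E.
Proof.
have W0 y : (0 <= (\int[mu]_(x in `[y, k + 2]) (\int[mu]_(s in `[y, x]) b s) ^+ 2)%:E)%E.
  by rewrite lee_fin; apply: Rintegral_ge0 => x _; exact: sqr_ge0.
have mW := measurable_int mu (itg_window_osc k mb b2).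
have sub : `[k, k + 1[%classic `<=` `[k, k + 2]%classic.
  by move=> x; rewrite /= !in_itv/= => /andP[-> xk]; rewrite (le_trans (ltW xk))// lerD2l ler1n.
rewrite /window_osc (Rint_efin (measurable_itv _) (itg_window_osc k mb b2)).
apply: (@le_trans _ _ (\int[mu]_(y in `[k, (k + 1)%R[)
   (\int[mu]_(x in `[y, k + 2]) (\int[mu]_(s in `[y, x]) b s) ^+ 2)%:E)%E); last first.
  exact: (ge0_subset_integral mu (measurable_itv _) (measurable_itv _) mW (fun y _ => W0 y) sub).
apply: ge0_le_integral => //.
- by move=> y _; rewrite lee_fin sliding_osc_ge0.
- exact: measurable_funS (msl _).
- exact: measurable_funS mW.
- move=> y; rewrite /= in_itv/= => /andP[ky yk]; rewrite lee_fin /sliding_osc.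
  apply: le_Rint_sub => //; last by move=> x _; exact: sqr_ge0.
  move=> x; rewrite /= !in_itv/= => /andP[-> xk]/=; move: xk yk; lra.
Qed.

Let unit_itv_disjoint (c : R) (D : set int) :
  trivIset D (fun k : int => `[k%:~R + c, k%:~R + c + 1[%classic : set R).
Proof.
move=> i j _ _ [z []]; rewrite /= !in_itv/= => /andP[i1 i2] /andP[j1 j2].
have : (i%:~R < j%:~R + 1 :> R) by move: i1 j2; lra.
have : (j%:~R < i%:~R + 1 :> R) by move: j1 i2; lra.
by rewrite -!(intrD _ _ 1) !ltr_int !ltzD1 => ji ij; apply/eqP; rewrite eq_le ij ji.
Qed.

Let sum_unit_itv (f : R -> \bar R) (c : R) (F : seq int) : uniq F -> measurable_fun setT f ->
  (forall x, 0 <= f x)%E ->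
  (\sum_(k <- F) \int[mu]_(x in `[(k%:~R + c)%R, (k%:~R + c + 1)%R[) f x <= \int[mu]_x f x)%E.
Proof.
move=> uF mf f0.
rewrite -(@ge0_integral_bigsetU _ _ _ mu _ (fun k : int => `[k%:~R + c, k%:~R + c + 1[%classic : set R)) //.
- apply: ge0_subset_integral => //.
  by apply: bigsetU_measurable => k _; exact: measurable_itv.
- exact: measurable_funS mf.
Qed.

Lemma sum_window_osc_le (F : seq int) : uniq F ->
  (\sum_(k <- F) (window_osc k%:~R b)%:E <= 128%:E * spectral_energy b)%E.
Proof.
move=> uF; pose f y : \bar R := (sliding_osc b 2 y)%:E.
have f0 y : (0 <= f y)%E by rewrite lee_fin sliding_osc_ge0.
have mf : measurable_fun setT f by exact: msl.
apply: (@le_trans _ _ (\sum_(k <- F) (\int[mu]_(x in `[(k%:~R + 0)%R, (k%:~R + 0 + 1)%R[) f x +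
    \int[mu]_(x in `[(k%:~R + 1)%R, (k%:~R + 1 + 1)%R[) f x))%E).
  apply: lee_sum => k _; apply: (le_trans (window_osc_le_sliding _)).
  rewrite -integral_itv_bndo_bndc//; last exact: measurable_funS mf.
  rewrite (@itv_bndbnd_setU _ _ _ (BLeft (k%:~R + 1))) ?bnd_simp ?lerDl// ?lerD2l ?ler1n//.
  rewrite ge0_integral_setU//=.
  - by rewrite addr0 (_ : k%:~R + 1 + 1 = k%:~R + 2)//; ring.
  - exact: measurable_funS mf.
  - by move=> x _; exact: f0.
  - apply/disj_setPS => y [/=]; rewrite !in_itv/= => /andP[_ y1] /andP[y2 _].
    by have := lt_le_trans y1 y2; rewrite ltxx.
rewrite big_split/=.
apply: (le_trans (leeD (sum_unit_itv 0 uF mf f0) (sum_unit_itv 1 uF mf f0))).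
have H := sliding_osc_le_energy A0 bA.
apply: (le_trans (leeD H H)); rewrite -ge0_muleDl ?lee_fin//.
by rewrite -EFinD (_ : 64 + 64 = 128)//; ring.
Qed.

Lemma energy_le_sum_window_osc (F : seq int) : uniq F ->
  (forall k : int, - A - 2 < k%:~R <= A -> k \in F) ->
  (spectral_energy b <= 288%:E * \sum_(k <- F) (window_osc k%:~R b)%:E)%E.
Proof.
move=> uF Fcov; apply: (le_trans (energy_le_sliding_osc A0 bA)); rewrite lee_pmul2l//.
pose f y : \bar R := (sliding_osc b 1 y)%:E.
have f0 y : (0 <= f y)%E by rewrite lee_fin sliding_osc_ge0.
have mf : measurable_fun setT f by exact: msl.
have [_ _ bsupp] := bA.
have fsupp z : f z != 0%E -> - A - 1 <= z <= A.
  apply: contraNT => zA; apply/eqP; congr EFin.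
  rewrite /sliding_osc (@eq_Rintegral _ _ _ mu _ (fun=> 0)); first by rewrite Rintegral_cst// mul0r.
  move=> x; rewrite mem_itvcc => /andP[zx xz].
  rewrite (@eq_Rintegral _ _ _ mu _ (fun=> 0)); first by rewrite Rintegral_cst// mul0r expr0n.
  move=> s; rewrite mem_itvcc => /andP[zs sx]; apply: bsupp; apply: contra zA => /andP[As sA].
  by apply/andP; split; lra.
pose I (k : int) : set R := `[k%:~R + 0, k%:~R + 0 + 1[%classic.
apply: (@le_trans _ _ (\sum_(k <- F) \int[mu]_(x in I k) f x)%E); last first.
  by apply: lee_sum => k _; rewrite /I addr0; exact: sliding_le_window_osc.
rewrite -(@ge0_integral_bigsetU _ _ _ mu _ I)//; last exact: measurable_funS mf.
rewrite [leRHS]integral_mkcond le_eqVlt; apply/orP; left; apply/eqP; apply: eq_integral => z _.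
rewrite patchE; case: ifPn => // zF; apply/eqP; apply: contraNT zF => /fsupp /andP[z1 z2].
rewrite inE -bigcup_seq; exists (Num.floor z) => /=.
  apply: Fcov; apply/andP; split.
    by have := floorD1_gt z; rewrite intrD; lra.
  by apply: le_trans z2; exact: floor_le_tmp.
rewrite /I /= in_itv/= addr0 floor_le_tmp/=.
by have := floorD1_gt z; rewrite intrD.
- by move=> k; exact: measurable_itv.
- exact: unit_itv_disjoint.
Qed.

End WindowSums.

Section RieszFischer.
Variable R : realType.
Notation mu := (@lebesgue_measure R).

Let half_sum n : \sum_(0 <= k < n) (2^-1 : R) ^+ k <= 2.
Proof.
have -> : \sum_(0 <= k < n) (2^-1 : R) ^+ k = 2 - 2 * 2^-1 ^+ n.
  elim: n => [|n IH]; first by rewrite big_nil expr0; ring.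
  by rewrite big_nat_recr//= IH exprS; field.
by rewrite lerBlDr lerDl mulr_ge0// exprn_ge0.
Qed.

Let cvg_of_weighted_sqr (u : nat -> R) (S : R) :
  (forall n, \sum_(k < n) 2 ^+ k * (u k.+1 - u k) ^+ 2 <= S) -> cvgn u.
Proof.
move=> uS; pose d k := u k.+1 - u k.
have ud n : u n = u 0%N + series d n.
  rewrite /series/= telescope_sumr//.
  by rewrite addrC subrK.
rewrite (_ : u = fun n => u 0%N + series d n); last exact/funext.
apply: is_cvgD; first exact: is_cvg_cst.
apply: normed_cvg; apply: nondecreasing_is_cvgn.
  by apply: nondecreasing_series => n _ _ /=.
exists (2 + S) => _ [n _ <-]; rewrite -[leLHS]/(\sum_(0 <= k < n) `|d k|) big_mkord.
have dk k : `|d k| <= 2^-1 ^+ k + 2 ^+ k * d k ^+ 2.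
  have e0 : 0 < (2 : R) ^+ k by exact: exprn_gt0.
  rewrite exprVn -(real_normK (num_real (d k))); move: `|d k| (2 ^+ k) e0 => x e e0.
  rewrite -(ler_pM2l e0) mulrDr divff ?gt_eqF//.
  by have := sqr_ge0 (e * x - 2^-1); rewrite !expr2; nra.
apply: (@le_trans _ _ (\sum_(k < n) (2^-1 ^+ k + 2 ^+ k * d k ^+ 2))).
  by apply: ler_sum => k _; exact: dk.
rewrite big_split/= lerD//; last exact: uS.
by rewrite -(big_mkord xpredT (fun k => 2^-1 ^+ k)); exact: half_sum.
Qed.

Let monotone_index (e : nat -> R) : (forall n, 0 <= e n) -> e @ \oo --> 0 ->
  (forall n m, (n <= m)%N -> e m <= e n) ->
  exists p : nat -> nat, [/\ forall k, (p k <= p k.+1)%N, forall k, (k <= p k)%N & forall k, e (p k) <= 4^-1 ^+ k].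
Proof.
move=> e0 ecvg edec.
have H k : exists n, e n <= 4^-1 ^+ k.
  have k0 : 0 < (4^-1 : R) ^+ k by exact: exprn_gt0.
  move/cvgrPdist_le : ecvg => /(_ _ k0)[n _ /(_ n (leqnn n))].
  by rewrite /= sub0r normrN ger0_norm// => en; exists n.
have [f Hf] := boolp.choice H.
exists (fun k => (k + \sum_(j < k.+1) f j)%N); split=> k.
- by rewrite [in leqRHS]big_ord_recr/= addSn -addnS leq_add2l; exact: leqW (leq_addr _ _).
- exact: leq_addr.
- apply: le_trans (Hf k); apply: edec.
  by rewrite big_ord_recr/= addnA leq_addl.
Qed.

Let limn_einf_ge0 (u : (\bar R)^nat) : (forall n, 0 <= u n)%E -> (0 <= limn_einf u)%E.
Proof.
move=> u0; rewrite limn_einf_lim; apply: lime_ge; first exact: is_cvg_einfs.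
by apply: nearW => n; apply: le_ereal_inf_tmp => _ [k _ <-].
Qed.

Let limn_einf_le (u : (\bar R)^nat) (M : \bar R) :
  (forall n, exists2 k, (n <= k)%N & (u k <= M)%E) -> (limn_einf u <= M)%E.
Proof.
move=> uM; rewrite limn_einf_lim; apply: lime_le; first exact: is_cvg_einfs.
apply: nearW => n; have [k nk kM] := uM n.
by apply: le_trans kM; apply: ereal_inf_lbound; exists k.
Qed.

(** Completeness of L^2, with the rate of convergence. A subsequence along which consecutive distances decay geometrically converges almost everywhere; Fatou's lemma transfers the Cauchy estimate to the limit. *)
Lemma riesz_fischer (f : nat -> R -> R) (e : nat -> R) :
  (forall n, measurable_fun setT (f n)) -> (forall n, 0 <= e n) -> e @ \oo --> 0 ->
  (forall n m, (n <= m)%N -> e m <= e n) ->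
  (forall n m, (n <= m)%N -> (\int[mu]_x ((f m x - f n x) ^+ 2)%:E <= (e n)%:E)%E) ->
  exists2 g : R -> R, measurable_fun setT g & forall n, (\int[mu]_x ((f n x - g x) ^+ 2)%:E <= (e n)%:E)%E.
Proof.
move=> mf e0 ecvg edec fe.
have [p [pm pk pe]] := monotone_index e0 ecvg edec.
pose h k x : \bar R := (2 ^+ k * (f (p k.+1) x - f (p k) x) ^+ 2)%:E.
have h0 k x : (0 <= h k x)%E by rewrite lee_fin mulr_ge0 ?sqr_ge0// exprn_ge0.
have msq n m : measurable_fun setT (fun x => ((f n x - f m x) ^+ 2)%:E).
  by apply/measurable_EFinP; apply: measurable_funX; exact: measurable_funB.
have mh k : measurable_fun setT (h k).
  by apply/measurable_EFinP; apply: measurable_funM => //; apply/measurable_EFinP; exact: msq.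
have mfg (g : R -> R) n : measurable_fun setT g -> measurable_fun setT (fun x => ((f n x - g x) ^+ 2)%:E).
  by move=> mg; apply/measurable_EFinP; apply: measurable_funX; exact: measurable_funB.
pose s x : \bar R := (\sum_(0 <= k <oo) h k x)%E.
have ms : measurable_fun setT s.
  by apply: ge0_emeasurable_sum => // k x _ _; exact: h0.
have s0 x : (0 <= s x)%E by apply: nneseries_ge0 => k _ _; exact: h0.
have si : mu.-integrable setT s.
  apply/integrableP; split => //.
  under eq_integral do rewrite gee0_abs ?s0//.
  rewrite /s integral_nneseries//.
  apply: (@le_lt_trans _ _ 2%:E); last exact: ltry.
  apply: lime_le; first by apply: is_cvg_nneseries => k _ _; apply: integral_ge0 => x _; exact: h0.
  apply: nearW => n.
  apply: (@le_trans _ _ (\sum_(0 <= k < n) (2^-1 ^+ k)%:E)%E).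
    apply: lee_sum => k _; rewrite /h; under eq_integral do rewrite EFinM.
    rewrite ge0_integralZl ?lee_fin ?exprn_ge0//; [|exact: msq|by move=> x _; rewrite lee_fin sqr_ge0].
    apply: (@le_trans _ _ ((2 ^+ k)%:E * (4^-1 ^+ k)%:E)%E).
      rewrite lee_pmul2l ?lte_fin ?exprn_gt0//.
      by apply: (le_trans (fe _ _ (pm k))); rewrite lee_fin.
    by rewrite -EFinM -exprMn lee_fin (_ : 2 * 4^-1 = 2^-1 :> R)//; field.
  by rewrite sumEFin lee_fin; exact: half_sum.
pose g x : R := fine (limn_esup (fun k => (f (p k) x)%:E)).
have mg : measurable_fun setT g.
  by apply: measurableT_comp => //; apply: measurable_fun_limn_esup => n; exact/measurable_EFinP.
have cvgae : {ae mu, forall x, f (p n) x @[n --> \oo] --> g x}.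
  apply: filterS (integrable_ae measurableT si).
  move=> x /(_ I) sx.
  have cu : cvgn (fun k => f (p k) x).
    apply: (@cvg_of_weighted_sqr _ (fine (s x))) => n.
    rewrite -lee_fin fineK// -sumEFin -(big_mkord xpredT (fun k => h k x)).
    by apply: nneseries_lim_ge.
  have cE : (f (p k) x)%:E @[k --> \oo] --> (limn (fun k => f (p k) x))%:E by apply: cvg_EFin; [exact: nearW|exact: cu].
  by rewrite /g (cvg_limn_einf_sup cE).2/=.
exists g => // n.
apply: (@le_trans _ _ (\int[mu]_x limn_einf (fun k => ((f n x - f (p k) x) ^+ 2)%:E))%E).
  apply: ae_ge0_le_integral => //.
  - by move=> x _; rewrite lee_fin sqr_ge0.
  - exact: mfg.
  - by move=> x _; apply: limn_einf_ge0 => k; rewrite lee_fin sqr_ge0.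
  - rewrite (_ : (fun x => _) = fun x => (- limn_esup (fun k => - ((f n x - f (p k) x) ^+ 2)%:E))%E).
      apply: measurableT_comp => //; apply: measurable_fun_limn_esup => k.
      by apply: measurableT_comp => //; exact: msq.
    by apply/funext => x; rewrite limn_esupN oppeK.
  - apply: filterS cvgae; first exact: (ae_filter_ringOfSetsType mu).
    move=> x cx _; rewrite (cvg_limn_einf_sup (_ : _ --> ((f n x - g x) ^+ 2)%:E)).1//.
    apply: cvg_EFin; first exact: nearW.
    have cd : f n x - f (p k) x @[k --> \oo] --> f n x - g x by apply: cvgB => //; exact: cvg_cst.
    exact: (cvgM cd cd).
apply: (le_trans (fatou mu measurableT _ _)).
- by move=> k; exact: msq.
- by move=> k x _; rewrite lee_fin sqr_ge0.
apply: limn_einf_le => k; exists (k + n)%N; first exact: leq_addr.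
apply: le_trans (fe n (p (k + n)%N) (leq_trans (leq_addl _ _) (pk _))).
rewrite le_eqVlt; apply/orP; left; apply/eqP; apply: eq_integral => x _.
by rewrite -sqrrN opprB.
Qed.

End RieszFischer.

Section Truncation.
Variable R : realType.
Notation mu := (@lebesgue_measure R).
Notation itg D f := (mu.-integrable D (EFin \o (f : R -> R))).
Implicit Types (n m : nat).

Definition trunc n (a : R -> R) (x : R) : R := if - n%:R <= x <= n%:R then a x else 0.

Definition tail (a : R -> R) n : R := \int[mu]_x (a x - trunc n a x) ^+ 2.

Variable a : R -> R.
Hypotheses (ma : measurable_fun setT a) (a2 : itg setT (fun x => a x ^+ 2)).

Let truncE n x : trunc n a x = \1_(`[- n%:R, n%:R]%classic) x * a x.
Proof. by rewrite /trunc indicE mem_itvcc; case: ifP => _; rewrite ?mul1r ?mul0r. Qed.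

Lemma measurable_trunc n : measurable_fun setT (trunc n a).
Proof.
rewrite (_ : trunc n a = fun x => \1_(`[- n%:R, n%:R]%classic) x * a x); last exact/funext/truncE.
by apply: measurable_funM => //; exact: measurable_indic.
Qed.

Lemma trunc_sqr_le n x : (trunc n a x) ^+ 2 <= a x ^+ 2.
Proof. by rewrite /trunc; case: ifP => // _; rewrite expr0n sqr_ge0. Qed.

Lemma itg_trunc n : itg setT (fun x => trunc n a x ^+ 2).
Proof.
apply: (itg_le _ _ _ a2) => //; first by apply: measurable_funX; exact: measurable_trunc.
by move=> x _; rewrite ger0_norm ?sqr_ge0// trunc_sqr_le.
Qed.

Lemma compact_L2_trunc n : compact_L2 n%:R (trunc n a).
Proof.
split; [exact: measurable_trunc|exact: itg_trunc|].
by move=> x /negbTE; rewrite /trunc => ->.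
Qed.

Let truncB_sqr_le n m x : (trunc m a x - trunc n a x) ^+ 2 <= a x ^+ 2.
Proof.
rewrite /trunc; case: ifP => _; case: ifP => _; rewrite ?subrr ?subr0 ?sub0r ?sqrrN// expr0n sqr_ge0//.
Qed.

Lemma compact_L2_truncB n m : (n <= m)%N -> compact_L2 m%:R (fun x => trunc m a x - trunc n a x).
Proof.
move=> nm; have mB : measurable_fun setT (fun x => trunc m a x - trunc n a x).
  by apply: measurable_funB; exact: measurable_trunc.
split=> //.
- apply: (itg_le _ _ _ a2) => //; first by apply: measurable_funX.
  by move=> x _; rewrite ger0_norm ?sqr_ge0// truncB_sqr_le.
- move=> x xm; rewrite /trunc (negbTE xm); case: ifP => [|_]; last by rewrite subrr.
  have : (n%:R : R) <= m%:R by rewrite ler_nat.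
  move: xm; rewrite negb_and -!ltNge => /orP[xm nm' /andP[nx xn]|xm nm' /andP[nx xn]]; exfalso; lra.
Qed.

Lemma itg_tail n : itg setT (fun x => (a x - trunc n a x) ^+ 2).
Proof.
apply: (itg_le _ _ _ a2) => //.
  by apply: measurable_funX; apply: measurable_funB => //; exact: measurable_trunc.
move=> x _; rewrite ger0_norm ?sqr_ge0// /trunc; case: ifP => _; rewrite ?subr0//.
by rewrite subrr expr0n/= sqr_ge0.
Qed.

Lemma tail_ge0 n : 0 <= tail a n.
Proof. by apply: Rintegral_ge0 => x _; exact: sqr_ge0. Qed.

Lemma tail_decr n m : (n <= m)%N -> tail a m <= tail a n.
Proof.
move=> nm; apply: le_Rintegral => //; [exact: itg_tail|exact: itg_tail|move=> x _].
have nm' : (n%:R : R) <= m%:R by rewrite ler_nat.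
rewrite /trunc; case: ifP => [_|mx]; first by rewrite subrr expr0n sqr_ge0.
case: ifP => // /andP[nx xn]; move/negbT: mx; rewrite negb_and -!ltNge => /orP[]; lra.
Qed.

Lemma truncB_le_tail n m : (n <= m)%N -> \int[mu]_x (trunc m a x - trunc n a x) ^+ 2 <= tail a n.
Proof.
move=> nm; have [_ i _] := compact_L2_truncB nm.
apply: le_Rintegral => //; first exact: itg_tail.
move=> x _; have nm' : (n%:R : R) <= m%:R by rewrite ler_nat.
rewrite /trunc; case: ifP => [_|mx]; first by case: ifP => // _; rewrite subrr.
case: ifP => [/andP[nx xn]|_]; last by rewrite subrr expr0n/= subr0 sqr_ge0.
by move/negbT: mx; rewrite negb_and -!ltNge => /orP[]; lra.
Qed.

Lemma tail_cvg0 : tail a @ \oo --> 0.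
Proof.
have H : (\int[mu]_x ((a x - trunc n a x) ^+ 2)%:E @[n --> \oo] --> \int[mu]_(x in setT) (cst 0 x))%E.
  apply: (@dominated_cvg _ _ _ mu setT _ _ _ (fun x => (a x ^+ 2)%:E)) => //.
  - by move=> n; exact: (measurable_int mu (itg_tail n)).
  - move=> x _; rewrite /cst; apply: cvg_near_cst; near=> n.
    rewrite /trunc ifT ?subrr ?expr0n// -ler_norml; near: n.
    exists (Num.truncn `|x|).+1 => // n /= xn.
    by rewrite ltW// (lt_le_trans (truncnS_gt _))// ler_nat.
  - move=> n x _; rewrite gee0_abs ?lee_fin ?sqr_ge0// /trunc; case: ifP => _; rewrite ?subr0//.
    by rewrite subrr expr0n/= sqr_ge0.
rewrite integral_cst// mul0e in H.
exact: fine_cvg H.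
Unshelve. all: by end_near. Qed.

End Truncation.

Section PairSpectrum.
Variable R : realType.
Notation mu := (@lebesgue_measure R).
Notation itg D f := (mu.-integrable D (EFin \o (f : R -> R))).
Implicit Types (a b : R -> R).

(** 2 pi times the squared modulus of the Fourier transform of a + i b *)
Definition pair_spectrum a b (eta : R) : R :=
  (fcos a eta + fsin b eta) ^+ 2 + (fcos b eta - fsin a eta) ^+ 2.

Lemma pair_spectrum_ge0 a b eta : 0 <= pair_spectrum a b eta.
Proof. by rewrite addr_ge0// sqr_ge0. Qed.

Lemma pair_spectrum_sym a b eta : itg setT a -> itg setT b ->
  pair_spectrum a b eta + pair_spectrum a b (- eta) =
  2 * power_spectrum a eta + 2 * power_spectrum b eta.
Proof.
have cN c : fcos c (- eta) = fcos c eta by apply: eq_Rintegral => x _; rewrite mulNr cosN.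
have sN c : itg setT c -> fsin c (- eta) = - fsin c eta.
  move=> ci; rewrite -[RHS]mulN1r /fsin -RintegralZl//; last exact: itg_sin.
  by apply: eq_Rintegral => x _; rewrite mulNr sinN mulN1r mulrN.
by move=> ai bi; rewrite /pair_spectrum /power_spectrum !cN !sN//; ring.
Qed.

Lemma measurable_pair_spectrum a b : itg setT a -> itg setT b -> measurable_fun setT (pair_spectrum a b).
Proof.
move=> ai bi; apply: measurable_funD; apply: measurable_funX.
  by apply: measurable_funD; [exact: measurable_fcos|exact: measurable_fsin].
by apply: measurable_funB; [exact: measurable_fcos|exact: measurable_fsin].
Qed.

(** Reflecting the negative frequencies removes the cross terms. *)
Lemma integral_pair_spectrum a b (w : R -> R) : itg setT a -> itg setT b ->
  measurable_fun setT w -> (forall x, 0 <= w x) -> (forall x, w (- x) = w x) ->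
  (\int[mu]_eta (pair_spectrum a b eta * w eta)%:E =
   2%:E * (\int[mu]_(eta in `[0%R, +oo[) (power_spectrum a eta * w eta)%:E +
           \int[mu]_(eta in `[0%R, +oo[) (power_spectrum b eta * w eta)%:E))%E.
Proof.
move=> ai bi mw w0 wN; pose F (eta : R) : \bar R := (pair_spectrum a b eta * w eta)%:E.
have mF : measurable_fun setT F.
  by apply/measurable_EFinP; apply: measurable_funM => //; exact: measurable_pair_spectrum.
have F0 eta : (0 <= F eta)%E by rewrite lee_fin mulr_ge0// pair_spectrum_ge0.
have mps c : itg setT c -> measurable_fun (`[0%R, +oo[%classic : set R) (fun eta => (power_spectrum c eta * w eta)%:E).
  move=> ci; apply/measurable_EFinP; apply: measurable_funS (measurable_funM (measurable_power_spectrum ci) mw) => //.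
have ps0 c eta : (0 <= (power_spectrum c eta * w eta)%:E)%E by rewrite lee_fin mulr_ge0// power_spectrum_ge0.
have dj : [disjoint (`[0%R, +oo[%classic : set R) & (`]-oo, 0%R[%classic : set R)].
  by apply/disj_setPS => x [/=]; rewrite !in_itv/= andbT => x0 x1; move: (le_lt_trans x0 x1); rewrite ltxx.
have EU : (\int[mu]_eta F eta = \int[mu]_(eta in `[0%R, +oo[) F eta + \int[mu]_(eta in `]-oo, 0%R[) F eta)%E.
  rewrite -(ge0_integral_setU (mu : {measure set _ -> \bar R}) (measurable_itv _) (measurable_itv _) _ _ dj)//.
  - by rewrite -setCitvr setUv.
  - exact: measurable_funS mF.
rewrite -/F EU.
rewrite [X in (_ + X)%E]integral_itv_bndo_bndc; last exact: measurable_funS mF.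
have mFN : measurable_fun setT (fun eta : R => F (- eta)) by apply: measurableT_comp mF _; exact: oppr_measurable.
have -> : (\int[mu]_(x in `]-oo, 0%R]) F x = \int[mu]_(x in `]-oo, 0%R]) F (- - x)%R)%E.
  by apply: eq_integral => x _; rewrite opprK.
rewrite -(@ge0_integration_by_substitution0 _ (fun eta : R => F (- eta)))//.
rewrite -ge0_integralD//; [|exact: measurable_funS mF|exact: measurable_funS mFN].
rewrite -ge0_integralD//; [|exact: mps|exact: mps].
rewrite -ge0_integralZl//; [|by apply: emeasurable_funD; exact: mps|by move=> x _; rewrite adde_ge0].
apply: eq_integral => x _; rewrite /F wN -!EFinD -mulrDl pair_spectrum_sym// -EFinM.
by congr EFin; ring.
Qed.

End PairSpectrum.

Section FourierL2.
Variable R : realType.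
Notation mu := (@lebesgue_measure R).
Notation itg D f := (mu.-integrable D (EFin \o (f : R -> R))).
Local Notation Re := complex.Re.
Local Notation Im := complex.Im.
Local Notation normc := ComplexField.Normc.normc.

Lemma fcosB (a b : R -> R) eta : itg setT a -> itg setT b ->
  fcos (fun x => a x - b x) eta = fcos a eta - fcos b eta.
Proof.
move=> ai bi; rewrite /fcos -RintegralB//; [|exact: itg_cos|exact: itg_cos].
by apply: eq_Rintegral => x _; rewrite mulrBl.
Qed.

Lemma fsinB (a b : R -> R) eta : itg setT a -> itg setT b ->
  fsin (fun x => a x - b x) eta = fsin a eta - fsin b eta.
Proof.
move=> ai bi; rewrite /fsin -RintegralB//; [|exact: itg_sin|exact: itg_sin].
by apply: eq_Rintegral => x _; rewrite mulrBl.
Qed.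

Variable q : R -> R[i].
Hypothesis qL : is_L2 q.
Let a x := Re (q x).
Let b x := Im (q x).
Let F n := fourier_integral `[- n%:R, n%:R] q.
Let sc : R := (Num.sqrt (2 * pi))^-1.

Let ma : measurable_fun setT a. Proof. by case: (is_L2_components qL). Qed.
Let mb : measurable_fun setT b. Proof. by case: (is_L2_components qL). Qed.
Let a2 : itg setT (fun x => a x ^+ 2). Proof. by case: (is_L2_components qL). Qed.
Let b2 : itg setT (fun x => b x ^+ 2). Proof. by case: (is_L2_components qL). Qed.
Let cA n : compact_L2 n%:R (trunc n a). Proof. exact: compact_L2_trunc. Qed.
Let cB n : compact_L2 n%:R (trunc n b). Proof. exact: compact_L2_trunc. Qed.
Let aI n : itg setT (trunc n a). Proof. exact: compact_L2_itg (cA n). Qed.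
Let bI n : itg setT (trunc n b). Proof. exact: compact_L2_itg (cB n). Qed.

Let sc2 : sc ^+ 2 = (2 * pi)^-1.
Proof. by rewrite /sc exprVn sqr_sqrtr// mulr_ge0// pi_ge0. Qed.

Let sc2_le1 : sc ^+ 2 <= 1.
Proof. by rewrite sc2 invf_le1; have := @pi_ge2 R; lra. Qed.

Let Rint_truncD n (u : R -> R) :
  \int[mu]_(x in `[- n%:R, n%:R]) u x = \int[mu]_x (if - n%:R <= x <= n%:R then u x else 0).
Proof. by rewrite Rintegral_mkcond; apply: eq_Rintegral => x _; rewrite patchE mem_itvcc. Qed.

Let ReF n eta : Re (F n eta) = sc * (fcos (trunc n a) eta + fsin (trunc n b) eta).
Proof.
rewrite /F /fourier_integral /cintegral /= mul0r subr0; congr (_ * _).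
rewrite /fcos /fsin -RintegralD//; [|exact: itg_cos|exact: itg_sin].
rewrite Rint_truncD; apply: eq_Rintegral => x _; rewrite /trunc /a /b.
case: ifP => _; last by rewrite !mul0r addr0.
by rewrite /cis; case: (q x) => u v /=; rewrite cosN sinN mulrN opprK.
Qed.

Let ImF n eta : Im (F n eta) = sc * (fcos (trunc n b) eta - fsin (trunc n a) eta).
Proof.
rewrite /F /fourier_integral /cintegral /= mul0r addr0; congr (_ * _).
rewrite /fcos /fsin -RintegralB//; [|exact: itg_cos|exact: itg_sin].
rewrite Rint_truncD; apply: eq_Rintegral => x _; rewrite /trunc /a /b.
case: ifP => _; last by rewrite !mul0r subr0.
by rewrite /cis; case: (q x) => u v /=; rewrite cosN sinN mulrN addrC.
Qed.

Let mF n : cmeasurable (F n).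
Proof.
split.
  rewrite (_ : (fun x => _) = fun eta => sc * (fcos (trunc n a) eta + fsin (trunc n b) eta)); last first.
    by apply/funext => eta; rewrite ReF.
  by apply: measurable_funM => //; apply: measurable_funD; [exact: measurable_fcos|exact: measurable_fsin].
rewrite (_ : (fun x => _) = fun eta => sc * (fcos (trunc n b) eta - fsin (trunc n a) eta)); last first.
  by apply/funext => eta; rewrite ImF.
by apply: measurable_funM => //; apply: measurable_funB; [exact: measurable_fcos|exact: measurable_fsin].
Qed.

Let tau n : R := 48 * (tail a n + tail b n).

Let tau_ge0 n : 0 <= tau n.
Proof. by rewrite mulr_ge0// addr_ge0// tail_ge0. Qed.

Let tau_decr n m : (n <= m)%N -> tau m <= tau n.
Proof. by move=> nm; rewrite ler_wpM2l// lerD// tail_decr. Qed.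

Let tau_cvg : tau @ \oo --> 0.
Proof.
rewrite (_ : 0 = 48 * (0 + 0) :> R); last by rewrite addr0 mulr0.
by apply: cvgM; [exact: cvg_cst|apply: cvgD; exact: tail_cvg0].
Qed.

(** Bessel's inequality makes the truncated transforms a Cauchy sequence. *)
Let cauchyF n m : (n <= m)%N ->
  (\int[mu]_eta ((Re (F m eta) - Re (F n eta)) ^+ 2 + (Im (F m eta) - Im (F n eta)) ^+ 2)%:E <= (tau n)%:E)%E.
Proof.
move=> nm; pose u x := trunc m a x - trunc n a x; pose v x := trunc m b x - trunc n b x.
have cu : compact_L2 m%:R u := compact_L2_truncB ma a2 nm.
have cv : compact_L2 m%:R v := compact_L2_truncB mb b2 nm.
have ui := compact_L2_itg cu; have vi := compact_L2_itg cv.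
have m0 : 0 <= (m%:R : R) by [].
apply: (@le_trans _ _ (\int[mu]_eta (pair_spectrum u v eta * 1)%:E)%E).
  apply: ge0_le_integral => //.
  - by move=> eta _; rewrite lee_fin addr_ge0// sqr_ge0.
  - apply/measurable_EFinP; have [mr mi] := mF n; have [mr' mi'] := mF m.
    by apply: measurable_funD; apply: measurable_funX; apply: measurable_funB.
  - by apply/measurable_EFinP; apply: measurable_funM => //; exact: measurable_pair_spectrum.
  - move=> eta _; rewrite lee_fin mulr1 !ReF !ImF -!mulrBr !exprMn -mulrDr /pair_spectrum !fcosB// !fsinB//.
    rewrite -[leRHS]mul1r; apply: ler_pM => //; [exact: sqr_ge0|by rewrite addr_ge0// sqr_ge0|].
    by rewrite le_eqVlt; apply/orP; left; apply/eqP; congr (_ ^+ 2 + _ ^+ 2); ring.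
rewrite integral_pair_spectrum//.
under eq_integral do rewrite mulr1.
under [X in (_ + X)%E]eq_integral do rewrite mulr1.
apply: (@le_trans _ _ (2%:E * ((24 * \int[mu]_x u x ^+ 2)%:E + (24 * \int[mu]_x v x ^+ 2)%:E))%E).
  by rewrite lee_pmul2l//; apply: leeD; [exact: bessel cu|exact: bessel cv].
have Hu : \int[mu]_x u x ^+ 2 <= tail a n by exact: truncB_le_tail.
have Hv : \int[mu]_x v x ^+ 2 <= tail b n by exact: truncB_le_tail.
by rewrite -EFinD -EFinM lee_fin /tau; move: Hu Hv; move: (Rintegral _ _ _) (Rintegral _ _ _) => X Y; lra.
Qed.

Let exists_limit : exists G : R -> R[i], cmeasurable G /\
  forall n, (\int[mu]_eta (normc (F n eta - G eta) ^+ 2)%:E <= (2 * tau n)%:E)%E.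
Proof.
have H1 n m : (n <= m)%N -> (\int[mu]_x ((Re (F m x) - Re (F n x)) ^+ 2)%:E <= (tau n)%:E)%E.
  move=> nm; apply: le_trans (cauchyF nm); have [mr mi] := mF n; have [mr' mi'] := mF m.
  apply: ge0_le_integral => //.
  - by move=> x _; rewrite lee_fin sqr_ge0.
  - by apply/measurable_EFinP; apply: measurable_funX; apply: measurable_funB.
  - by apply/measurable_EFinP; apply: measurable_funD; apply: measurable_funX; apply: measurable_funB.
  - by move=> x _; rewrite lee_fin lerDl sqr_ge0.
have H2 n m : (n <= m)%N -> (\int[mu]_x ((Im (F m x) - Im (F n x)) ^+ 2)%:E <= (tau n)%:E)%E.
  move=> nm; apply: le_trans (cauchyF nm); have [mr mi] := mF n; have [mr' mi'] := mF m.
  apply: ge0_le_integral => //.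
  - by move=> x _; rewrite lee_fin sqr_ge0.
  - by apply/measurable_EFinP; apply: measurable_funX; apply: measurable_funB.
  - by apply/measurable_EFinP; apply: measurable_funD; apply: measurable_funX; apply: measurable_funB.
  - by move=> x _; rewrite lee_fin lerDr sqr_ge0.
have [g mg Hg] := riesz_fischer (fun n => (mF n).1) tau_ge0 tau_cvg tau_decr H1.
have [h mh Hh] := riesz_fischer (fun n => (mF n).2) tau_ge0 tau_cvg tau_decr H2.
exists (fun x => (g x +i* h x)%C); split; first by split.
move=> n; have [mr mi] := mF n.
rewrite (_ : (fun eta => _) = fun eta => (((Re (F n eta) - g eta) ^+ 2)%:E + ((Im (F n eta) - h eta) ^+ 2)%:E)%E); last first.
  by apply/funext => eta; rewrite normc_sqr -EFinD; case: (F n eta) => u v.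
rewrite ge0_integralD//.
- by rewrite mulr_natl mulr2n EFinD; apply: leeD.
- by move=> x _; rewrite lee_fin sqr_ge0.
- by apply/measurable_EFinP; apply: measurable_funX; apply: measurable_funB.
- by move=> x _; rewrite lee_fin sqr_ge0.
- by apply/measurable_EFinP; apply: measurable_funX; apply: measurable_funB.
Qed.

Let normc_add_le (z w : R[i]) : normc z ^+ 2 <= 2 * normc w ^+ 2 + 2 * normc (w - z) ^+ 2.
Proof.
rewrite !normc_sqr; case: z => z1 z2; case: w => w1 w2 /=.
have := sqr_ge0 (2 * w1 - z1); have := sqr_ge0 (2 * w2 - z2).
by rewrite !expr2; nra.
Qed.

Let L2norm_le f (e : R) : 0 <= e -> (\int[mu]_x (normc (f x) ^+ 2)%:E <= (e ^+ 2)%:E)%E ->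
  (L2norm f <= e%:E)%E.
Proof.
move=> e0; rewrite -L2norm_sqr; have := L2norm_ge0 f.
case: (L2norm f) => [x x0|_|//]; last by rewrite poweRyr.
rewrite lee_fin in x0.
by rewrite poweR_EFin powR_mulrn// !lee_fin ler_pXn2r// nnegrE.
Qed.

Let L2norm_cvg0 (f : nat -> R -> R[i]) : L2norm (f n) @[n --> \oo] --> 0%E ->
  (\int[mu]_x (normc (f n x) ^+ 2)%:E)%E @[n --> \oo] --> 0%E.
Proof.
move=> /fine_cvgP[ffin fcvg].
have c2 : (fine (L2norm (f n)) ^+ 2)%:E @[n --> \oo] --> (0 * 0 : R)%:E.
  by apply: cvg_EFin; [exact: nearW|exact: (cvgM fcvg fcvg)].
rewrite mulr0 in c2; apply: cvg_trans c2; apply: near_eq_cvg.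
apply: filterS ffin => n fn; rewrite -L2norm_sqr -[in RHS](fineK fn) poweR_EFin powR_mulrn//.
by rewrite fine_ge0// L2norm_ge0.
Qed.

Let cmeasurableB (f g : R -> R[i]) : cmeasurable f -> cmeasurable g -> cmeasurable (fun x => f x - g x).
Proof.
move=> [fr fi] [gr gi]; split.
  rewrite (_ : (fun x => _) = (fun x => Re (f x) - Re (g x))); first exact: measurable_funB.
  by apply/funext => x; case: (f x); case: (g x).
rewrite (_ : (fun x => _) = (fun x => Im (f x) - Im (g x))); first exact: measurable_funB.
by apply/funext => x; case: (f x); case: (g x).
Qed.

Let F0 eta : F 0 eta = 0.
Proof.
rewrite /F /fourier_integral /cintegral oppr0 set_itv1 !Rintegral_set1.
by rewrite [X in _ * X](_ : _ = 0)// mulr0.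
Qed.

(** The Fourier transform of a square-integrable function exists, so the chosen representative is one. *)
Lemma is_fourier_fourier : is_fourier q (fourier q).
Proof.
have [G [mG HG]] := exists_limit.
apply: (@xgetPex _ (cst 0) [set fhat | is_fourier q fhat]); exists G; split.
  apply/is_L2P; split => //; apply/integrableP; split.
    by apply/measurable_EFinP; exact: measurable_normc_sqr.
  under eq_integral do rewrite /= ger0_norm ?sqr_ge0//.
  apply: le_lt_trans (ltry (2 * tau 0)); apply: le_trans (HG 0%N).
  rewrite le_eqVlt; apply/orP; left; apply/eqP; apply: eq_integral => eta _.
  by rewrite F0 !normc_sqr; case: (G eta) => u v /=; rewrite !sub0r !sqrrN.
apply: (@squeeze_cvge _ _ _ _ (cst 0%E) _ (fun n => (Num.sqrt (2 * tau n))%:E)).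
- apply: nearW => n; rewrite /cst L2norm_ge0/=; apply: L2norm_le; first exact: sqrtr_ge0.
  by rewrite sqr_sqrtr; [exact: HG|exact: mulr_ge0].
- exact: cvg_cst.
- apply: cvg_EFin; first exact: nearW.
  have ct : 2 * tau n @[n --> \oo] --> (2 * 0 : R) by apply: cvgM; [exact: cvg_cst|exact: tau_cvg].
  rewrite mulr0 in ct; rewrite -[X in _ --> X]sqrtr0.
  exact: (cvg_comp (fun n => 2 * tau n) Num.sqrt ct (@sqrt_continuous _ 0)).
Qed.

Let weight_bounds (x : R) : 0 < 1 + x ^+ 2 /\ (1 + x ^+ 2)^-1 <= 1.
Proof.
have x0 : 0 <= x ^+ 2 := sqr_ge0 x.
by split; [lra|rewrite invf_le1; lra].
Qed.

Lemma measurable_H1_weight : measurable_fun setT (fun x : R => (1 + x ^+ 2)^-1).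
Proof.
apply: continuous_measurable_fun => x; apply: cvgV; first by rewrite gt_eqF//; case: (weight_bounds x).
by apply: cvgD; [exact: cvg_cst|exact: exprn_continuous].
Qed.

Definition fourier_error n : \bar R := (\int[mu]_eta (normc (fourier_integral `[- n%:R, n%:R] q eta - fourier q eta) ^+ 2)%:E)%E.

Lemma fourier_error_cvg0 : fourier_error n @[n --> \oo] --> 0%E.
Proof. by apply: L2norm_cvg0; case: is_fourier_fourier. Qed.

(** The H^-1 norm of a truncation is a spectral energy. *)
Lemma integral_trunc_spectrum n :
  (\int[mu]_eta (normc (F n eta) ^+ 2 / (1 + eta ^+ 2))%:E =
   pi^-1%:E * (spectral_energy (trunc n a) + spectral_energy (trunc n b)))%E.
Proof.
transitivity (\int[mu]_eta ((2 * pi)^-1%:E * (pair_spectrum (trunc n a) (trunc n b) eta * (1 + eta ^+ 2)^-1)%:E))%E.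
  apply: eq_integral => eta _; rewrite normc_sqr ReF ImF !exprMn -mulrDr sc2 -EFinM mulrA//.
rewrite ge0_integralZl//.
- rewrite integral_pair_spectrum//.
  + rewrite muleA -EFinM; congr (_%:E * _)%E; move: (pi : R) (pi_gt0 R) => p p0; field; rewrite gt_eqF//.
  + exact: measurable_H1_weight.
  + by move=> x; rewrite invr_ge0 ltW//; case: (weight_bounds x).
  + by move=> x; rewrite sqrrN.
- by apply/measurable_EFinP; apply: measurable_funM; [exact: measurable_pair_spectrum|exact: measurable_H1_weight].
- by move=> x _; rewrite lee_fin mulr_ge0 ?pair_spectrum_ge0// invr_ge0 ltW//; case: (weight_bounds x).
- by rewrite lee_fin invr_ge0 mulr_ge0// pi_ge0.
Qed.

Let weighted_le (f g : R -> R[i]) : cmeasurable f -> cmeasurable g ->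
  (\int[mu]_eta (normc (f eta) ^+ 2 / (1 + eta ^+ 2))%:E <=
   2%:E * \int[mu]_eta (normc (g eta) ^+ 2 / (1 + eta ^+ 2))%:E +
   2%:E * \int[mu]_eta (normc (g eta - f eta) ^+ 2)%:E)%E.
Proof.
move=> mf mg; have w0 x : 0 <= (1 + x ^+ 2 : R)^-1 by rewrite invr_ge0 ltW//; case: (weight_bounds x).
have mw (f' : R -> R[i]) : cmeasurable f' -> measurable_fun setT (fun x => (normc (f' x) ^+ 2 / (1 + x ^+ 2))%:E).
  by move=> mf'; apply/measurable_EFinP; apply: measurable_funM; [exact: measurable_normc_sqr|exact: measurable_H1_weight].
have md : measurable_fun setT (fun x => (normc (g x - f x) ^+ 2)%:E).
  by apply/measurable_EFinP; apply: (@measurable_normc_sqr _ (fun x => g x - f x)); exact: cmeasurableB.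
rewrite -!ge0_integralZl//; last 3 first.
- by move=> x _; rewrite lee_fin sqr_ge0.
- exact: mw.
- by move=> x _; rewrite lee_fin mulr_ge0// sqr_ge0.
rewrite -ge0_integralD//; last 4 first.
- by move=> x _; rewrite -EFinM lee_fin mulr_ge0// mulr_ge0// sqr_ge0.
- by apply: measurable_funeM; exact: mw.
- by move=> x _; rewrite -EFinM lee_fin mulr_ge0// sqr_ge0.
- exact: measurable_funeM.
apply: ge0_le_integral => //.
- by move=> x _; rewrite lee_fin mulr_ge0// sqr_ge0.
- exact: mw.
- by apply: emeasurable_funD; apply: measurable_funeM => //; exact: mw.
- move=> x _; rewrite -!EFinM -EFinD lee_fin; have [wp w1] := weight_bounds x.
  have := ler_wpM2r (w0 x) (normc_add_le (f x) (g x)); rewrite mulrDl -2!(mulrA 2) => H; apply: (le_trans H).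
  by rewrite lerD2l; apply: ler_wpM2l => //; apply: ler_piMr => //; exact: sqr_ge0.
Qed.

Lemma Hm1norm_le n : (Hm1norm_sqr q <=
  2%:E * (pi^-1%:E * (spectral_energy (trunc n a) + spectral_energy (trunc n b))) + 2%:E * fourier_error n)%E.
Proof.
rewrite -integral_trunc_spectrum; apply: weighted_le; last exact: mF.
by case: is_fourier_fourier => -[].
Qed.

Lemma spectral_energy_le n :
  (pi^-1%:E * (spectral_energy (trunc n a) + spectral_energy (trunc n b)) <=
   2%:E * Hm1norm_sqr q + 2%:E * fourier_error n)%E.
Proof.
rewrite -integral_trunc_spectrum /fourier_error.
have -> : (\int[mu]_eta (normc (fourier_integral `[- n%:R, n%:R] q eta - fourier q eta) ^+ 2)%:E =
  \int[mu]_eta (normc (fourier q eta - F n eta) ^+ 2)%:E)%E.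
  apply: eq_integral => x _; rewrite !normc_sqr -/(F n x).
  by case: (fourier q x) => u v; case: (F n x) => u' v' /=; congr EFin; ring.
apply: weighted_le; first exact: mF.
by case: is_fourier_fourier => -[].
Qed.

End FourierL2.

Section TruncatedWindows.
Variable R : realType.
Notation mu := (@lebesgue_measure R).
Notation itg D f := (mu.-integrable D (EFin \o (f : R -> R))).
Implicit Types (a b : R -> R).

Lemma eq_window_osc s a b : (forall x, s <= x <= s + 2 -> a x = b x) -> window_osc s a = window_osc s b.
Proof.
move=> ab; rewrite /window_osc; apply: eq_Rintegral => y; rewrite mem_itvcc => /andP[sy ys].
apply: eq_Rintegral => x; rewrite mem_itvcc => /andP[yx xs]; congr (_ ^+ 2).
apply: eq_Rintegral => t; rewrite mem_itvcc => /andP[yt tx]; apply: ab.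
by rewrite (le_trans sy yt) (le_trans tx xs).
Qed.

Lemma window_osc_trunc n s a : - n%:R <= s -> s + 2 <= n%:R -> window_osc s (trunc n a) = window_osc s a.
Proof.
move=> ns sn; apply: eq_window_osc => x /andP[sx xs].
by rewrite /trunc (le_trans ns sx) (le_trans xs sn).
Qed.

Lemma window_osc_le_sqr s b : measurable_fun setT b -> itg setT (fun x => b x ^+ 2) ->
  window_osc s b <= 8 * \int[mu]_(x in `[s, s + 2]) b x ^+ 2.
Proof.
move=> mb b2; set B := Rintegral _ _ _.
have s2 : s <= s + 2 by rewrite lerDl.
have ib2 (u v : R) : itg `[u, v] (fun x => b x ^+ 2).
  by apply: itg_mono b2 => //; exact: measurable_itv.
have B0 : 0 <= B by apply: Rintegral_ge0 => x _; exact: sqr_ge0.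
have inner y x : s <= y -> y <= x -> x <= s + 2 -> (\int[mu]_(t in `[y, x]) b t) ^+ 2 <= 2 * B.
  move=> sy yx xs.
  have i1 : itg `[y, x] (fun z => (cst (1 : R)) z ^+ 2) by exact: (itg_cst y x (1 ^+ 2)).
  have H := cauchy_schwarz (measurable_itv `[y, x]) (measurable_cst (1 : R)) (measurable_funTS mb) i1 (ib2 y x).
  have E1 : \int[mu]_(z in `[y, x]) (cst (1 : R) z * b z) = \int[mu]_(z in `[y, x]) b z.
    by apply: eq_Rintegral => z _; rewrite /cst mul1r.
  have E2 : \int[mu]_(z in `[y, x]) (cst (1 : R) z ^+ 2) = x - y.
    by rewrite /cst expr1n Rint_itv// mul1r.
  rewrite E1 E2 in H; apply: (le_trans H).
  have HB : \int[mu]_(t in `[y, x]) b t ^+ 2 <= B.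
    apply: le_Rint_sub; [exact: measurable_itv|exact: measurable_itv| |exact: ib2|by move=> z _; exact: sqr_ge0].
    by move=> z; rewrite /= !in_itv/= => /andP[yz zx]; rewrite (le_trans sy yz) (le_trans zx xs).
  by apply: ler_pM => //; [lra|apply: Rintegral_ge0 => z _; exact: sqr_ge0|lra].
have [P cP HP] := local_primitive s (s + 2) mb b2.
have iinner y : s <= y -> itg `[y, s + 2] (fun x => (\int[mu]_(t in `[y, x]) b t) ^+ 2).
  move=> sy; apply: (@eq_integrable _ _ _ mu _ (measurable_itv _) (EFin \o (fun x => (P x - P y) ^+ 2))).
    by move=> x; rewrite mem_itvcc => /andP[yx xs] /=; rewrite HP.
  apply: itg_cont; apply: continuous_subspaceT => x.
  apply: (@continuous_comp _ _ _ (fun x => P x - P y) (fun z => z ^+ 2)).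
    by apply: cvgB; [exact: cP|exact: cvg_cst].
  exact: exprn_continuous.
apply: (@le_trans _ _ (\int[mu]_(y in `[s, s + 2]) (4 * B))).
  apply: le_Rintegral => //; [exact: itg_window_osc|exact: itg_cst|].
  move=> y; rewrite /= in_itv/= => /andP[sy ys].
  apply: (@le_trans _ _ (\int[mu]_(x in `[y, s + 2]) (2 * B))).
    apply: le_Rintegral => //; [exact: iinner|exact: itg_cst|].
    by move=> x; rewrite /= in_itv/= => /andP[yx xs]; exact: inner.
  by rewrite Rint_itv//; nra.
by rewrite Rint_itv//; lra.
Qed.

(** Windows that meet the complement of [- m, m] only carry mass of the tail. *)
Lemma window_osc_le_tail m n s a : measurable_fun setT a -> itg setT (fun x => a x ^+ 2) ->
  (forall x, s <= x <= s + 2 -> ~~ (- m%:R <= x <= m%:R)) ->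
  window_osc s (trunc n a) <= 8 * tail a m.
Proof.
move=> ma a2 out; apply: le_trans (window_osc_le_sqr _ (measurable_trunc ma n) (itg_trunc ma a2 n)) _.
rewrite ler_pM2l//; apply: (@le_trans _ _ (\int[mu]_(x in `[s, s + 2]) (a x - trunc m a x) ^+ 2)).
  apply: le_Rintegral => //.
  - by apply: itg_mono (itg_trunc ma a2 n) => //; exact: measurable_itv.
  - by apply: itg_mono (itg_tail ma a2 m) => //; exact: measurable_itv.
  - move=> x; rewrite /= in_itv/= => /out xm.
    by rewrite [in leRHS]/trunc (negbTE xm) subr0 trunc_sqr_le.
by apply: le_Rint_sub => //; [exact: itg_tail|move=> x _; exact: sqr_ge0].
Qed.

End TruncatedWindows.


Section TruncatedEnergy.
Variable R : realType.
Notation mu := (@lebesgue_measure R).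
Notation itg D f := (mu.-integrable D (EFin \o (f : R -> R))).

(** The integers k with [k, k + 2] inside [- m - 2, m + 2] *)
Definition inner_windows (m : nat) : seq int := [seq i%:Z - m.+2%:Z | i <- iota 0 (2 * m + 3)].

Let sum3 (x y z w : R) : x <= 8 * w -> y <= 8 * w -> z <= 8 * w -> x + y + z <= 24 * w.
Proof. by lra. Qed.

Let mem_inner m (k : int) : (k \in inner_windows m) = (- m.+2%:Z <= k <= m%:Z).
Proof.
apply/mapP/idP => [|km]; first by case=> j; rewrite mem_iota => jm ->; lia.
by exists (absz (k + m.+2%:Z)); rewrite ?mem_iota; lia.
Qed.

Lemma uniq_inner_windows m : uniq (inner_windows m).
Proof. by rewrite map_inj_uniq ?iota_uniq// => i j; lia. Qed.

Lemma energy_trunc_le (c : R -> R) m : measurable_fun setT c -> itg setT (fun x => c x ^+ 2) ->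
  (spectral_energy (trunc m.+2 c) <=
   288%:E * ((24 * tail c m)%:E + \sum_(k <- inner_windows m) (window_osc k%:~R c)%:E))%E.
Proof.
move=> mc c2; pose F := [:: - m.+3%:Z, m.+1%:Z, m.+2%:Z & inner_windows m].
have uF : uniq F by rewrite /= uniq_inner_windows !inE !mem_inner; lia.
have m20 : 0 <= (m.+2%:R : R) by [].
have Fcov (k : int) : - (m.+2%:R : R) - 2 < (k%:~R : R) <= m.+2%:R -> k \in F.
  have -> : - (m.+2%:R : R) - 2 = (- m.+4%:Z)%:~R by rewrite intrN -[m.+4]addn2 [in RHS]PoszD intrD; ring.
  by rewrite ltr_int -[m.+2%:R]/(m.+2%:Z%:~R) ler_int !inE mem_inner; lia.
apply: (le_trans (energy_le_sum_window_osc m20 (compact_L2_trunc mc c2 m.+2) uF Fcov)).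
apply: lee_wpmul2l; [by rewrite lee_fin ler0n|rewrite /F !big_cons].
have out (s : R) : (s + 2 < - m%:R \/ m%:R < s) -> window_osc s (trunc m.+2 c) <= 8 * tail c m.
  move=> sm; apply: window_osc_le_tail => // x /andP[sx xs]; apply/negP => /andP[mx xm].
  by case: sm => sm; lra.
have posz_intr (n : nat) : (n%:Z)%:~R = n%:R :> R by [].
have m1 : (m.+1%:R : R) = m%:R + 1 by rewrite -natr1.
have m2 : (m.+2%:R : R) = m%:R + 2 by rewrite -natr1 m1; ring.
have m3 : (m.+3%:R : R) = m%:R + 3 by rewrite -natr1 m2; ring.
have o1 : window_osc (- m.+3%:Z)%:~R (trunc m.+2 c) <= 8 * tail c m.
  by apply: out; left; rewrite intrN posz_intr m3 opprD -addrA gtrDl; lra.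
have o2 : window_osc m.+1%:Z%:~R (trunc m.+2 c) <= 8 * tail c m.
  by apply: out; right; rewrite posz_intr m1 ltrDl.
have o3 : window_osc m.+2%:Z%:~R (trunc m.+2 c) <= 8 * tail c m.
  by apply: out; right; rewrite posz_intr m2 ltrDl.
rewrite !addeA; apply: leeD; first by rewrite -!EFinD lee_fin; exact: sum3 o1 o2 o3.
rewrite [leLHS]big_seq [leRHS]big_seq; apply: lee_sum => k; rewrite mem_inner => /andP[k1 k2].
rewrite lee_fin window_osc_trunc//.
  by rewrite -posz_intr -intrN ler_int.
by rewrite m2 lerD2r -posz_intr ler_int.
Qed.

End TruncatedEnergy.

Section Comparison.
Variable R : realType.
Notation mu := (@lebesgue_measure R).
Variables (q : R -> R[i]) (N : R -> 'M[R]_2).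
Hypotheses (qL : is_L2 q) (Nsol : is_fundamental_solution (Qmx q) N).
Let r := fine (L2norm q).
Let a x := complex.Re (q x).
Let b x := complex.Im (q x).
Let t (k : int) : R := \det (mxintegral `[k%:~R, (k + 2)%:~R] (fun x => (N x)^T *m N x)) - 4.

Let ma : measurable_fun setT a. Proof. by case: (is_L2_components qL). Qed.
Let mb : measurable_fun setT b. Proof. by case: (is_L2_components qL). Qed.
Let a2 := let: And4 _ _ h _ := is_L2_components qL in h.
Let b2 := let: And4 _ _ _ h := is_L2_components qL in h.

Let intr2 (k : int) : (k + 2)%:~R = k%:~R + 2 :> R. Proof. by rewrite intrD. Qed.

Let t_ge0 k : 0 <= t k. Proof. by rewrite /t intr2; exact: (det_window_ge0 Nsol). Qed.

Let osc_le_t k : window_osc k%:~R a + window_osc k%:~R b <= (1 + 16 * r ^+ 4) * t k.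
Proof. by rewrite /t intr2; exact: window_osc_le_det. Qed.

Let t_le_osc k : t k <= (16 + 64 * expR (4 * r + 1) ^+ 2 * r ^+ 2) * (window_osc k%:~R a + window_osc k%:~R b).
Proof. by rewrite /t intr2; exact: det_le_window_osc. Qed.

Let pi0 : 0 < (pi : R). Proof. exact: pi_gt0. Qed.

Let sum_le_mul (c : R) (u v w : int -> R) (F : seq int) :
  (forall k, k \in F -> u k <= c * (v k + w k)) ->
  (\sum_(k <- F) (u k)%:E <= c%:E * (\sum_(k <- F) (v k)%:E + \sum_(k <- F) (w k)%:E))%E.
Proof.
move=> H; rewrite !sumEFin -EFinD -EFinM lee_fin -big_split mulr_sumr.
by rewrite [leLHS]big_seq [leRHS]big_seq; exact: ler_sum.
Qed.

Let mul_sum_ge (c : R) (u v w : int -> R) (F : seq int) : (forall k, v k + w k <= c * u k) ->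
  (\sum_(k <- F) (v k)%:E + \sum_(k <- F) (w k)%:E <= c%:E * \sum_(k <- F) (u k)%:E)%E.
Proof.
move=> H; rewrite !sumEFin -EFinD -EFinM lee_fin -big_split mulr_sumr.
by apply: ler_sum => k _; exact: H.
Qed.

Lemma Ktilde_le : (Ktilde N <= (256 * pi * (16 + 64 * expR (4 * r + 1) ^+ 2 * r ^+ 2))%:E * Hm1norm_sqr q)%E.
Proof.
set K := 16 + _; have K0 : 0 <= K by rewrite addr_ge0// mulr_ge0 ?sqr_ge0// mulr_ge0// sqr_ge0.
have E0 := fourier_error_cvg0 qL.
rewrite /Ktilde -/t; apply: ge_ereal_sup => _ [X [Xfin _] <-].
rewrite fsbig_finite//; set F : seq int := finmap.enum_fset _.
have uF : uniq F by exact: finmap.fset_uniq.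
have Fbound : exists m : nat, forall k, k \in F -> - m%:R <= (k%:~R : R) /\ (k%:~R : R) + 2 <= m%:R.
  exists (\sum_(k <- F) (`|k| + 2))%N => k kF.
  have : (`|k| + 2 <= \sum_(k <- F) (`|k| + 2))%N by rewrite (big_rem k)//= leq_addr.
  rewrite -(ler_nat R) natrD natr_absz intr_norm => H; have := lexx `|k%:~R : R|.
  by rewrite ler_norml => /andP[H1 H2]; split; lra.
have [m Hm] := Fbound.
have bound n : (m <= n)%N -> (\sum_(k <- F) (t k)%:E <=
    (K * 128 * pi)%:E * (2%:E * Hm1norm_sqr q + 2%:E * fourier_error q n))%E.
  move=> mn; have mn' : (m%:R : R) <= n%:R by rewrite ler_nat.
  have n0 : 0 <= (n%:R : R) by [].
  have HF : (\sum_(k <- F) (t k)%:E <= K%:E * (\sum_(k <- F) (window_osc k%:~R (trunc n a))%:E +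
      \sum_(k <- F) (window_osc k%:~R (trunc n b))%:E))%E.
    apply: sum_le_mul => k kF; have [k1 k2] := Hm k kF.
    have ka : - n%:R <= (k%:~R : R) by lra.
    have kb : (k%:~R : R) + 2 <= n%:R by lra.
    by rewrite !(window_osc_trunc _ ka kb); exact: t_le_osc.
  apply: (le_trans HF); rewrite -mulrA EFinM -muleA; apply: lee_wpmul2l; first by rewrite lee_fin.
  have Ha := sum_window_osc_le n0 (compact_L2_trunc ma a2 n) uF.
  have Hb := sum_window_osc_le n0 (compact_L2_trunc mb b2 n) uF.
  apply: (le_trans (leeD Ha Hb)).
  have e0 (c : R -> R) : (0 <= spectral_energy c)%E.
    by apply: integral_ge0 => x _; rewrite lee_fin mulr_ge0 ?power_spectrum_ge0// invr_ge0 addr_ge0// sqr_ge0.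
  rewrite -(ge0_muleDr _ (e0 _) (e0 _)) EFinM -muleA lee_pmul2l//.
  have Hs := spectral_energy_le qL n.
  have piE (x : \bar R) : x = (pi%:E * (pi^-1%:E * x))%E.
    by rewrite muleA -EFinM divff ?mul1e// lt0r_neq0.
  by rewrite [leLHS]piE lee_pmul2l//; exact: Hs.
have cvgE : ((K * 128 * pi)%:E * (2%:E * Hm1norm_sqr q + 2%:E * fourier_error q n))%E @[n --> \oo] -->
    ((K * 128 * pi)%:E * (2%:E * Hm1norm_sqr q + 2%:E * 0))%E.
  apply: cvgeZl => //; apply: cvgeD; [by rewrite mule0 fin_num_adde_defl|exact: cvg_cst|].
  by apply: cvgeZl.
have H : (\sum_(k <- F) (t k)%:E <= (K * 128 * pi)%:E * (2%:E * Hm1norm_sqr q + 2%:E * 0))%E.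
  apply: (cvge_to_ge cvgE); exists m; first by []; move=> p /=; exact: bound.
apply: (le_trans H); rewrite mule0 adde0 muleA -EFinM le_eqVlt; apply/orP; left; apply/eqP.
by congr (_%:E * _)%E; ring.
Qed.

Let sum_t_le (F : seq int) : uniq F -> (\sum_(k <- F) (t k)%:E <= Ktilde N)%E.
Proof.
move=> uF; rewrite /Ktilde -/t; apply: esum_ge; exists [set` F]; first by split; [exact: finite_seq|].
by rewrite -fsbig_seq.
Qed.

Let regroup (x y : R) (u v : int -> R) (F : seq int) (T : \bar R) :
  (\sum_(k <- F) (u k)%:E + \sum_(k <- F) (v k)%:E <= T ->
   288%:E * ((24 * x)%:E + \sum_(k <- F) (u k)%:E) + 288%:E * ((24 * y)%:E + \sum_(k <- F) (v k)%:E) <=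
   288%:E * (T + 24%:E * (x + y)%:E))%E.
Proof.
rewrite !sumEFin; move: (\sum_(k <- F) u k) (\sum_(k <- F) v k) => U V H.
apply: (@le_trans _ _ (288%:E * (U%:E + V%:E + 24%:E * (x + y)%:E))%E).
  by rewrite -!EFinM -!EFinD lee_fin; lra.
by apply: lee_wpmul2l; [rewrite lee_fin ler0n|exact: leeD].
Qed.

Let cvg_shift2 (u : nat -> \bar R) (l : \bar R) : u n @[n --> \oo] --> l -> u n.+2 @[n --> \oo] --> l.
Proof.
move=> ul; apply: (@cvg_comp _ _ _ (fun n => n.+2) u _ \oo) ul => P [n _ nP].
by exists n => // k /= nk; apply: nP => /=; rewrite (leq_trans nk)// -addn2 leq_addr.
Qed.

Let Ktilde_ge0 : (0 <= Ktilde N)%E.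
Proof. by apply: esum_ge0 => k _; rewrite lee_fin; exact: t_ge0. Qed.

Let distribute (c P z : R) : 0 <= P -> 0 <= z ->
  (c%:E * (288%:E * (P%:E * Ktilde N + 24%:E * z%:E)) = (c * 288 * P)%:E * Ktilde N + (c * 288 * 24)%:E * z%:E)%E.
Proof.
move=> P0 z0; rewrite muleA -EFinM -EFinM muleDr// ?muleA -?EFinM ?mulrA//.
by rewrite fin_num_adde_defl.
Qed.

Lemma Hm1norm_le_Ktilde : (Hm1norm_sqr q <= (576 / pi * (1 + 16 * r ^+ 4))%:E * Ktilde N)%E.
Proof.
set P := 1 + 16 * r ^+ 4; have P0 : 0 <= P by rewrite addr_ge0// mulr_ge0// exprn_even_ge0.
pose B m := ((576 / pi * P)%:E * Ktilde N + ((576 / pi * 24)%:E * (tail a m + tail b m)%:E + 2%:E * fourier_error q m.+2))%E.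
have bound m : (Hm1norm_sqr q <= B m)%E.
  apply: (le_trans (Hm1norm_le qL m.+2)); rewrite /B [leRHS]addeA; apply: leeD; last exact: lexx.
  have Ha := energy_trunc_le m ma a2; have Hb := energy_trunc_le m mb b2.
  rewrite muleA -EFinM.
  have HG : (\sum_(k <- inner_windows m) (window_osc k%:~R a)%:E + \sum_(k <- inner_windows m) (window_osc k%:~R b)%:E <= P%:E * Ktilde N)%E.
    apply: (@le_trans _ _ (P%:E * \sum_(k <- inner_windows m) (t k)%:E)%E).
      by apply: mul_sum_ge => k; exact: osc_le_t.
    by apply: lee_wpmul2l; [rewrite lee_fin|exact/sum_t_le/uniq_inner_windows].
  apply: (@le_trans _ _ ((2 / pi)%:E * (288%:E * (P%:E * Ktilde N + 24%:E * (tail a m + tail b m)%:E)))%E).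
    apply: lee_wpmul2l; first by rewrite lee_fin divr_ge0// ltW.
    apply: (le_trans (leeD Ha Hb)).
    exact: (regroup (tail a m) (tail b m) HG).
  have tt : 0 <= tail a m + tail b m by rewrite addr_ge0// tail_ge0.
  rewrite (distribute _ P0 tt).
  have -> : 2 / pi * 288 = 576 / pi :> R by move: (pi : R) pi0 => p p0; field; exact: lt0r_neq0.
  exact: lexx.
have cvgB : B m @[m --> \oo] --> ((576 / pi * P)%:E * Ktilde N + ((576 / pi * 24)%:E * (0 + 0)%:E + 2%:E * 0))%E.
  have ct : (tail a m + tail b m)%:E @[m --> \oo] --> (0 + 0 : R)%:E.
    by apply: cvg_EFin; [exact: nearW|apply: cvgD; exact: tail_cvg0].
  have ce : fourier_error q m.+2 @[m --> \oo] --> 0%E.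
    by apply: cvg_shift2; exact: fourier_error_cvg0 qL.
  apply: cvgeD; [by rewrite addr0 !mule0 adde0 fin_num_adde_defl|exact: cvg_cst|].
  by apply: cvgeD; [rewrite addr0 !mule0|exact: cvgeZl|exact: cvgeZl].
have := cvge_to_ge cvgB (nearW _ bound).
by rewrite addr0 !mule0 !adde0; apply.
Qed.

End Comparison.

Theorem theorem4p1 (R : realType) :
  exists c C C1 C2 : R,
    [/\ 0 < c, 0 < C, 0 < C1 & 0 < C2] /\
    forall (q : R -> R[i]) (N : R -> 'M[R]_2),
      is_L2 q ->
      is_fundamental_solution (Qmx q) N ->
      let r := fine (L2norm q) in
      ((c * expR (- (C1 * r)))%:E * Hm1norm_sqr q <= Ktilde N)%E /\
      (Ktilde N <= (C * expR (C2 * r))%:E * Hm1norm_sqr q)%E.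
Proof.
have pi0 : 0 < (pi : R) := pi_gt0 R.
have n0 n : 0 < (n.+1%:R : R) := ltr0Sn R n.
have n576 : 0 < (576 : R) := n0 575%N.
have n17 : 0 < (17 : R) := n0 16%N.
have n256 : 0 < (256 : R) := n0 255%N.
have n16 : 0 < (16 : R) := n0 15%N.
have n64 : 0 < (64 : R) := n0 63%N.
have c0 : 0 < pi / (576 * 17) :> R := divr_gt0 pi0 (mulr_gt0 n576 n17).
have d0 : 0 < 256 * pi :> R := mulr_gt0 n256 pi0.
pose e2 : R := expR 1 ^+ 2.
exists (pi / (576 * 17)), (256 * pi * (16 + 64 * e2)), 4, 10; split.
  have e20 : 0 < e2 by rewrite exprn_gt0// expR_gt0.
  by split; [exact: c0|exact/mulr_gt0/addr_gt0/mulr_gt0|exact: n0 3%N|exact: n0 9%N].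
move=> q N qL Nsol r.
have r0 : 0 <= r by rewrite fine_ge0// L2norm_ge0.
have er : 1 + r <= expR r := expR_ge1Dx r.
have e1 : 1 <= expR r by lra.
have re : r <= expR r by lra.
have H0 : (0 <= Hm1norm_sqr q)%E.
  apply: integral_ge0 => x _; rewrite lee_fin divr_ge0 ?sqr_ge0//.
  by rewrite addr_ge0// sqr_ge0.
have T0 : (0 <= Ktilde N)%E.
  by apply: esum_ge0 => k _; rewrite lee_fin intrD; exact: det_window_ge0 Nsol _.
have e4E : expR (4 * r) = expR r ^+ 4 by rewrite -expRM_natl.
split.
- have ce0 : 0 <= pi / (576 * 17) * expR (- (4 * r)) := mulr_ge0 (ltW c0) (expR_ge0 _).
  have H := Hm1norm_le_Ktilde qL Nsol.
  apply: (le_trans (lee_wpmul2l _ H)); first by rewrite lee_fin.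
  rewrite muleA -EFinM -[leRHS]mul1e; apply: lee_wpmul2r => //; rewrite lee_fin.
  rewrite expRN e4E -/r; set x := expR r in er e1 re *.
  have x4 : 0 < x ^+ 4 by rewrite exprn_gt0// (lt_le_trans _ e1).
  have -> : pi / (576 * 17) / x ^+ 4 * (576 / pi * (1 + 16 * r ^+ 4)) = (1 + 16 * r ^+ 4) / (17 * x ^+ 4).
    move: (pi : R) pi0 => p p0; move: (x ^+ 4) x4 => y y0.
    by field; rewrite !gt_eqF.
  rewrite (ler_pdivrMr _ _ (mulr_gt0 n17 x4)) mul1r.
  have : r ^+ 4 <= x ^+ 4 by rewrite lerXn2r// nnegrE (le_trans r0).
  have : 1 <= x ^+ 4 by rewrite exprn_ege1.
  lra.
- apply: (le_trans (Ktilde_le qL Nsol)); apply: lee_wpmul2r => //; rewrite lee_fin -/r.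
  rewrite -[leRHS]mulrA; apply: ler_wpM2l; first exact: ltW.
  rewrite expRD e4E (_ : expR (10 * r) = expR r ^+ 10); last by rewrite -expRM_natl.
  set x := expR r in er e1 re *; rewrite exprMn -/e2.
  have -> : (16 + 64 * e2) * x ^+ 10 = 16 * x ^+ 10 + 64 * ((x ^+ 4) ^+ 2 * e2) * x ^+ 2 by ring.
  have e20 : 0 <= e2 by rewrite sqr_ge0.
  apply: lerD; first by rewrite ler_peMr// exprn_ege1.
  apply: ler_wpM2l; first by apply: mulr_ge0; [exact: ltW|rewrite mulr_ge0// sqr_ge0].
  by rewrite lerXn2r// nnegrE (le_trans r0).
Qed.
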